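(* Let $N\ge2$, $\theta>0$, $a_-,a_+\in\mathbb R$ with $a_-<a_+$, and let $V^t,V^b$ be analytic in a neighborhood $\mathcal M\subseteq\mathbb C$ of $[a_-,a_+]$ and real-valued on $\mathcal M\cap\mathbb R$. Suppose $(X_1,\dots,X_N,Y_1,\dots,Y_{N-1})$ is a random vector in $\mathbb R^{2N-1}$ with density $$f(x,y)=\frac1{Z^c}\prod_{1\le i<j\le N}(x_j-x_i)\prod_{1\le i<j\le N-1}(y_j-y_i)\prod_{i=1}^{N-1}\prod_{j=1}^N|y_i-x_j|^{\theta-1}\prod_{i=1}^{N-1}e^{-N\theta V^b(y_i)}\prod_{i=1}^Ne^{-N\theta V^t(x_i)}$$ supported on $\mathcal G=\{(x,y)\in\mathbb R^{2N-1}:a_-<x_1<y_1<x_2<y_2<\cdots<y_{N-1}<x_N<a_+\}$, where $Z^c$ is the normalization constant making the integral of $f$ over $\mathcal G$ equal to $1$. Let $G^t(z)=\sum_{i=1}^N\frac1{z-X_i}$ and $G^b(z)=\sum_{i=1}^{N-1}\frac1{z-Y_i}$. Let $v\in\mathbb C\setminus[a_-,a_+]$ and let $\Gamma$ be a positively oriented contour inside $\mathcal M$ that contains the segment $[a_-,a_+]$ in its interior and excludes $v$. Then $$0=\frac{N\theta}{2\pi\mathrm i}\int_\Gamma\frac{dz\,(z-a_-)(z-a_+)}{(z-v)(v-a_-)(v-a_+)}\Big[\mathbb E[G^t(z)]\,\partial_zV^t(z)+\mathbb E[G^b(z)]\,\partial_zV^b(z)\Big]+\frac{\mathbb E[G^t(v)^2]}2+\frac{\mathbb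 E[G^b(v)^2]}2$$ $$-\frac{\partial_v\mathbb E[G^t(v)]+\partial_v\mathbb E[G^b(v)]}2-(1-\theta)\,\mathbb E[G^t(v)G^b(v)]-\frac{N^2-(1-\theta)N(N-1)}{(v-a_-)(v-a_+)}.$$
   Context: $\mathrm i=\sqrt{-1}$; $\mathbb E$ is expectation with respect to the law of $(X_1,\dots,X_N,Y_1,\dots,Y_{N-1})$.
   Formalization: The contour Γ is required to lie in M together with its interior, since otherwise the potentials could have singularities enclosed by Γ and the identity would fail; ''contour'' is taken to be a simple closed piecewise C¹ curve. *)

(* Defs.v *)
From HB Require Import structures.
From mathcomp Require Import all_boot all_order all_algebra complex.
From mathcomp Require Import all_classical all_reals all_analysis.
Set Implicit Arguments.
Unset Strict Implicit.
Unset Printing Implicit Defensive.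
Set Warnings "-redundant-canonical-projection".
Import Order.TTheory GRing.Theory Num.Theory.
Import numFieldNormedType.Exports.
Local Open Scope classical_set_scope.
Local Open Scope ring_scope.
Local Open Scope complex_scope.

(* The modulus topology; the library provides it only on the alias R[i]^o. *)
HB.instance Definition _ (R : rcfType) := NormedModule.copy R[i] R[i]^o.

Section LebesgueTuple.
Context {R : realType}.

Definition cons_pair n (p : R * n.-tuple R) : n.+1.-tuple R :=
  [tuple of p.1 :: p.2].

Definition lebesgue_cons n (mu : set (n.-tuple R) -> \bar R) :
    set (n.+1.-tuple R) -> \bar R :=
  pushforward (lebesgue_measure \x mu)%E (@cons_pair n).

(* Lebesgue measure on R^n, built as the image of the product measure under
   the identification of R * R^n with R^(n+1). *)
Fixpoint lebesgue_tuple n : set (n.-tuple R) -> \bar R :=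
  if n is k.+1 then lebesgue_cons (@lebesgue_tuple k) else \d_[tuple].
Arguments lebesgue_tuple : clear implicits.

Lemma measurable_cons_pair n :
  measurable_fun [set: R * n.-tuple R] (@cons_pair n).
Proof. exact: measurable_cons. Qed.

Lemma measurable_uncons n :
  measurable_fun [set: n.+1.-tuple R]
    (fun t => (thead t, [tuple of behead t] : n.-tuple R)).
Proof.
apply/measurable_fun_pair; first exact: measurable_tnth.
exact: measurable_behead.
Qed.

Lemma uncons_pairK n (p : R * n.-tuple R) :
  (thead (cons_pair p), [tuple of behead (cons_pair p)]) = p.
Proof. by case: p => x t; congr pair; apply/val_inj. Qed.

Section Step.
Local Open Scope ereal_scope.
Variables (n : nat) (mu : {sigma_finite_measure set (n.-tuple R) -> \bar R}).

Let cons0 : lebesgue_cons mu set0 = 0.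
Proof. by rewrite /lebesgue_cons /pushforward preimage_set0 measure0. Qed.

Let cons_ge0 A : 0 <= lebesgue_cons mu A.
Proof. by rewrite /lebesgue_cons /pushforward; exact: measure_ge0. Qed.

Let cons_sigma_additive : semi_sigma_additive (lebesgue_cons mu).
Proof.
have mc (A : set (n.+1.-tuple R)) :
    measurable A -> measurable (@cons_pair n @^-1` A).
  by move=> mA; rewrite -[X in measurable X]setTI; exact: measurable_cons_pair.
move=> F mF tF mUF; rewrite /lebesgue_cons /pushforward preimage_bigcup.
apply: measure_semi_sigma_additive.
- by move=> i; exact: mc.
- apply/trivIsetP => /= i j _ _ ij; rewrite -preimage_setI.
  by move/trivIsetP : tF => /(_ _ _ _ _ ij) ->//; rewrite preimage_set0.
- by rewrite -preimage_bigcup; exact: mc.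
Qed.

HB.instance Definition _ := isMeasure.Build _ _ _ (lebesgue_cons mu)
  cons0 cons_ge0 cons_sigma_additive.

Let cons_sigma_finite : sigma_finite setT (lebesgue_cons mu).
Proof.
have /sigma_finiteP[F [TF ndF Foo]] :=
  sigma_finiteT (@lebesgue_measure R).
have /sigma_finiteP[G [TG ndG Goo]] := sigma_finiteT mu.
have UFG : \bigcup_i (F i `*` G i) = setT.
  rewrite -subTset => -[x t] _.
  have [i _ Fix] : (\bigcup_i F i) x by rewrite -TF.
  have [j _ Gjt] : (\bigcup_i G i) t by rewrite -TG.
  exists (maxn i j) => //; split => /=.
    by move: x Fix; exact/subsetPset/ndF/leq_maxl.
  by move: t Gjt; exact/subsetPset/ndG/leq_maxr.
pose u (t : n.+1.-tuple R) := (thead t, [tuple of behead t] : n.-tuple R).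
exists (fun i => u @^-1` (F i `*` G i)).
  by rewrite -preimage_bigcup UFG preimage_setT.
move=> i; have [mF Fi] := Foo i; have [mG Gi] := Goo i; split.
  by rewrite -[X in measurable X]setTI; apply: measurable_uncons => //;
    exact: measurableX.
rewrite /lebesgue_cons /pushforward.
rewrite (_ : _ @^-1` _ = F i `*` G i); last first.
  by apply/funext => p; rewrite /preimage /mkset [u _]uncons_pairK.
by rewrite product_measure1E// lte_mul_pinfty// ge0_fin_numE.
Qed.

HB.instance Definition _ := Measure_isSigmaFinite.Build _ _ _
  (lebesgue_cons mu) cons_sigma_finite.

End Step.

Lemma lebesgue_tuple_measure n :
  {mu : {sigma_finite_measure set (n.-tuple R) -> \bar R} |
    mu = lebesgue_tuple n :> (set (n.-tuple R) -> \bar R)}.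
Proof.
elim: n => [|n [mu mun]]; first by exists \d_[tuple].
by exists (lebesgue_cons mu); rewrite /= mun.
Qed.

Section Instances.
Local Open Scope ereal_scope.
Variable n : nat.

Let tuple0 : lebesgue_tuple n set0 = 0.
Proof. by case: (lebesgue_tuple_measure n) => mu <-. Qed.

Let tuple_ge0 A : 0 <= lebesgue_tuple n A.
Proof. by case: (lebesgue_tuple_measure n) => mu <-. Qed.

Let tuple_sigma_additive : semi_sigma_additive (lebesgue_tuple n).
Proof.
case: (lebesgue_tuple_measure n) => mu <-; exact: measure_semi_sigma_additive.
Qed.

HB.instance Definition _ := isMeasure.Build _ _ _ (lebesgue_tuple n)
  tuple0 tuple_ge0 tuple_sigma_additive.

Let tuple_sigma_finite : sigma_finite setT (lebesgue_tuple n).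
Proof. case: (lebesgue_tuple_measure n) => mu <-; exact: sigma_finiteT. Qed.

HB.instance Definition _ := Measure_isSigmaFinite.Build _ _ _
  (lebesgue_tuple n) tuple_sigma_finite.

End Instances.

Lemma lebesgue_tuple_box n (A : 'I_n -> set R) :
    (forall i, measurable (A i)) ->
  (lebesgue_tuple n [set t | forall i, A i (tnth t i)] =
    \prod_(i < n) lebesgue_measure (A i))%E.
Proof.
elim: n A => [|n IHn] A mA.
  rewrite big_ord0 /= diracE mem_set//; by case.
rewrite big_ord_recl -IHn//= /lebesgue_cons /pushforward.
rewrite -product_measure1E//; last first.
  rewrite (_ : [set _ | _] = \bigcap_(i in [set: 'I_n])
      ((@tnth n R ^~ i) @^-1` A (lift ord0 i))).
    apply: fin_bigcap_measurable => // i _.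
    by rewrite -[X in measurable X]setTI; exact: measurable_tnth.
  by apply/seteqP; split => t /= tA i *; exact: tA.
  exact: mA.
congr ((_ \x _)%E _); apply/seteqP; split => -[x t] /=.
  by move=> xtA; split => [|i]; [exact: (xtA ord0)|
    have := xtA (lift ord0 i); rewrite tnthS].
move=> [Ax tA] i; case: (unliftP ord0 i) => [j|] ->//.
by rewrite tnthS; exact: tA.
Qed.

End LebesgueTuple.
Arguments lebesgue_tuple {R} n A.

Section Complex.
Context {R : realType}.
Local Notation C := R[i].

Definition analytic_at (f : C -> C) (z0 : C) : Prop :=
  exists (a : nat -> C) (r : R), 0 < r /\
    forall z, `|z - z0| < r%:C ->
      series (fun n => a n * (z - z0) ^+ n) @ \oo --> f z.

Definition segment (a b : R) : set C := [set x%:C | x in `[a, b]].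

Definition C1 (g : R -> R) : Prop :=
  (forall t, derivable g t 1) /\ continuous (derive1 g).

(* h is the restriction to [a, b] of a C^1 function, hence has one-sided
   derivatives at the endpoints. *)
Definition C1_on (a b : R) (h : R -> R) : Prop :=
  exists2 g, C1 g & {in `[a, b], h =1 g}.

Definition piecewise_C1 (h : R -> R) : Prop :=
  exists s : seq R,
    [/\ path <%R 0 s, last 0 s = 1 &
        forall k, (k < size s)%N -> C1_on (nth 0 (0 :: s) k) (nth 0 s k) h].

Definition contour_image (gamma : R -> C) : set C := gamma @` `[0, 1].

Record contour (gamma : R -> C) : Prop := Contour {
  contour_Re : piecewise_C1 (fun t => complex.Re (gamma t));
  contour_Im : piecewise_C1 (fun t => complex.Im (gamma t));
  contour_closed : gamma 0 = gamma 1;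
  contour_simple : {in `[0, 1[ &, injective gamma} }.

Definition path_derive (gamma : R -> C) (t : R) : C :=
  derive1 (fun u => complex.Re (gamma u)) t +i*
  derive1 (fun u => complex.Im (gamma u)) t.

Definition Cintegral (D : set R) (f : R -> C) : C :=
  (\int[lebesgue_measure]_(t in D) complex.Re (f t)) +i*
  (\int[lebesgue_measure]_(t in D) complex.Im (f t)).

Definition contour_integral (gamma : R -> C) (f : C -> C) : C :=
  Cintegral `[0, 1] (fun t => f (gamma t) * path_derive gamma t).

(* Points in bounded components of the complement. The first conjunct is
   needed: connected_component is empty, hence bounded, on the contour. *)
Definition contour_interior (gamma : R -> C) : set C :=
  [set w | ~ contour_image gamma w /\
           bounded_set (connected_component (~` contour_image gamma) w)].

Definition winding_number (gamma : R -> C) (w : C) : C :=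
  (2 * 'i%C * pi%:C)^-1 * contour_integral gamma (fun z => (z - w)^-1).

(* The winding number is 1 (rather than -1) around the interior. *)
Definition positively_oriented (gamma : R -> C) : Prop :=
  forall w, contour_interior gamma w -> winding_number gamma w = 1.

Definition Cexpectation d (T : measurableType d) (P : probability T R)
    (Z : T -> C) : C :=
  fine ('E_P[fun w => complex.Re (Z w)])%E +i*
  fine ('E_P[fun w => complex.Im (Z w)])%E.

Definition stieltjes_sum n (x : n.-tuple R) (z : C) : C :=
  \sum_(i < n) (z - (tnth x i)%:C)^-1.

End Complex.

Section Ensemble.
Context {R : realType}.
Local Notation C := R[i].
Variables (N : nat) (theta am ap : R) (Vt Vb : C -> C).
Local Notation space := (N.-tuple R * N.-1.-tuple R)%type.

(* a_- < x_1 < y_1 < x_2 < ... < y_(N-1) < x_N < a_+, indices shifted to 0 *)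
Definition interlacing : set space := [set p : space |
  [/\ am < nth 0 p.1 0, nth 0 p.1 N.-1 < ap &
      forall i, (i < N.-1)%N ->
        nth 0 p.1 i < nth 0 p.2 i /\ nth 0 p.2 i < nth 0 p.1 i.+1]].

Definition vandermonde n (x : n.-tuple R) : R :=
  \prod_(i < n) \prod_(j < n | (i < j)%N) (tnth x j - tnth x i).

Definition weight (p : space) : R :=
  vandermonde p.1 * vandermonde p.2 *
  (\prod_(i < N.-1) \prod_(j < N)
     `|tnth p.2 i - tnth p.1 j| `^ (theta - 1)) *
  (\prod_(i < N.-1) expR (- (N%:R * theta * complex.Re (Vb (tnth p.2 i)%:C)))) *
  (\prod_(i < N) expR (- (N%:R * theta * complex.Re (Vt (tnth p.1 i)%:C)))).

Definition density (Zc : R) (p : space) : R :=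
  Zc^-1 * weight p * \1_interlacing p.

End Ensemble.
Arguments interlacing {R} N am ap.
Arguments weight {R} N theta Vt Vb p.
Arguments density {R} N theta am ap Vt Vb Zc p.

(* Main.v *)
Require Import Defs.
From HB Require Import structures.
From mathcomp Require Import all_boot all_order all_algebra complex.
From mathcomp Require Import all_classical all_reals all_analysis.
From mathcomp Require Import measurable_realfun.
From mathcomp Require Import ring lra.

(** The identity is the Schwinger-Dyson equation of the ensemble for the vector
    field h(x) = p(x) / ((v - x) p(v)), where p(z) = (z - a_-) (z - a_+).

    The field vanishes at both end points, so for small real eps the map
    x |-> x + eps h(x) (for the real or the imaginary part of h) is an
    increasing bijection of [a_-, a_+], and applying it to every coordinate maps
    the interlacing configurations onto themselves. The change of variables
    therefore preserves the total mass 1 of the density f. The difference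
    quotient q(x, y) = 1 / ((v - x) (v - y)) - 1 / p(v) of h is bounded: each
    difference of coordinates is multiplied by 1 + eps q, the Jacobian is a
    product of factors 1 + eps q(x, x), and the factors involving the potentials
    vary smoothly. Hence the transformed density is f (1 + eps D + o(eps)),
    uniformly over configurations, and comparing masses gives E[D] = 0
    ([real_loop_equation], [complex_loop_equation]). In this form no boundary
    term appears, and the singularities |y - x|^(theta - 1) with theta < 1
    never have to be differentiated.

    The sums of q over pairs of particles are polynomials in the Stieltjes
    transforms at v and their derivatives ([complex_loop_rateE],
    [derive_stieltjes]); they give every term of the identity except the contour
    integral. The latter is the contribution of the potentials: by Cauchy's
    formula the integral over Gamma of p(z) / ((z - v) p(v)) V'(z) / (z - x) is
    - 2 pi i h(x) V'(x) for x in [a_-, a_+] ([contour_kernel]), and Fubini's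
    theorem moves the expectation inside the integral ([contour_stieltjes]).

    A contour is a simple closed piecewise C^1 curve whose interior is the union
    of the bounded components of its complement. For such curves Cauchy's formula
    is proved by Dixon's method: the integral of (F(z) - F(w)) / (z - w), with
    F(w) replaced by 0 for w outside, is an entire function of w that vanishes
    at infinity, hence is zero ([entire_vanishing], [cauchy_formula]). To
    integrate power series along the contour, analyticity is expressed by Taylor
    polynomials with an error that is geometric in the degree ([taylor]). *)

Set Implicit Arguments.
Unset Strict Implicit.
Unset Printing Implicit Defensive.
Import Order.TTheory GRing.Theory Num.Theory.
Import numFieldNormedType.Exports.
Local Open Scope classical_set_scope.
Local Open Scope ring_scope.
Local Open Scope complex_scope.

(** * The modulus of a complex number *)

Section Modulus.
Context {R : realType}.
Local Notation C := R[i].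
Implicit Types (z w : C).

(** The norm of [R[i]] has values in [R[i]] itself; estimates compare real
    numbers. *)
Definition cabs z : R := complex.Re `|z|.

Lemma cabsE z : (cabs z)%:C = `|z|.
Proof. by rewrite /cabs normc_def. Qed.

Lemma cabsC z : cabs z = Num.sqrt (complex.Re z ^+ 2 + complex.Im z ^+ 2).
Proof. by rewrite /cabs normc_def. Qed.

Lemma cabs_ge0 z : 0 <= cabs z.
Proof. by rewrite cabsC sqrtr_ge0. Qed.

Lemma cabs0 : cabs 0 = 0.
Proof. by apply: (@complexI R); rewrite cabsE normr0. Qed.

Lemma cabsM z w : cabs (z * w) = cabs z * cabs w.
Proof. by apply: (@complexI R); rewrite rmorphM /= !cabsE normrM. Qed.

Lemma cabsV z : cabs z^-1 = (cabs z)^-1.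
Proof. by apply: (@complexI R); rewrite fmorphV /= !cabsE normfV. Qed.

Lemma cabsX z n : cabs (z ^+ n) = cabs z ^+ n.
Proof. by apply: (@complexI R); rewrite rmorphXn /= !cabsE normrX. Qed.

Lemma cabsN z : cabs (- z) = cabs z.
Proof. by apply: (@complexI R); rewrite !cabsE normrN. Qed.

Lemma cabs_distC z w : cabs (z - w) = cabs (w - z).
Proof. by rewrite -cabsN opprB. Qed.

Lemma cabsD z w : cabs (z + w) <= cabs z + cabs w.
Proof. by rewrite -lecR rmorphD /= !cabsE ler_normD. Qed.

Lemma cabsB z w : cabs (z - w) <= cabs z + cabs w.
Proof. by rewrite -(cabsN w) cabsD. Qed.

Lemma cabs_sub_le z w : cabs z - cabs w <= cabs (z - w).
Proof. by rewrite lerBlDr (le_trans _ (cabsD _ _))// subrK. Qed.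

Lemma cabs_eq0 z : (cabs z == 0) = (z == 0).
Proof. by rewrite -(inj_eq (@complexI R)) cabsE normr_eq0. Qed.

Lemma cabs_gt0 z : (0 < cabs z) = (z != 0).
Proof. by rewrite lt_def cabs_ge0 andbT cabs_eq0. Qed.

Lemma cabs_real (x : R) : cabs x%:C = `|x|.
Proof. by rewrite cabsC /= expr0n addr0 sqrtr_sqr. Qed.

Lemma Re_le_cabs z : `|complex.Re z| <= cabs z.
Proof. by rewrite cabsC -sqrtr_sqr ler_sqrt ?lerDl ?addr_ge0 ?sqr_ge0. Qed.

Lemma Im_le_cabs z : `|complex.Im z| <= cabs z.
Proof. by rewrite cabsC -sqrtr_sqr ler_sqrt ?lerDr ?addr_ge0 ?sqr_ge0. Qed.

Lemma cabs_le_ReIm z : cabs z <= `|complex.Re z| + `|complex.Im z|.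
Proof.
rewrite {1}(complexE z) (le_trans (cabsD _ _))// cabsM !cabs_real.
by rewrite [cabs 'i%C]cabsC /= expr0n /= add0r expr1n sqrtr1 mul1r.
Qed.

Lemma cabs_sum n (F : 'I_n -> C) : cabs (\sum_(i < n) F i) <= \sum_(i < n) cabs (F i).
Proof.
elim/big_ind2: _ => [|x1 x2 y1 y2 h1 h2|//]; first by rewrite cabs0.
by rewrite (le_trans (cabsD _ _))// lerD.
Qed.

Lemma sqr_cabs z : cabs z ^+ 2 = complex.Re z ^+ 2 + complex.Im z ^+ 2.
Proof. by rewrite cabsC sqr_sqrtr// addr_ge0 ?sqr_ge0. Qed.

Lemma ReD z w : complex.Re (z + w) = complex.Re z + complex.Re w.
Proof. by case: z; case: w. Qed.
Lemma ImD z w : complex.Im (z + w) = complex.Im z + complex.Im w.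
Proof. by case: z; case: w. Qed.
Lemma ReN z : complex.Re (- z) = - complex.Re z.
Proof. by case: z. Qed.
Lemma ImN z : complex.Im (- z) = - complex.Im z.
Proof. by case: z. Qed.
Lemma ReM z w : complex.Re (z * w) =
  complex.Re z * complex.Re w - complex.Im z * complex.Im w.
Proof. by case: z; case: w. Qed.
Lemma ImM z w : complex.Im (z * w) =
  complex.Re z * complex.Im w + complex.Im z * complex.Re w.
Proof. by case: z; case: w. Qed.
Lemma ReV z : complex.Re z^-1 = complex.Re z / cabs z ^+ 2.
Proof. by rewrite sqr_cabs; case: z. Qed.
Lemma ImV z : complex.Im z^-1 = - (complex.Im z / cabs z ^+ 2).
Proof. by rewrite sqr_cabs; case: z. Qed.
Lemma complexP z w : complex.Re z = complex.Re w ->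
  complex.Im z = complex.Im w -> z = w.
Proof. by case: z; case: w => a b c d /= -> ->. Qed.

Lemma pos_complexP (e : C) : 0 < e -> e = (complex.Re e)%:C /\ 0 < complex.Re e.
Proof.
rewrite ltcE => /andP[/eqP h1 h2]; split => //.
by apply: complexP.
Qed.

Lemma nbhs_cabsP z (A : set C) : nbhs z A <->
  exists2 r, 0 < r & forall u, cabs (u - z) < r -> A u.
Proof.
split.
  move/nbhs_ballP => [e /= e0 eA]; have [ee re] := pos_complexP e0.
  exists (complex.Re e) => // u zu; apply: eA.
  by rewrite -ball_normE /= ee -cabsE cabs_distC ltcR.
move=> [r r0 rA]; apply/nbhs_ballP; exists r%:C => /=; first by rewrite ltcR.
by move=> u; rewrite -ball_normE /= -cabsE ltcR cabs_distC; exact: rA.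
Qed.

Lemma cvg_cabsP (T : Type) (F : set_system T) (FF : Filter F) (f : T -> C) l :
  (f @ F --> l) <-> forall e : R, 0 < e -> \forall t \near F, cabs (f t - l) < e.
Proof.
split.
  move=> fl e e0; apply: (fl [set u | cabs (u - l) < e]).
  by apply/nbhs_cabsP; exists e.
move=> h A /nbhs_cabsP[r r0 rA]; near=> t; apply: rA; near: t; exact: h.
Unshelve. all: by end_near. Qed.

Lemma derive1_cabs (f : C -> C) z l :
  (forall e, 0 < e -> exists2 d, 0 < d & forall k, k != 0 -> cabs k < d ->
     cabs (f (k + z) - f z - l * k) <= e * cabs k) ->
  derive1 f z = l.
Proof.
move=> h; apply: cvg_lim; first exact: norm_hausdorff.
apply/cvg_cabsP => e e0.
have e20 : 0 < e / 2 by rewrite divr_gt0.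
have [d d0 hd] := h _ e20.
apply/nbhs_cabsP; exists d => // k; rewrite subr0 => kd k0.
have := hd _ k0 kd.
rewrite (_ : _ - _ - _ = k * (k^-1 *: (f (k + z) - f z) - l)); last first.
  by rewrite /GRing.scale /=; field.
rewrite cabsM mulrC ler_pM2r ?cabs_gt0// => /le_lt_trans; apply.
by rewrite ltr_pdivrMr// mulr2n; lra.
Qed.

Lemma derivable_cabs (f : R -> R) (x l : R) : is_derive x 1 f l ->
  forall e, 0 < e -> exists2 d, 0 < d & forall k, k != 0 -> `|k| < d ->
     `|f (k + x) - f x - l * k| <= e * `|k|.
Proof.
move=> [fx <-] e e0.
have /cvgrPdist_lt/(_ _ e0) := fx.
move=> /nbhs_ballP[d /= d0 hd]; exists d => // k k0 kd.
have := hd k; rewrite -ball_normE /= sub0r normrN => /(_ kd k0) h.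
rewrite (_ : _ - _ = - k * ('D_1 f x - k^-1 *: (f (k *: 1 + x) - f x))).
  by rewrite normrM normrN mulrC ler_wpM2r// ltW.
rewrite /GRing.scale /= mulr1; field.
exact: k0.
Qed.

Lemma continuous_from_cabs (f : C -> R) :
  (forall z e, 0 < e -> exists2 d, 0 < d &
     forall u, cabs (u - z) < d -> `|f z - f u| < e) -> continuous f.
Proof.
move=> h z; apply/(@cvgrPdist_lt _ _ _ (nbhs z) (nbhs_filter z)) => e e0.
by have [d d0 hd] := h z e e0; apply/nbhs_cabsP; exists d.
Qed.

Lemma continuous_cabs : continuous cabs.
Proof.
apply: continuous_from_cabs => z e e0; exists e => // u.
rewrite cabs_distC => zu; rewrite ltr_norml; apply/andP; split; last first.
  exact: le_lt_trans (cabs_sub_le _ _) zu.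
by rewrite ltrNl opprB (le_lt_trans (cabs_sub_le _ _))// cabs_distC.
Qed.

Lemma continuous_Re : continuous (@complex.Re R).
Proof.
apply: continuous_from_cabs => z e e0; exists e => // u.
by rewrite cabs_distC -ReN -ReD; exact/le_lt_trans/Re_le_cabs.
Qed.

Lemma continuous_Im : continuous (@complex.Im R).
Proof.
apply: continuous_from_cabs => z e e0; exists e => // u.
by rewrite cabs_distC -ImN -ImD; exact/le_lt_trans/Im_le_cabs.
Qed.

Lemma cvg_ReIm (T : Type) (F : set_system T) (FF : Filter F) (f : T -> C) l :
  (@complex.Re R \o f) @ F --> complex.Re l ->
  (@complex.Im R \o f) @ F --> complex.Im l -> f @ F --> l.
Proof.
move=> h1 h2; apply/cvg_cabsP => e e0; have e2 : 0 < e / 2 by rewrite divr_gt0.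
move/cvgrPdist_lt : h1 => /(_ _ e2) h1; move/cvgrPdist_lt : h2 => /(_ _ e2) h2.
near=> t; rewrite (le_lt_trans (cabs_le_ReIm _))// [ltRHS]splitr.
rewrite ReD ReN ImD ImN ltrD//.
  by rewrite distrC; near: t; exact: h1.
by rewrite distrC; near: t; exact: h2.
Unshelve. all: by end_near. Qed.

(** A closed disc is a closed subset of a compact square. *)
Lemma compact_disc (L : R) : compact [set z : C | cabs z <= L].
Proof.
pose sq := `[- L, L]%classic `*` `[- L, L]%classic : set (R * R).
have csq : compact sq by apply: compact_setX; exact: segment_compact.
pose g := fun p : R * R => p.1 +i* p.2.
have cg : continuous g.
  move=> p; apply: cvg_ReIm; [exact: cvg_fst|exact: cvg_snd].
have cgsq : compact (g @` sq).
  by apply: continuous_compact => //; exact: continuous_subspaceT.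
apply: (subclosed_compact _ cgsq).
  apply: (@closed_comp _ _ cabs [set x : R | x <= L]); last exact: closed_le.
  by move=> ? _; exact: continuous_cabs.
move=> z /= zL; exists (complex.Re z, complex.Im z); last by case: z {zL}.
split => /=; rewrite in_itv /= -ler_norml (le_trans _ zL)//.
  exact: Re_le_cabs.
exact: Im_le_cabs.
Qed.

End Modulus.

(** * Integrals of bounded measurable complex functions *)

Section ComplexIntegral.
Context {R : realType} d {T : measurableType d}.
Local Notation C := R[i].
Implicit Types (D : set T) (f g : T -> C).

Definition cmeas D f :=
  measurable_fun D (fun x => complex.Re (f x)) /\
  measurable_fun D (fun x => complex.Im (f x)).

Lemma cmeas_sub D D' f : measurable D -> D' `<=` D -> cmeas D f -> cmeas D' f.
Proof. by move=> mD DD [h1 h2]; split; [exact: measurable_funS h1|exact: measurable_funS h2]. Qed.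

Lemma cmeas_cst D (c : C) : cmeas D (fun=> c).
Proof. by split; exact: measurable_cst. Qed.

Lemma cmeas_real D (f : T -> R) : measurable_fun D f -> cmeas D (fun x => (f x)%:C).
Proof. by move=> mf; split => //=; exact: measurable_cst. Qed.

Lemma cmeasN D f : cmeas D f -> cmeas D (fun x => - f x).
Proof.
move=> [h1 h2]; split.
  by under eq_fun do rewrite ReN; exact: measurable_funN.
by under eq_fun do rewrite ImN; exact: measurable_funN.
Qed.

Lemma cmeasD D f g : cmeas D f -> cmeas D g -> cmeas D (fun x => f x + g x).
Proof.
move=> [h1 h2] [h3 h4]; split.
  by under eq_fun do rewrite ReD; exact: measurable_funD.
by under eq_fun do rewrite ImD; exact: measurable_funD.
Qed.

Lemma cmeasB D f g : cmeas D f -> cmeas D g -> cmeas D (fun x => f x - g x).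
Proof. by move=> hf hg; apply: cmeasD => //; exact: cmeasN. Qed.

Lemma cmeasM D f g : cmeas D f -> cmeas D g -> cmeas D (fun x => f x * g x).
Proof.
move=> [h1 h2] [h3 h4]; split.
  under eq_fun do rewrite ReM.
  by apply: measurable_funB; exact: measurable_funM.
under eq_fun do rewrite ImM.
by apply: measurable_funD; exact: measurable_funM.
Qed.

Lemma cmeasX D f n : cmeas D f -> cmeas D (fun x => f x ^+ n).
Proof.
move=> hf; elim: n => [|n ih]; first exact: cmeas_cst.
by under eq_fun do rewrite exprS; exact: cmeasM.
Qed.

Lemma cmeasV D f : cmeas D f -> cmeas D (fun x => (f x)^-1).
Proof.
move=> [h1 h2].
have mi : measurable_fun D (fun x => (cabs (f x) ^+ 2)^-1).
  under eq_fun do rewrite -powR_inv1 ?sqr_ge0// sqr_cabs.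
  apply: (@measurableT_comp _ _ _ _ _ _ (fun x : R => x `^ (-1))).
    exact: measurable_powR.
  by apply: measurable_funD; exact: measurable_funX.
split.
  by under eq_fun do rewrite ReV; exact: measurable_funM.
under eq_fun do rewrite ImV.
by apply: measurable_funN; exact: measurable_funM.
Qed.

Lemma cmeas_sum D n (F : 'I_n -> T -> C) :
  (forall i, cmeas D (F i)) -> cmeas D (fun x => \sum_(i < n) F i x).
Proof.
move=> h; elim: n F h => [|n ih] F h.
  by under eq_fun do rewrite big_ord0; exact: cmeas_cst.
under eq_fun do rewrite big_ord_recl; apply: cmeasD => //.
by apply: ih => i; exact: h.
Qed.

(** Only bounded measurable integrands on sets of finite measure occur. They
    form an algebra, so that linearity of the integral needs no further
    integrability argument. *)
Definition cbm D f := cmeas D f /\ exists B, forall x, D x -> cabs (f x) <= B.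

Lemma cbm_cst D (c : C) : cbm D (fun=> c).
Proof. by split; [exact: cmeas_cst|exists (cabs c)]. Qed.

Lemma cbmN D f : cbm D f -> cbm D (fun x => - f x).
Proof.
move=> [h1 [B hB]]; split; first exact: cmeasN.
by exists B => x Dx; rewrite cabsN hB.
Qed.

Lemma cbmD D f g : cbm D f -> cbm D g -> cbm D (fun x => f x + g x).
Proof.
move=> [h1 [B hB]] [h1' [B' hB']]; split; first exact: cmeasD.
by exists (B + B') => x Dx; rewrite (le_trans (cabsD _ _))// lerD ?hB ?hB'.
Qed.

Lemma cbmB D f g : cbm D f -> cbm D g -> cbm D (fun x => f x - g x).
Proof. by move=> hf hg; apply: cbmD => //; exact: cbmN. Qed.

Lemma cbmM D f g : cbm D f -> cbm D g -> cbm D (fun x => f x * g x).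
Proof.
move=> [h1 [B hB]] [h1' [B' hB']]; split; first exact: cmeasM.
by exists (B * B') => x Dx; rewrite cabsM ler_pM ?cabs_ge0 ?hB ?hB'.
Qed.

Lemma cbmX D f n : cbm D f -> cbm D (fun x => f x ^+ n).
Proof.
move=> hf; elim: n => [|n ih]; first exact: cbm_cst.
by under eq_fun do rewrite exprS; exact: cbmM.
Qed.

Lemma cbm_sum D n (F : 'I_n -> T -> C) :
  (forall i, cbm D (F i)) -> cbm D (fun x => \sum_(i < n) F i x).
Proof.
move=> h; elim: n F h => [|n ih] F h.
  by under eq_fun do rewrite big_ord0; exact: cbm_cst.
under eq_fun do rewrite big_ord_recl; apply: cbmD => //.
by apply: ih => i; exact: h.
Qed.

Lemma cbmV D f (b : R) : 0 < b -> (forall x, D x -> b <= cabs (f x)) ->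
  cmeas D f -> cbm D (fun x => (f x)^-1).
Proof.
move=> b0 h mf; split; first exact: cmeasV.
exists b^-1 => x Dx; rewrite cabsV lef_pV2 ?posrE ?h//.
by rewrite (lt_le_trans b0)// h.
Qed.

Variable mu : {measure set T -> \bar R}.

(** [Cintegral] is an instance of this integral, and so is [Cexpectation]
    once it is restricted to the support of the law. *)
Definition CI D f : C :=
  (\int[mu]_(x in D) complex.Re (f x)) +i* (\int[mu]_(x in D) complex.Im (f x)).

Variables (D : set T) (mD : measurable D) (muD : (mu D < +oo)%E).

Lemma cbm_integrable f : cbm D f ->
  mu.-integrable D (EFin \o (fun x => complex.Re (f x))) /\
  mu.-integrable D (EFin \o (fun x => complex.Im (f x))).
Proof.
move=> [[h1 h2] [B hB]]; split; apply: measurable_bounded_integrable => //;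
  exists B; split; rewrite ?num_real// => M BM x Dx /=.
  by rewrite (le_trans (Re_le_cabs _))// (le_trans (hB _ Dx))// ltW.
by rewrite (le_trans (Im_le_cabs _))// (le_trans (hB _ Dx))// ltW.
Qed.

Lemma CI_eq f g : (forall x, D x -> f x = g x) -> CI D f = CI D g.
Proof.
by move=> h; congr (_ +i* _); apply: eq_Rintegral => x; rewrite inE => /h ->.
Qed.

Lemma CID f g : cbm D f -> cbm D g ->
  CI D (fun x => f x + g x) = CI D f + CI D g.
Proof.
move=> /cbm_integrable[f1 f2] /cbm_integrable[g1 g2]; congr (_ +i* _).
  by under eq_Rintegral do rewrite ReD; rewrite RintegralD.
by under eq_Rintegral do rewrite ImD; rewrite RintegralD.
Qed.

Lemma integrableZl_EFin (k : R) (f : T -> R) : mu.-integrable D (EFin \o f) ->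
  mu.-integrable D (EFin \o (fun x => k * f x)).
Proof. by move=> h; exact: (integrableZl mD k h). Qed.

Lemma CIZ (c : C) f : cbm D f -> CI D (fun x => c * f x) = c * CI D f.
Proof.
move=> /cbm_integrable[f1 f2]; apply: complexP.
  rewrite ReM /=; under eq_Rintegral do rewrite ReM.
  by rewrite RintegralB ?RintegralZl//; exact: integrableZl_EFin.
rewrite ImM /=; under eq_Rintegral do rewrite ImM.
by rewrite RintegralD ?RintegralZl//; exact: integrableZl_EFin.
Qed.

Lemma CIN f : cbm D f -> CI D (fun x => - f x) = - CI D f.
Proof.
by move=> hf; rewrite -mulN1r -CIZ//; apply: CI_eq => x _; rewrite mulN1r.
Qed.

Lemma CIB f g : cbm D f -> cbm D g ->
  CI D (fun x => f x - g x) = CI D f - CI D g.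
Proof. by move=> hf hg; rewrite CID ?CIN//; exact: cbmN. Qed.

Lemma CI_sum n (F : 'I_n -> T -> C) : (forall i, cbm D (F i)) ->
  CI D (fun x => \sum_(i < n) F i x) = \sum_(i < n) CI D (F i).
Proof.
elim: n F => [|n ih] F h.
  rewrite big_ord0 (@CI_eq _ (fun=> 0)); last by move=> x _; rewrite big_ord0.
  by apply: complexP; rewrite /= Rintegral_cst// mul0r.
rewrite big_ord_recl -ih// -CID//; last by apply: cbm_sum => i; exact: h.
by apply: CI_eq => x _; rewrite big_ord_recl.
Qed.

Lemma CI_cst (c : C) : CI D (fun=> c) = c * (fine (mu D))%:C.
Proof.
by apply: complexP; rewrite ?ReM ?ImM /= Rintegral_cst// ?mulr0 ?subr0 ?add0r.
Qed.

Lemma Rintegral_null_le (f : T -> R) (S : set T) B : measurable S -> mu S = 0%E ->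
  measurable_fun D f -> 0 <= B -> (forall x, D x -> ~ S x -> `|f x| <= B) ->
  `| \int[mu]_(x in D) f x | <= B * fine (mu D).
Proof.
move=> mS muS mf B0 fB.
have mef : measurable_fun D (EFin \o f) by exact/measurable_EFinP.
have h : (\int[mu]_(x in D) `|(EFin \o f) x| <= B%:E * mu D)%E.
  apply: integral_le_bound => //.
  exists S; split => //= x /not_implyP[Dx]; rewrite /= lee_fin => nfx.
  by apply: contrapT => nS; apply: nfx; exact: fB.
have fi : mu.-integrable D (EFin \o f).
  apply/integrableP; split => //; apply: le_lt_trans h _.
  by rewrite lte_mul_pinfty.
rewrite (le_trans (le_normr_Rintegral _ _))// /Rintegral.
rewrite (_ : B * _ = fine (B%:E * mu D)); last first.
  by rewrite fineM// ge0_fin_numE.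
apply: fine_le => //.
  by apply: integrable_fin_num => //; exact: integrable_norm.
by rewrite fin_numM// ge0_fin_numE.
Qed.

(** The real and imaginary parts are bounded separately, whence the factor 2.
    It is of no consequence: the bound only serves to show that quantities
    tend to 0. The null set S allows for parameters at which an integrand is
    0 / 0. *)
Lemma CI_le f (S : set T) B : measurable S -> mu S = 0%E -> cmeas D f -> 0 <= B ->
  (forall x, D x -> ~ S x -> cabs (f x) <= B) ->
  cabs (CI D f) <= 2 * B * fine (mu D).
Proof.
move=> mS muS [m1 m2] B0 h; rewrite (le_trans (cabs_le_ReIm _))//=.
rewrite (_ : 2 * B * _ = B * fine (mu D) + B * fine (mu D)); last by ring.
rewrite lerD//.
  apply: (Rintegral_null_le mS) => // x Dx Sx.
  by rewrite (le_trans (Re_le_cabs _))// h.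
apply: (Rintegral_null_le mS) => // x Dx Sx.
by rewrite (le_trans (Im_le_cabs _))// h.
Qed.

Lemma CI_null f g (S : set T) : measurable S -> mu S = 0%E ->
  cbm D f -> cbm D g -> (forall x, D x -> ~ S x -> f x = g x) ->
  CI D f = CI D g.
Proof.
move=> mS muS hf hg fg; apply/eqP; rewrite -subr_eq0 -CIB//.
rewrite -cabs_eq0 eq_le cabs_ge0 andbT.
rewrite (le_trans (@CI_le _ S 0 mS muS _ _ _))//.
- exact: (cbmB hf hg).1.
- by move=> x Dx Sx; rewrite fg// subrr cabs0.
Qed.

End ComplexIntegral.

(** * Power series expansions with geometric error *)

Section Taylor.
Context {R : realType}.
Local Notation C := R[i].
Implicit Types (F : C -> C) (z u k : C) (a : nat -> C) (B q : R).

Lemma le_geom_limit (x y K : R) : (forall n, x <= y + K * 2^-1 ^+ n) -> x <= y.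
Proof.
move=> h; have c : (fun n => y + K * 2^-1 ^+ n) @ \oo --> y + K * 0.
  apply: cvgD; first exact: cvg_cst.
  apply: cvgM; first exact: cvg_cst.
  by apply: cvg_expr; rewrite ger0_norm; lra.
rewrite -[leRHS]addr0 -[X in _ + X](mulr0 K).
have -> : y + K * 0 = lim ((fun n => y + K * 2^-1 ^+ n) @ \oo) by apply/esym/cvg_lim.
by apply: limr_ge; [apply/cvg_ex; eexists; exact: c|near=> n; exact: h].
Unshelve. all: by end_near. Qed.

Lemma sum_geom_le (r : R) n : 0 <= r <= 2^-1 -> \sum_(i < n) r ^+ i <= 2.
Proof.
move=> /andP[r0 r1].
have : (1 - r) * \sum_(i < n) r ^+ i <= 1.
  have -> : (1 - r) * \sum_(i < n) r ^+ i = 1 - r ^+ n.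
    by rewrite -[RHS]opprB subrX1; ring.
  by rewrite gerBl exprn_ge0.
have S0 : 0 <= \sum_(i < n) r ^+ i by apply: sumr_ge0 => i _; rewrite exprn_ge0.
move: (\sum_(i < n) r ^+ i) S0 => S S0.
by nra.
Qed.

Lemma sum_geom_tail (r : R) m n : 0 <= r <= 2^-1 -> (m <= n)%N ->
  \sum_(m <= i < n) r ^+ i <= 2 * r ^+ m.
Proof.
move=> r01 mn; rewrite -{1}(add0n m) big_addn big_mkord.
under eq_bigr do rewrite exprD.
rewrite -mulr_suml ler_wpM2r ?sum_geom_le// exprn_ge0//; by case/andP: r01.
Qed.

Lemma cabs_sum_nat (x : nat -> C) m n :
  cabs (\sum_(m <= i < n) x i) <= \sum_(m <= i < n) cabs (x i).
Proof.
elim/big_ind2: _ => [|x1 x2 y1 y2 h1 h2|//]; first by rewrite cabs0.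
by rewrite (le_trans (cabsD _ _))// lerD.
Qed.

Lemma cabs_series_tail (x : nat -> C) K (r : R) m n : 0 <= r <= 2^-1 -> (m <= n)%N ->
  (forall i, cabs (x i) <= K * r ^+ i) ->
  cabs (\sum_(i < n) x i - \sum_(i < m) x i) <= 2 * K * r ^+ m.
Proof.
move=> r01 mn xK.
have K0 : 0 <= K by have := xK 0%N; rewrite expr0 mulr1; apply: le_trans; exact: cabs_ge0.
have -> : \sum_(i < n) x i - \sum_(i < m) x i = \sum_(m <= i < n) x i.
  by rewrite -!(big_mkord xpredT x) (big_cat_nat _ mn)//= addrAC subrr add0r.
rewrite (le_trans (cabs_sum_nat _ _ _))//.
rewrite (@le_trans _ _ (\sum_(m <= i < n) K * r ^+ i))//.
  by apply: ler_sum => i _; exact: xK.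
by rewrite -mulr_sumr (mulrC 2) -mulrA ler_wpM2l// sum_geom_tail.
Qed.

Lemma real_geom_series (x : nat -> R) K (r : R) : 0 <= r <= 2^-1 ->
  (forall i, `|x i| <= K * r ^+ i) ->
  exists l, forall m, `|l - \sum_(i < m) x i| <= 2 * K * r ^+ m.
Proof.
move=> r01 xK; have [r0 r1] := andP r01.
have K0 : 0 <= K by have := xK 0%N; rewrite expr0 mulr1; apply: le_trans.
have cx : cvgn (series x).
  apply: normed_cvg; apply: (@series_le_cvg _ _ (fun i => K * r ^+ i)) => [i|i|i|] //=; last 1 first.
  - by apply: is_cvg_geometric_series; rewrite ger0_norm//; lra.
  - by rewrite mulr_ge0// exprn_ge0.
exists (limn (series x)) => m.
have t n : (m <= n)%N -> `|\sum_(i < n) x i - \sum_(i < m) x i| <= 2 * K * r ^+ m.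
  move=> mn; have := @cabs_series_tail (fun i => (x i)%:C) K r m n r01 mn.
  by rewrite -!rmorph_sum -rmorphB cabs_real; apply => i; rewrite cabs_real.
have cn : (fun n => `|series x n - \sum_(i < m) x i|) @ \oo -->
    `|limn (series x) - \sum_(i < m) x i|.
  by apply: cvg_norm; apply: cvgB => //; exact: cvg_cst.
rewrite -(cvg_lim _ cn)//; apply: limr_le; first by apply/cvg_ex; eexists; exact: cn.
by near=> n; rewrite /series /= big_mkord; apply: t; near: n; exact: nbhs_infty_ge.
Unshelve. all: by end_near. Qed.

Lemma geom_series (x : nat -> C) K (r : R) : 0 <= r <= 2^-1 ->
  (forall i, cabs (x i) <= K * r ^+ i) ->
  exists l, forall m, cabs (l - \sum_(i < m) x i) <= 4 * K * r ^+ m.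
Proof.
move=> r01 xK.
have Res m : complex.Re (\sum_(i < m) x i) = \sum_(i < m) complex.Re (x i).
  by elim: m => [|m ih]; rewrite ?big_ord0// !big_ord_recr /= ReD ih.
have Ims m : complex.Im (\sum_(i < m) x i) = \sum_(i < m) complex.Im (x i).
  by elim: m => [|m ih]; rewrite ?big_ord0// !big_ord_recr /= ImD ih.
have [l1 h1] := @real_geom_series (fun i => complex.Re (x i)) K r r01
  (fun i => le_trans (Re_le_cabs _) (xK i)).
have [l2 h2] := @real_geom_series (fun i => complex.Im (x i)) K r r01
  (fun i => le_trans (Im_le_cabs _) (xK i)).
exists (l1 +i* l2) => m; rewrite (le_trans (cabs_le_ReIm _))//.
rewrite ReD ReN ImD ImN Res Ims /= (le_trans (lerD (h1 m) (h2 m)))//.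
by rewrite le_eqVlt; apply/orP; left; apply/eqP; ring.
Qed.

(** A quantitative form of analyticity: the error after M terms is geometric
    in M. Unlike convergence of the power series, this estimate can be
    integrated with respect to a parameter. *)
Definition taylor F z a B q := [/\ 0 <= B, 0 < q & forall u M, q * cabs u <= 2^-1 ->
  cabs (F (z + u) - \sum_(n < M) a n * u ^+ n) <= B * (q * cabs u) ^+ M].

Definition holo F z := exists a B q, taylor F z a B q.

Lemma taylor0 F z a B q : taylor F z a B q -> a 0%N = F z.
Proof.
move=> [B0 q0 h]; have := h 0 1%N; rewrite cabs0 mulr0 => /(_ _)/wrap[]; first lra.
rewrite expr1 mulr0 addr0 big_ord1 expr0 mulr1 => h1.
apply/eqP; rewrite eq_sym -subr_eq0 -cabs_eq0 eq_le h1; exact: cabs_ge0.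
Qed.

(** Two consecutive partial sums are compared at a point u with q |u| = 1 /
    2. *)
Lemma taylor_coef F z a B q n : taylor F z a B q -> cabs (a n) <= 2 * B * q ^+ n.
Proof.
move=> [B0 q0 h]; pose u : C := ((2 * q)^-1)%:C.
have q20 : 0 < 2 * q by rewrite mulr_gt0.
have cu : cabs u = (2 * q)^-1 by rewrite cabs_real ger0_norm// invr_ge0 ltW.
have qu : q * cabs u = 2^-1 by rewrite cu; field; rewrite gt_eqF.
have h1 := h u n; have h2 := h u n.+1; rewrite qu lexx in h1 h2.
have : cabs (a n * u ^+ n) <= 2 * B * 2^-1 ^+ n.
  have -> : a n * u ^+ n = (F (z + u) - \sum_(i < n) a i * u ^+ i) -
      (F (z + u) - \sum_(i < n.+1) a i * u ^+ i).
    by rewrite big_ord_recr /=; ring.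
  rewrite (le_trans (cabsB _ _))// (le_trans (lerD (h1 isT) (h2 isT)))// exprS.
  have : 0 <= 2^-1 ^+ n :> R by rewrite exprn_ge0.
  by move: (2^-1 ^+ n) => e e0; nra.
rewrite cabsM cabsX -(_ : q * (2 * q)^-1 = 2^-1); last by field; rewrite gt_eqF.
rewrite cu exprMn mulrA ler_pM2r// exprn_gt0// invr_gt0//.
Qed.

(** Convergence at a single point at distance r / 2 bounds the coefficients
    geometrically, hence the remainder at all closer points. *)
Lemma analytic_holo F z : analytic_at F z -> holo F z.
Proof.
move=> [a [r [r0 h]]]; pose s := r / 2; have s0 : 0 < s by rewrite divr_gt0.
have [K Kh] : exists K, forall n, cabs (a n) * s ^+ n <= K.
  have hs : `|(z + s%:C) - z| < r%:C.
    rewrite (addrC z) addrK -cabsE cabs_real gtr0_norm// ltcR /s; lra.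
  have := h _ hs => /cvg_cabsP /(_ 1 ltr01) [N _ hN].
  pose P n := series (fun n => a n * (z + s%:C - z) ^+ n) n.
  have tN n : (N <= n)%N -> cabs (a n) * s ^+ n <= 2.
    move=> Nn; have -> : cabs (a n) * s ^+ n = cabs (P n.+1 - P n).
      rewrite /P /series /= big_nat_recr//= addrAC subrr add0r.
      by rewrite (addrC z) addrK cabsM cabsX cabs_real gtr0_norm.
    have -> : P n.+1 - P n = (P n.+1 - F (z + s%:C)) - (P n - F (z + s%:C)) by ring.
    rewrite (le_trans (cabsB _ _))// -[leRHS]/(1 + 1) lerD// ltW//.
      by apply: hN => /=; rewrite (leq_trans Nn).
    by apply: hN.
  exists (2 + \sum_(i < N) cabs (a i) * s ^+ i) => n.
  have p i : 0 <= cabs (a i) * s ^+ i by rewrite mulr_ge0 ?cabs_ge0// exprn_ge0// ltW.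
  have [Nn|nN] := leqP N n.
    by rewrite (le_trans (tN _ Nn))// lerDl sumr_ge0.
  rewrite (bigD1 (Ordinal nN))//= addrCA lerDl addr_ge0// sumr_ge0//.
have K0 : 0 <= K.
  by apply: le_trans (Kh 0%N); rewrite mulr_ge0 ?cabs_ge0// exprn_ge0// ltW.
exists a, (2 * K), s^-1; split; [by rewrite mulr_ge0|by rewrite invr_gt0|].
move=> u M su.
have su' : cabs u <= s / 2 by move: su; rewrite mulrC ler_pdivrMr// mulrC.
have hu : `|z + u - z| < r%:C.
  rewrite (addrC z) addrK -cabsE ltcR (le_lt_trans su')// /s; lra.
have := h _ hu => /cvg_cabsP c.
apply/ler_addgt0Pr => e e0.
have [N _ hN] := c _ e0.
have /= := hN (maxn N M) (leq_maxl _ _).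
rewrite (addrC z) addrK /series /= big_mkord => h1.
have xK i : cabs (a i * u ^+ i) <= K * (s^-1 * cabs u) ^+ i.
  rewrite cabsM cabsX exprMn mulrA ler_wpM2r ?exprn_ge0 ?cabs_ge0//.
  by rewrite exprVn ler_pdivlMr ?exprn_gt0// Kh.
have r01 : 0 <= s^-1 * cabs u <= 2^-1.
  by rewrite su andbT mulr_ge0 ?cabs_ge0// invr_ge0 ltW.
have h2 := cabs_series_tail r01 (leq_maxr N M) xK.
rewrite (_ : F _ - _ = - (\sum_(i < maxn N M) a i * u ^+ i - F (u + z)) +
  (\sum_(i < maxn N M) a i * u ^+ i - \sum_(n < M) a n * u ^+ n)); last first.
  by rewrite [u + z]addrC; ring.
rewrite (le_trans (cabsD _ _))// cabsN addrC lerD// ltW//.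
Qed.

Lemma holo_cst (c z : C) : holo (fun=> c) z.
Proof.
exists (fun n => if n is 0%N then c else 0), (cabs c), 1; split => //.
  exact: cabs_ge0.
move=> u [|M] _; first by rewrite big_ord0 subr0 expr0 mulr1.
rewrite big_ord_recl expr0 mulr1 big1 ?addr0 ?subrr ?cabs0; last first.
  by move=> i _; rewrite /= mul0r.
by rewrite mulr_ge0 ?cabs_ge0// exprn_ge0// mul1r cabs_ge0.
Qed.

(** Increasing q shrinks the disc of the estimate until F and G agree on it. *)
Lemma taylor_ext F G z a B q : taylor F z a B q ->
  (exists2 r, 0 < r & forall u, cabs u < r -> F (z + u) = G (z + u)) -> holo G z.
Proof.
move=> [B0 q0 h] [r r0 rFG]; exists a, B, (Num.max q r^-1); split => //.
  by rewrite lt_max q0.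
move=> u M hu.
have qm : q <= Num.max q r^-1 by rewrite le_max lexx.
have rm : r^-1 <= Num.max q r^-1 by rewrite le_max lexx orbT.
have qu : q * cabs u <= Num.max q r^-1 * cabs u by rewrite ler_wpM2r ?cabs_ge0.
have ru : r^-1 * cabs u <= 2^-1.
  by apply: le_trans hu; rewrite ler_wpM2r ?cabs_ge0.
rewrite -rFG; last first.
  have : cabs u <= r * 2^-1 by rewrite mulrC -ler_pdivrMr// mulrC.
  by move/le_lt_trans; apply; lra.
rewrite (le_trans (h u M (le_trans qu hu)))// ler_wpM2l// lerXn2r// nnegrE ?mulr_ge0 ?cabs_ge0//.
  exact: ltW.
by rewrite (le_trans (ltW q0)).
Qed.

Lemma holo_continuous_at F z : holo F z -> F @ nbhs z --> F z.
Proof.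
move=> h; apply/(@cvg_cabsP _ _ (nbhs z) (nbhs_filter z)) => e e0.
have [a [B [q T]]] := h; have [B0 q0 hT] := T.
have d0 : 0 < Num.min (2^-1 / q) (e / (B * q + 1)).
  have : 0 < B * q + 1 by rewrite ltr_wpDl// mulr_ge0// ltW.
  by move=> ?; rewrite lt_min !divr_gt0.
apply/nbhs_cabsP; exists (Num.min (2^-1 / q) (e / (B * q + 1))) => // u.
rewrite lt_min => /andP[u1 u2].
have := hT (u - z) 1%N; rewrite big_ord1 expr0 mulr1 expr1 (taylor0 T) (addrC z) subrK.
move=> /(_ _)/wrap[]; first by rewrite mulrC -ler_pdivlMr// ltW.
move=> /le_lt_trans; apply.
have Bq : 0 < B * q + 1 by rewrite ltr_wpDl// mulr_ge0// ltW.
move: u2; rewrite ltr_pdivlMr// mulrDr mulr1 mulrA [B * q * _]mulrC mulrA.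
by apply: le_lt_trans; rewrite lerDl cabs_ge0.
Qed.

Lemma holo_continuous F : (forall z, holo F z) -> continuous F.
Proof. by move=> h z; exact: holo_continuous_at. Qed.

End Taylor.

(** * Derivatives of analytic functions and Liouville's theorem *)

Section HoloDerivative.
Context {R : realType}.
Local Notation C := R[i].
Implicit Types (F G : C -> C) (z u k : C) (a : nat -> C) (B q : R).

Lemma cabs_nat n : cabs (n%:R : C) = n%:R.
Proof.
have -> : (n%:R : C) = (n%:R : R)%:C by rewrite rmorph_nat.
by rewrite cabs_real ger0_norm.
Qed.

(** The factor r ^+ 2 stands for a division by r ^+ 2 that would fail at r =
    0. The remainder is k ^+ 2 times a sum of n (n - 1) / 2 <= 2 ^ n
    monomials of degree n - 2 in u and u + k. *)
Lemma binomial_remainder u k (r : R) n : cabs u <= r -> cabs (u + k) <= r ->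
  cabs ((u + k) ^+ n - u ^+ n - n%:R * k * u ^+ n.-1) * r ^+ 2 <=
  2 ^+ n * cabs k ^+ 2 * r ^+ n.
Proof.
move=> ur ukr; have r0 : 0 <= r := le_trans (cabs_ge0 u) ur.
have k0 : 0 <= cabs k ^+ 2 by rewrite exprn_ge0// cabs_ge0.
elim: n => [|n ih].
  by rewrite !expr0 subrr mul0r mul0r subrr cabs0 mul0r mul1r mulr1.
have -> : (u + k) ^+ n.+1 - u ^+ n.+1 - n.+1%:R * k * u ^+ n.+1.-1 =
   (u + k) * ((u + k) ^+ n - u ^+ n - n%:R * k * u ^+ n.-1) +
   n%:R * k ^+ 2 * u ^+ n.-1.
  case: n {ih} => [|n]; first by rewrite /= !expr0 !expr1; ring.
  by rewrite -natr1 /= !exprS; ring.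
rewrite (le_trans (ler_wpM2r _ (cabsD _ _)))// ?exprn_ge0// mulrDl.
have -> : 2 ^+ n.+1 * cabs k ^+ 2 * r ^+ n.+1 =
  r * (2 ^+ n * cabs k ^+ 2 * r ^+ n) + 2 ^+ n * cabs k ^+ 2 * (r * r ^+ n).
  by rewrite !exprS; ring.
apply: lerD.
  rewrite cabsM -[leLHS]mulrA; apply: ler_pM => //; first exact: cabs_ge0.
  by rewrite mulr_ge0 ?exprn_ge0 ?cabs_ge0.
rewrite cabsM [cabs (_ * k ^+ 2)]cabsM !cabsX cabs_nat.
case: n {ih} => [|n]; first by rewrite !mul0r; apply: mulr_ge0; apply: mulr_ge0; rewrite // exprn_ge0.
rewrite -!mulrA; apply: ler_pM => //.
- by rewrite !mulr_ge0 ?exprn_ge0 ?cabs_ge0.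
- by rewrite -natrX ler_nat ltnW// ltn_expl.
rewrite ler_wpM2l ?cabs_ge0// ler_wpM2l ?cabs_ge0// (_ : r * r ^+ n.+1 = r ^+ n * r ^+ 2); last by rewrite exprS expr2; ring.
by rewrite ler_wpM2r ?exprn_ge0// lerXn2r// nnegrE cabs_ge0.
Qed.

(** G is the sum of the termwise differentiated series. The second-order
    remainder is bounded for the Taylor polynomials, where it is
    [binomial_remainder], and the bound passes to the limit. *)
Lemma taylor_deriv F z a B q : taylor F z a B q -> exists G, exists2 K, 0 <= K &
  (forall u k, q * cabs u <= 4^-1 -> q * cabs (u + k) <= 4^-1 ->
     cabs (F (z + u + k) - F (z + u) - k * G u) <= K * cabs k ^+ 2) /\
  (forall u M, q * cabs u <= 4^-1 ->
     cabs (G u - \sum_(i < M) i.+1%:R * a i.+1 * u ^+ i) <= K * (2 * q * cabs u) ^+ M).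
Proof.
move=> T; have [B0 q0 hT] := T.
have aB n : cabs (a n) <= 2 * B * q ^+ n := taylor_coef n T.
have xK u i : cabs (i.+1%:R * a i.+1 * u ^+ i) <= 2 * B * q * (2 * q * cabs u) ^+ i.
  rewrite !cabsM cabsX cabs_nat !exprMn.
  rewrite (_ : _ * (_ * _) = 2 ^+ i * (2 * B * q ^+ i.+1) * cabs u ^+ i); last first.
    by rewrite exprS; ring.
  rewrite ler_wpM2r ?exprn_ge0 ?cabs_ge0//; apply: ler_pM; rewrite ?cabs_ge0//.
  by rewrite -natrX ler_nat ltn_expl.
have r01 u : q * cabs u <= 4^-1 -> 0 <= 2 * q * cabs u <= 2^-1.
  by move=> h; rewrite -!mulrA mulr_ge0//= ?mulr_ge0 ?cabs_ge0 ?(ltW q0)//; lra.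
have exG u : exists l, q * cabs u <= 4^-1 -> forall m,
    cabs (l - \sum_(i < m) i.+1%:R * a i.+1 * u ^+ i) <= 4 * (2 * B * q) * (2 * q * cabs u) ^+ m.
  have [h|h] := boolP (q * cabs u <= 4^-1); last by exists 0.
  by have [l hl] := geom_series (r01 u h) (xK u); exists l.
have [G hG] := choice exG.
(* K1 bounds the remainder of the differentiated series; K2 = 4 * B / r ^+ 2
   with r = (4 * q)^-1 *)
pose K1 := 8 * B * q; pose K2 := 64 * B * q ^+ 2.
have K10 : 0 <= K1 by rewrite !mulr_ge0// ltW.
have K20 : 0 <= K2.
  by apply: mulr_ge0; [exact: mulr_ge0|rewrite exprn_ge0// ltW].
exists G, (K1 + K2); first by rewrite addr_ge0.
split; last first.
  move=> u M hu; apply: (le_trans (hG u hu M)).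
  rewrite ler_wpM2r ?exprn_ge0//; first by case/andP: (r01 u hu).
  by rewrite (_ : 4 * _ = K1) ?lerDl// /K1; ring.
move=> u k hu huk.
suff h : cabs (F (z + u + k) - F (z + u) - k * G u) <= K2 * cabs k ^+ 2.
  by rewrite (le_trans h)// ler_wpM2r ?lerDr// exprn_ge0 ?cabs_ge0.
apply: (@le_geom_limit _ _ _ (2 * B + cabs k * K1)) => n.
pose P n u := \sum_(i < n) a i * u ^+ i.
pose dP n u := \sum_(i < n) i.+1%:R * a i.+1 * u ^+ i.
rewrite -(addrA z) (_ : _ - k * G u = (F (z + (u + k)) - P n.+1 (u + k)) - (F (z + u) - P n.+1 u)
   - k * (G u - dP n u) + (P n.+1 (u + k) - P n.+1 u - k * dP n u)); last first.
  by ring.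
have qle w : q * cabs w <= 4^-1 -> q * cabs w <= 2^-1.
  by move=> h; apply: le_trans h _; lra.
have pw w : q * cabs w <= 4^-1 -> B * (q * cabs w) ^+ n.+1 <= B * 2^-1 ^+ n.
  move=> h; rewrite ler_wpM2l//.
  have w0 : 0 <= q * cabs w by rewrite mulr_ge0 ?cabs_ge0 ?ltW.
  apply: (@le_trans _ _ (2^-1 ^+ n.+1)).
    by rewrite lerXn2r ?nnegrE//; exact: qle.
  by rewrite exprS ler_piMl ?exprn_ge0//; lra.
have e1 := le_trans (hT (u + k) n.+1 (qle _ huk)) (pw _ huk).
have e2 := le_trans (hT u n.+1 (qle _ hu)) (pw _ hu).
have e3 : cabs (k * (G u - dP n u)) <= cabs k * K1 * 2^-1 ^+ n.
  rewrite cabsM -mulrA ler_wpM2l ?cabs_ge0// (le_trans (hG u hu n))//.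
  rewrite (_ : 4 * _ = K1); last by rewrite /K1; ring.
  have /andP[? ?] := r01 u hu.
  by rewrite ler_wpM2l// lerXn2r// nnegrE.
have e4 : cabs (P n.+1 (u + k) - P n.+1 u - k * dP n u) <= K2 * cabs k ^+ 2.
  pose r := (4 * q)^-1.
  have r0 : 0 < r by rewrite invr_gt0 mulr_gt0.
  have lr w : q * cabs w <= 4^-1 -> cabs w <= r.
    by move=> h; rewrite /r invfM ler_pdivlMr// mulrC.
  rewrite (_ : _ - _ - _ = \sum_(i < n.+1) a i *
      ((u + k) ^+ i - u ^+ i - i%:R * k * u ^+ i.-1)); last first.
    rewrite (eq_bigr (fun i : 'I_n.+1 => a i * (u + k) ^+ i - a i * u ^+ i -
        k * (i%:R * a i * u ^+ i.-1))); last by move=> i _; ring.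
    rewrite !sumrB -mulr_sumr; congr (_ - _ - _ * _).
    by rewrite big_ord_recl /= !mul0r add0r.
  rewrite -(@ler_pM2r _ (r ^+ 2)) ?exprn_gt0//.
  rewrite (@le_trans _ _ (\sum_(i < n.+1) 2 * B * cabs k ^+ 2 * 2^-1 ^+ i))//.
    rewrite (le_trans (ler_wpM2r _ (cabs_sum _)))// ?exprn_ge0 ?(ltW r0)//.
    rewrite mulr_suml; apply: ler_sum => i _.
    have := binomial_remainder i (lr _ hu) (lr _ huk).
    move=> h; rewrite cabsM -[leLHS]mulrA.
    apply: (le_trans (ler_pM (cabs_ge0 _) _ (aB i) h)).
      by rewrite mulr_ge0 ?cabs_ge0// exprn_ge0 ?ltW.
    rewrite le_eqVlt; apply/orP; left; apply/eqP.
    have -> : 2^-1 = 2 * q * r by rewrite /r; field; rewrite gt_eqF.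
    by rewrite !exprMn; ring.
  rewrite -mulr_sumr (_ : K2 * _ * _ = 2 * B * cabs k ^+ 2 * 2); last first.
    by rewrite /K2 /r; field; rewrite gt_eqF.
  by rewrite ler_wpM2l ?sum_geom_le ?lexx// ?mulr_ge0// ?exprn_ge0 ?cabs_ge0//= andbT invr_ge0.
rewrite (le_trans (cabsD _ _))// addrC lerD// (le_trans (cabsB _ _))//.
rewrite (le_trans (lerD (cabsB _ _) e3))// !mulrDl lerD2r.
by rewrite (le_trans (lerD e1 e2))// le_eqVlt; apply/orP; left; apply/eqP; ring.
Qed.

(** The second-order remainder is uniform near z: on the real axis this
    controls the increments of the potentials along a flow. *)
Lemma holo_deriv F z : holo F z -> holo (derive1 F : C -> C) z /\
  exists2 r, 0 < r & exists2 K, 0 <= K & forall w k, cabs (w - z) < r ->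
    cabs (w + k - z) < r -> cabs (F (w + k) - F w - k * derive1 F w) <= K * cabs k ^+ 2.
Proof.
move=> [a [B [q T]]]; have [B0 q0 _] := T.
have [G [K K0 [h1 h2]]] := taylor_deriv T.
pose r := (4 * q)^-1; have r0 : 0 < r by rewrite invr_gt0 mulr_gt0.
have lr w : cabs w < r -> q * cabs w <= 4^-1.
  by rewrite /r invfM => h; rewrite mulrC -ler_pdivlMr// ltW.
have dG u : cabs u < r -> derive1 F (z + u) = G u.
  move=> ur; apply: derive1_cabs => e e0.
  have d0 : 0 < Num.min (r - cabs u) (e / (K + 1)).
    by rewrite lt_min subr_gt0 ur divr_gt0// ltr_wpDl.
  exists (Num.min (r - cabs u) (e / (K + 1))) => // k k0; rewrite lt_min => /andP[k1 k2].
  rewrite (addrC k) (mulrC (G u) k).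
  have := h1 u k (lr _ ur) (lr _ _); rewrite (le_lt_trans (cabsD _ _)) -?ltrBrDl// => /(_ isT).
  move=> /le_trans; apply; rewrite expr2 mulrA ler_wpM2r ?cabs_ge0//.
  move: k2; rewrite ltr_pdivlMr ?ltr_wpDl// => /ltW; apply: le_trans.
  by rewrite mulrC ler_wpM2l ?cabs_ge0// lerDl.
split; last first.
  exists r => //; exists K => // w k wr wkr.
  have wE : w = z + (w - z) by rewrite addrC subrK.
  have := h1 (w - z) k (lr _ wr).
  rewrite -(dG _ wr) -wE addrAC => /(_ (lr _ wkr)).
  by [].
have TG : taylor (fun w => G (w - z)) z (fun i => i.+1%:R * a i.+1) K (2 * q).
  split; [by []|by rewrite mulr_gt0|move=> u M hu].
  rewrite (addrC z) addrK; apply: h2.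
  by move: hu; rewrite -mulrA; lra.
apply: (taylor_ext TG); exists r => // u ur.
by rewrite dG// (addrC z) addrK.
Qed.

(** If F is not zero, |F| attains its maximum, on a compact set, and there is
    a maximiser z1 of largest real part. Either the first nonvanishing
    coefficient of positive degree at z1 gives a direction in which |F|
    increases, or F is constant near z1, and points to the right of z1 are
    maximisers too. *)
Lemma entire_vanishing F : (forall z, holo F z) ->
  (forall e, 0 < e -> exists L, forall w, L <= cabs w -> cabs (F w) < e) ->
  forall w, F w = 0.
Proof.
move=> hF F0 w; apply/eqP; rewrite -cabs_eq0; apply: contrapT => /negP nw.
have m0 : 0 < cabs (F w) by rewrite lt_def nw cabs_ge0.
have [L hL] := F0 _ m0.
have cF := holo_continuous hF.
have cfF : continuous (fun z => cabs (F z)).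
  by move=> z; apply: continuous_comp; [exact: cF|exact: continuous_cabs].
pose D := [set z : C | cabs z <= L].
have Dw : D w by rewrite /D /= leNgt; apply/negP => /ltW /hL; rewrite ltxx.
have cD : compact D by exact: compact_disc.
have [z0 /set_mem Dz0 z0max] : exists2 z0, z0 \in D &
    forall z, z \in D -> cabs (F z) <= cabs (F z0).
  by apply: compact_EVT_max => //; [exists w|exact: continuous_subspaceT].
have gmax z : cabs (F z) <= cabs (F z0).
  have [zD|zD] := leP (cabs z) L; first by apply: z0max; rewrite inE.
  rewrite ltW// (lt_le_trans (hL _ (ltW zD)))//.
  by apply: z0max; rewrite inE.
pose M0 := cabs (F z0).
have M00 : 0 < M0 by rewrite (lt_le_trans m0).
pose S := D `&` [set z | cabs (F z) = M0].
have cS : compact S.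
  apply: compact_closedI => //.
  apply: (@closed_comp _ _ (fun z => cabs (F z)) [set x : R | x = M0]); last exact: closed_eq.
  by move=> ? _; exact: cfF.
have [z1 /set_mem[Dz1 /= Fz1] z1max] : exists2 z1, z1 \in S &
    forall z, z \in S -> complex.Re z <= complex.Re z1.
  apply: compact_EVT_max => //; first by exists z0.
  by apply: continuous_subspaceT; exact: continuous_Re.
have [a [B [q T]]] := hF z1; have [B0 q0 hT] := T.
have a0 := taylor0 T.
have [exk|nk] := pselect (exists k : nat, (0 < k)%N && (a k != 0)).
  case: (ex_minnP exk) => k /andP[k0 ak] kmin.
  have low u : \sum_(i < k) a i * u ^+ i = a 0%N.
    case: k k0 {ak} kmin => // k _ kmin.
    rewrite big_ord_recl expr0 mulr1 big1 ?addr0// => i _.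
    have [->|ai] := eqVneq (a (lift ord0 i)) 0; first by rewrite mul0r.
    have := kmin (lift ord0 i); rewrite ai lift0 /= => /(_ isT).
    by rewrite ltnNge ltn_ord.
  have c0 : a 0%N != 0 by rewrite a0 -cabs_gt0 Fz1.
  (* in the direction om, the sum a 0 + a k * u ^+ k has modulus (1 + t ^+ k)
     * M0, and the higher terms are of order t ^+ k.+1 *)
  pose om : C := k.-root (a 0%N / a k).
  have omk : om ^+ k = a 0%N / a k by exact: rootCK.
  pose c := B * (q * cabs om) ^+ k.+1.
  have qo : 0 <= q * cabs om by rewrite mulr_ge0 ?cabs_ge0// ltW.
  have c_ge0 : 0 <= c by rewrite mulr_ge0// exprn_ge0.
  pose t := Num.min (M0 / (c + 1)) (2^-1 / (q * cabs om + 1)).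
  have t0 : 0 < t by rewrite lt_min !divr_gt0// ltr_wpDl.
  have tc : t * c < M0.
    have : t <= M0 / (c + 1) by rewrite /t ge_min lexx.
    rewrite ler_pdivlMr ?ltr_wpDl// mulrDr mulr1; lra.
  have tq : q * cabs (t%:C * om) <= 2^-1.
    have : t <= 2^-1 / (q * cabs om + 1) by rewrite /t ge_min lexx orbT.
    rewrite ler_pdivlMr ?ltr_wpDl// mulrDr mulr1 cabsM cabs_real gtr0_norm//.
    by rewrite mulrCA; lra.
  have := hT _ k.+1 tq.
  rewrite big_ord_recr /= exprMn omk (_ : \sum_(i < k) _ = a 0%N); last first.
    exact: low.
  rewrite (_ : a 0%N + _ = (1 + t ^+ k)%:C * a 0%N); last first.
    by rewrite rmorphD rmorphXn /= rmorph1; field.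
  rewrite cabsM cabs_real (gtr0_norm t0) mulrCA exprMn => h.
  have : cabs ((1 + t ^+ k)%:C * a 0%N) <= M0 + B * (t ^+ k.+1 * (q * cabs om) ^+ k.+1).
    rewrite -[X in cabs X](subKr (F (z1 + t%:C * om))).
    by rewrite (le_trans (cabsB _ _))// lerD// gmax.
  have tk : 0 < t ^+ k by rewrite exprn_gt0.
  rewrite cabsM cabs_real gtr0_norm ?addr_gt0// a0 Fz1 mulrCA -/c exprS.
  rewrite mulrDl mul1r lerD2l [t * _]mulrC -mulrA ler_pM2l//.
  by rewrite leNgt tc.
(* all higher coefficients vanish, so F is constant near z1 *)
pose u : C := ((2 * q)^-1)%:C.
have q20 : 0 < 2 * q by rewrite mulr_gt0.
have qu : q * cabs u = 2^-1.
  by rewrite /u cabs_real ger0_norm; [field; rewrite gt_eqF|rewrite invr_ge0 ltW].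
have Fu : F (z1 + u) = F z1.
  apply/eqP; rewrite -subr_eq0 -cabs_eq0 eq_le cabs_ge0 andbT.
  apply: (@le_geom_limit _ _ _ (B * 2^-1)) => n; rewrite add0r.
  have := hT u n.+1; rewrite qu lexx => /(_ isT); rewrite exprS mulrA.
  rewrite big_ord_recl expr0 mulr1 a0 big1 ?addr0// => i _.
  have [->|ai] := eqVneq (a (lift ord0 i)) 0; first by rewrite mul0r.
  by exfalso; apply: nk; exists (lift ord0 i).
have : z1 + u \in S.
  rewrite inE; split => /=; last by rewrite Fu.
  rewrite /D /= leNgt; apply/negP => /ltW /hL; rewrite Fu Fz1 /M0 ltNge gmax//.
move=> /z1max; rewrite ReD /= gerDl leNgt invr_gt0 q20//.
Qed.

End HoloDerivative.

(** * Expansion of difference quotients *)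

Section DifferenceQuotient.
Context {R : realType}.
Local Notation C := R[i].
Implicit Types (F A : C -> C) (z u y : C) (a : nat -> C) (B q S rho : R).

(** With y = z - w0, Fz = F z and a the coefficients of A at w0, these are
    the Taylor coefficients at w0 of w |-> (F z - A w) / (z - w). *)
Definition quotient_coef a (y Fz : C) (m : nat) : C :=
  (Fz - \sum_(n < m.+1) a n * y ^+ n) / y ^+ m.+1.

Lemma quotient_coef_sum a y Fz u M : y != 0 ->
  (y - u) * \sum_(m < M) quotient_coef a y Fz m * u ^+ m =
  Fz - \sum_(n < M) a n * u ^+ n - (Fz - \sum_(n < M) a n * y ^+ n) * (u / y) ^+ M.
Proof.
move=> y0; elim: M => [|M ih]; first by rewrite !big_ord0 !subr0 expr0 mulr1 mulr0 subrr.
rewrite big_ord_recr /= mulrDr ih /quotient_coef !big_ord_recr /=.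
move: (\sum_(i < M) _) (\sum_(i < M) _) => P1 P2.
rewrite !exprS !exprMn exprVn.
have yM : y ^+ M != 0 by rewrite expf_neq0.
move: (y ^+ M) (u ^+ M) yM => e1 e2 e10.
by field; rewrite y0 e10.
Qed.

Lemma pow_lipschitz (y u : C) rho j : 0 <= rho -> cabs y <= rho -> cabs u <= rho ->
  cabs (y ^+ j - u ^+ j) * rho <= cabs (y - u) * j%:R * rho ^+ j.
Proof.
move=> r0 yr ur; elim: j => [|j ih].
  by rewrite !expr0 subrr cabs0 mul0r mulr0 mul0r.
have -> : y ^+ j.+1 - u ^+ j.+1 = y * (y ^+ j - u ^+ j) + (y - u) * u ^+ j.
  by rewrite !exprS; ring.
rewrite (le_trans (ler_wpM2r _ (cabsD _ _)))// mulrDl.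
have -> : cabs (y - u) * j.+1%:R * rho ^+ j.+1 =
  rho * (cabs (y - u) * j%:R * rho ^+ j) + cabs (y - u) * rho ^+ j * rho.
  by rewrite -natr1 exprS; ring.
rewrite lerD//.
  rewrite cabsM -[leLHS]mulrA; apply: ler_pM => //; first exact: cabs_ge0.
  by rewrite mulr_ge0// cabs_ge0.
rewrite cabsM ler_wpM2r// ler_wpM2l ?cabs_ge0// cabsX.
by rewrite lerXn2r// nnegrE cabs_ge0.
Qed.

(** The constants do not depend on y, so the estimate holds along a whole
    contour. When y is far from 0, the geometric series of 1 / (y - u)
    converges; when y is close to 0, F agrees with A and the quotient is a
    difference quotient of A, expanded through the factors y ^+ i - u ^+ i. *)
Lemma quotient_taylor A w0 a B q S r : taylor A w0 a B q -> 0 < r -> 0 <= S ->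
  exists2 rho, 0 < rho & exists2 B', 0 <= B' &
  forall y Fz u M, rho^-1 * cabs u <= 2^-1 -> y != 0 -> y != u -> cabs Fz <= S ->
    (cabs y < r -> Fz = A (w0 + y)) ->
    cabs ((Fz - A (w0 + u)) / (y - u) - \sum_(m < M) quotient_coef a y Fz m * u ^+ m)
     <= B' * (rho^-1 * cabs u) ^+ M.
Proof.
move=> T r0 S0; have [B0 q0 hT] := T.
(* q * rho <= 8^-1 absorbs both the growth of the coefficients and the factor
   i of y ^+ i - u ^+ i *)
pose rho := Num.min r (8 * q)^-1.
have rho0 : 0 < rho by rewrite lt_min r0 invr_gt0 mulr_gt0.
have qrho : q * rho <= 8^-1.
  have : rho <= (8 * q)^-1 by rewrite ge_min lexx orbT.
  by rewrite invfM ler_pdivlMr// mulrC.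
exists rho => //; pose B1 := 2 / rho * (S + 5 * B); pose B2 := 4 * B / rho.
have B10 : 0 <= B1 by rewrite mulr_ge0 ?addr_ge0 ?mulr_ge0 ?invr_ge0// ltW.
have B20 : 0 <= B2 by rewrite !mulr_ge0 ?invr_ge0// ltW.
exists (B1 + B2); first exact: addr_ge0.
move=> y Fz u M hu y0 yu FS FA.
have yu0 : y - u != 0 by rewrite subr_eq0.
have cyu : 0 < cabs (y - u) by rewrite cabs_gt0.
have urho : cabs u <= rho / 2 by rewrite -ler_pdivrMl// mulrC [_^-1 * _]mulrC -mulrC.
set e := rho^-1 * cabs u.
have e0 : 0 <= e by rewrite mulr_ge0 ?cabs_ge0// invr_ge0 ltW.
have que : q * cabs u <= e.
  rewrite /e ler_wpM2r ?cabs_ge0// -[leRHS]div1r ler_pdivlMr//.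
  by apply: le_trans qrho _; lra.
have qu2 : q * cabs u <= 2^-1 by exact: le_trans hu.
have eM0 : 0 <= e ^+ M by rewrite exprn_ge0.
have TMu : cabs (A (w0 + u) - \sum_(n < M) a n * u ^+ n) <= B * e ^+ M.
  rewrite (le_trans (hT u M qu2))// ler_wpM2l// lerXn2r// nnegrE mulr_ge0 ?cabs_ge0//.
  exact: ltW.
pose W := (Fz - \sum_(n < M) a n * y ^+ n) * (u / y) ^+ M -
  (A (w0 + u) - \sum_(n < M) a n * u ^+ n).
have -> : (Fz - A (w0 + u)) / (y - u) - \sum_(m < M) quotient_coef a y Fz m * u ^+ m = W / (y - u).
  apply: (mulfI yu0); rewrite mulrBr quotient_coef_sum// [RHS]mulrC divfK//.
  by rewrite [X in X - _ = _]mulrC divfK// /W; ring.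
rewrite cabsM cabsV ler_pdivrMr//.
have [ry|yr] := leP rho (cabs y).
  have yu2 : rho / 2 <= cabs (y - u).
    by rewrite (le_trans _ (cabs_sub_le _ _))//; lra.
  have uy : cabs (u / y) <= e.
    rewrite cabsM cabsV mulrC /e ler_wpM2r ?cabs_ge0// lef_pV2// posrE//.
    by rewrite (lt_le_trans rho0).
  have uyM : cabs (u / y) ^+ M <= e ^+ M by rewrite lerXn2r// nnegrE ?cabs_ge0.
  have hP : cabs ((\sum_(n < M) a n * y ^+ n) * (u / y) ^+ M) <= 4 * B * e ^+ M.
    rewrite mulr_suml (le_trans (cabs_sum _))//.
    rewrite (@le_trans _ _ (\sum_(n < M) (2 * B * e ^+ M) * 2^-1 ^+ n))//.
      apply: ler_sum => n _.
      have nM : (n <= M)%N by exact: ltnW.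
      have -> : e ^+ M = e ^+ n * e ^+ (M - n) by rewrite -exprD subnKC.
      have -> : (u / y) ^+ M = (u / y) ^+ n * (u / y) ^+ (M - n) by rewrite -exprD subnKC.
      have -> : a n * y ^+ n * ((u / y) ^+ n * (u / y) ^+ (M - n)) =
          a n * u ^+ n * (u / y) ^+ (M - n).
        by rewrite mulrA -[_ * _ * (u / y) ^+ n]mulrA -exprMn mulrCA divff// mulr1.
      rewrite [cabs (_ * _ ^+ (M - n))]cabsM cabsM !cabsX.
      have h1 : cabs (u / y) ^+ (M - n) <= e ^+ (M - n) by rewrite lerXn2r// nnegrE ?cabs_ge0.
      have h2 : cabs (a n) * cabs u ^+ n <= 2 * B * (e ^+ n * 2^-1 ^+ n).
        rewrite -exprMn (le_trans (ler_wpM2r _ (taylor_coef n T))) ?exprn_ge0 ?cabs_ge0//.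
        rewrite -[leLHS]mulrA -[q ^+ n * _]exprMn ler_wpM2l ?mulr_ge0//.
        rewrite lerXn2r ?nnegrE ?mulr_ge0 ?cabs_ge0 ?invr_ge0 ?(ltW q0) ?(ltW rho0)//.
        rewrite /e mulrAC ler_wpM2r ?cabs_ge0// ler_pdivlMl//.
        by rewrite mulrC (le_trans qrho)//; lra.
      apply: (le_trans (ler_pM _ _ h2 h1)); rewrite ?exprn_ge0 ?mulr_ge0 ?cabs_ge0 ?exprn_ge0 ?cabs_ge0//.
      by rewrite le_eqVlt; apply/orP; left; apply/eqP; ring.
    rewrite -mulr_sumr (_ : 4 * B * _ = 2 * B * e ^+ M * 2); last by ring.
    by rewrite ler_wpM2l ?mulr_ge0// sum_geom_le// lexx andbT invr_ge0.
  have hW : cabs W <= (S + 5 * B) * e ^+ M.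
    rewrite /W mulrBl (le_trans (cabsB _ _))//.
    rewrite (le_trans (lerD (cabsB _ _) TMu))//.
    rewrite (_ : (S + 5 * B) * _ = S * e ^+ M + 4 * B * e ^+ M + B * e ^+ M); last by ring.
    rewrite lerD2r lerD// cabsM cabsX ler_pM ?cabs_ge0 ?exprn_ge0 ?cabs_ge0//.
  rewrite (le_trans hW)// (@le_trans _ _ (B1 * e ^+ M * (rho / 2)))//.
    by rewrite /B1 le_eqVlt; apply/orP; left; apply/eqP; field; rewrite gt_eqF.
  apply: ler_pM => //; [exact: mulr_ge0|by rewrite divr_ge0// ltW|].
  by rewrite ler_wpM2r// lerDl.
have yr' : cabs y < r by rewrite (lt_le_trans yr)// ge_min lexx.
have qy8 : q * cabs y <= 8^-1 by rewrite (le_trans _ qrho)// ler_pM2l// ltW.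
have qy2 : q * cabs y <= 2^-1 by rewrite (le_trans qy8)//; lra.
apply: (@le_geom_limit _ _ _ (B * (cabs (u / y) ^+ M + 1))) => n.
pose L := (M + n)%N.
have TL v : q * cabs v <= 2^-1 -> cabs (A (w0 + v) - \sum_(i < L) a i * v ^+ i) <= B * 2^-1 ^+ n.
  move=> qv; rewrite (le_trans (hT v L qv))// ler_wpM2l// /L.
  have qv0 : 0 <= q * cabs v by rewrite mulr_ge0 ?cabs_ge0// ltW.
  rewrite exprD -[leRHS]mul1r ler_pM ?exprn_ge0//.
    by rewrite exprn_ile1// (le_trans qv)//; lra.
  by rewrite lerXn2r// nnegrE.
have split_sum v : \sum_(i < L) a i * v ^+ i =
    \sum_(i < M) a i * v ^+ i + v ^+ M * \sum_(i < n) a (M + i)%N * v ^+ i.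
  rewrite /L big_split_ord /=; congr (_ + _); rewrite mulr_sumr; apply: eq_bigr => i _.
  by rewrite exprD; ring.
pose Q := u ^+ M * \sum_(i < n) a (M + i)%N * (y ^+ i - u ^+ i).
have -> : W = (A (w0 + y) - \sum_(i < L) a i * y ^+ i) * (u / y) ^+ M -
    (A (w0 + u) - \sum_(i < L) a i * u ^+ i) + Q.
  rewrite /W (FA yr') !split_sum /Q.
  have -> : \sum_(i < n) a (M + i)%N * (y ^+ i - u ^+ i) =
    \sum_(i < n) a (M + i)%N * y ^+ i - \sum_(i < n) a (M + i)%N * u ^+ i.
    by rewrite -sumrB; apply: eq_bigr => i _; rewrite mulrBr.
  rewrite exprMn exprVn.
  have yM : y ^+ M != 0 by rewrite expf_neq0.
  move: (\sum_(i < n) _) (\sum_(i < n) _) (\sum_(i < M) _) (\sum_(i < M) _) => s1 s2 s3 s4.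
  by move: (y ^+ M) (u ^+ M) yM => e1 e2 e10; field.
have hQ : cabs Q <= B2 * e ^+ M * cabs (y - u).
  rewrite -(ler_pM2r rho0) /Q cabsM cabsX.
  have h i : cabs (a (M + i)%N * (y ^+ i - u ^+ i)) * rho <=
      2 * B * q ^+ M * cabs (y - u) * 2^-1 ^+ i.
    have ur' : cabs u <= rho by rewrite (le_trans urho)// ler_pdivrMr//; lra.
    have := pow_lipschitz i (ltW rho0) (ltW yr) ur'.
    move=> hl; rewrite cabsM -[leLHS]mulrA.
    apply: (le_trans (ler_pM _ _ (taylor_coef _ T) hl)); rewrite ?cabs_ge0//.
      by rewrite mulr_ge0 ?cabs_ge0// ltW.
    have -> : 2 * B * q ^+ (M + i) * (cabs (y - u) * i%:R * rho ^+ i) =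
        2 * B * q ^+ M * cabs (y - u) * (i%:R * (q * rho) ^+ i).
      by rewrite exprD exprMn; ring.
    rewrite ler_wpM2l ?mulr_ge0 ?exprn_ge0 ?cabs_ge0// ?(ltW q0)//.
    have i2 : i%:R <= 2 ^+ i :> R by rewrite -natrX ler_nat ltnW// ltn_expl.
    have h8 : (q * rho) ^+ i <= 4^-1 ^+ i.
      by rewrite lerXn2r ?nnegrE ?mulr_ge0 ?(ltW q0) ?(ltW rho0)//; lra.
    rewrite (le_trans (ler_pM _ _ i2 h8)) ?exprn_ge0 ?mulr_ge0 ?(ltW q0) ?(ltW rho0)//.
    by rewrite -exprMn lerXn2r ?nnegrE//; lra.
  have hs : cabs (\sum_(i < n) a (M + i)%N * (y ^+ i - u ^+ i)) * rho <=
      4 * B * q ^+ M * cabs (y - u).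
    rewrite (le_trans (ler_wpM2r _ (cabs_sum _)))// ?(ltW rho0)// mulr_suml.
    apply: (@le_trans _ _ (\sum_(i < n) 2 * B * q ^+ M * cabs (y - u) * 2^-1 ^+ i)).
      by apply: ler_sum => i _; exact: h.
    rewrite -mulr_sumr.
    rewrite (_ : 4 * B * _ * _ = 2 * B * q ^+ M * cabs (y - u) * 2); last by ring.
    rewrite ler_wpM2l ?mulr_ge0 ?exprn_ge0 ?cabs_ge0// ?(ltW q0)//.
    by rewrite sum_geom_le// lexx andbT invr_ge0.
  rewrite -[leLHS]mulrA (le_trans (ler_wpM2l _ hs)) ?exprn_ge0 ?cabs_ge0//.
  rewrite (_ : B2 * _ * _ * _ = 4 * B * e ^+ M * cabs (y - u)); last first.
    by rewrite /B2; field; rewrite gt_eqF.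
  rewrite (_ : _ * (_ * _) = 4 * B * (q * cabs u) ^+ M * cabs (y - u)); last first.
    by rewrite exprMn; ring.
  rewrite ler_wpM2r ?cabs_ge0// ler_wpM2l ?mulr_ge0// lerXn2r// nnegrE mulr_ge0 ?cabs_ge0//.
  exact: ltW.
rewrite (le_trans (cabsD _ _))// addrC lerD//.
  rewrite (le_trans hQ)// ler_wpM2r ?cabs_ge0// ler_wpM2r// lerDr//.
rewrite (le_trans (cabsB _ _))//.
have -> : B * (cabs (u / y) ^+ M + 1) * 2^-1 ^+ n =
  B * 2^-1 ^+ n * cabs (u / y) ^+ M + B * 2^-1 ^+ n by ring.
rewrite lerD//; last exact: TL.
by rewrite cabsM cabsX ler_wpM2r ?exprn_ge0 ?cabs_ge0// TL.
Qed.

End DifferenceQuotient.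

(** * Piecewise continuously differentiable functions *)

Section PieceChain.
Context {R : realType}.
Implicit Types (h g : R -> R) (Q : R -> R -> Prop) (a b : R).

Lemma C1_on_sub a b a' b' h : a <= a' -> b' <= b -> C1_on a b h -> C1_on a' b' h.
Proof.
move=> aa bb [g Cg gh]; exists g => // x; rewrite in_itv /= => /andP[x1 x2].
by apply: gh; rewrite in_itv /= (le_trans aa)//= (le_trans x2).
Qed.

Lemma chain_ind h Q (s : seq R) x0 :
  (forall x, Q x x) ->
  (forall x y z, x <= y -> y <= z -> Q x y -> Q y z -> Q x z) ->
  (forall a b, 0 <= a -> a < b -> b <= 1 -> C1_on a b h -> Q a b) ->
  path <%R x0 s -> 0 <= x0 -> last x0 s <= 1 ->
  (forall k, (k < size s)%N -> C1_on (nth 0 (x0 :: s) k) (nth 0 s k) h) ->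
  x0 <= last x0 s /\ Q x0 (last x0 s).
Proof.
move=> Q0 QT Qb; elim: s x0 => [|y s ih] x0 /=; first by move=> _ _ _ _; split.
move=> /andP[x0y py] x00 l1 hk.
have y0 : 0 <= y by rewrite (le_trans x00)// ltW.
have [yl Qyl] := ih y py y0 l1 (fun k => hk k.+1).
split; first by rewrite (le_trans (ltW x0y)).
apply: (QT _ y) => //; first exact: ltW.
apply: Qb => //; first exact: le_trans l1.
exact: (hk 0%N).
Qed.

(** Piecewise properties are proved as additive properties of intervals, so
    that the break points are handled once and for all. *)
Lemma piecewise_ind h Q : piecewise_C1 h ->
  (forall x, Q x x) ->
  (forall x y z, x <= y -> y <= z -> Q x y -> Q y z -> Q x z) ->
  (forall a b, 0 <= a -> a < b -> b <= 1 -> C1_on a b h -> Q a b) ->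
  Q 0 1.
Proof.
move=> [s [ps l1 hk]] Q0 QT Qb.
have l1' : last 0 s <= 1 by rewrite l1.
by have [_] := chain_ind Q0 QT Qb ps (lexx 0) l1' hk; rewrite l1.
Qed.

(** The pieces of h2 are clamped into each piece of h1, which amounts to
    passing to a common refinement. *)
Lemma piecewise_ind2 h1 h2 Q : piecewise_C1 h1 -> piecewise_C1 h2 ->
  (forall x, Q x x) ->
  (forall x y z, x <= y -> y <= z -> Q x y -> Q y z -> Q x z) ->
  (forall a b, 0 <= a -> a < b -> b <= 1 -> C1_on a b h1 -> C1_on a b h2 -> Q a b) ->
  Q 0 1.
Proof.
move=> pc1 pc2 Q0 QT Qb; apply: (piecewise_ind pc1) => // p q p0 pq q1 C1pq.
pose cl x := Num.max p (Num.min x q).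
have cl_mono x y : x <= y -> cl x <= cl y.
  move=> xy; rewrite /cl ge_max le_max lexx /= le_max; apply/orP; right.
  by rewrite le_min ge_min xy /= ge_min lexx orbT.
have <- : cl 0 = p by rewrite /cl; apply/max_idPl; rewrite ge_min p0.
have <- : cl 1 = q by rewrite /cl (min_idPr q1); apply/max_idPr; exact: ltW.
apply: (piecewise_ind (Q := fun x y => Q (cl x) (cl y)) pc2) => //.
  by move=> x y z xy yz; apply: QT; exact: cl_mono.
move=> a b a0 ab b1 C2ab.
have : cl a <= cl b by apply: cl_mono; exact: ltW.
rewrite le_eqVlt => /predU1P[-> //|cab].
have pcl x : p <= cl x by rewrite /cl le_max lexx.
have clq x : cl x <= q by rewrite /cl ge_max ltW//= ge_min lexx orbT.
have acl : a <= cl a.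
  rewrite leNgt; apply/negP => cla.
  have qa : q < a.
    by move: cla; rewrite /cl gt_max => /andP[_]; rewrite gt_min ltxx.
  have qcla : cl a = q by rewrite /cl (min_idPr (ltW qa)); apply/max_idPr; exact: ltW.
  by move: cab; rewrite qcla ltNge clq.
have clb : cl b <= b.
  rewrite leNgt; apply/negP => bcl.
  have bp : b < p.
    by move: bcl; rewrite /cl lt_max => /orP[//|]; rewrite lt_min ltxx.
  have pclb : cl b = p.
    by rewrite /cl; apply/max_idPl; rewrite ge_min ltW.
  by move: cab; rewrite pclb ltNge pcl.
apply: Qb => //; first exact: le_trans (pcl a).
- by rewrite (le_trans (clq b)).
- exact: C1_on_sub C1pq.
- exact: C1_on_sub C2ab.
Qed.

Local Notation mu := (@lebesgue_measure R).

Lemma itv_cc_split (x y z : R) : x <= y -> y <= z ->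
  `[x, z]%classic = `[x, y]%classic `|` `[y, z]%classic.
Proof.
move=> xy yz; apply/seteqP; split => t /=; rewrite !in_itv /=.
  move=> /andP[t1 t2]; have [ty|/ltW ty] := leP t y; [left|right].
    by rewrite t1.
  by rewrite ty.
move=> [/andP[t1 t2]|/andP[t1 t2]].
  by rewrite t1 (le_trans t2).
by rewrite t2 (le_trans xy).
Qed.

Lemma piecewise_C1_continuous h : piecewise_C1 h -> {within `[0, 1], continuous h}.
Proof.
move=> pc; apply: (piecewise_ind (Q := fun a b => {within `[a, b], continuous h}) pc).
- by move=> x; rewrite set_itv1; exact: continuous_subspace1.
- move=> x y z xy yz hxy hyz.
  rewrite (itv_cc_split xy yz).
  by apply: withinU_continuous => //; exact: itv_closed.
- move=> a b a0 ab b1 [g [dg cg] gh].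
  apply: (@subspace_eq_continuous _ _ _ (g : R -> R)).
    by move=> x /set_mem xab; rewrite /from_subspace /= gh.
  apply: continuous_subspaceT => x.
  exact/differentiable_continuous/derivable1_diffP.
Qed.

(** At an end point of a piece, the two-sided derivative of h need not be
    that of g: h may have a corner there. *)
Lemma C1_on_derive a b h : a < b -> C1_on a b h ->
  exists g, [/\ C1 g, {in `[a, b], h =1 g} & {in `]a, b[, derive1 h =1 derive1 g}].
Proof.
move=> ab [g Cg gh]; exists g; split => // x xab.
rewrite !derive1E; apply: near_eq_derive.
by near=> y; apply: gh; apply: subset_itv_oo_cc; near: y; exact: near_in_itvoo.
Unshelve. all: by end_near. Qed.

(** The derivative of h at a break point is an arbitrary value; it enters the
    bound as one more term of a maximum. *)
Lemma piecewise_C1_derive_bounded h : piecewise_C1 h -> measurable_fun `[0 : R, 1] (derive1 h) /\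
  exists B, forall t, t \in `[0, 1] -> `|derive1 h t| <= B.
Proof.
move=> pc; apply: (piecewise_ind (Q := fun a b => measurable_fun `[a, b] (derive1 h) /\
  exists B, forall t, t \in `[a, b] -> `|derive1 h t| <= B) pc).
- move=> x; split; first by rewrite set_itv1; exact: measurable_fun_set1.
  exists `|derive1 h x| => t; rewrite in_itv /= => /andP[t1 t2].
  by have -> : t = x by apply/eqP; rewrite eq_le t1 t2.
- move=> x y z xy yz [m1 [B1 hB1]] [m2 [B2 hB2]].
  rewrite (itv_cc_split xy yz).
  split; first by apply/measurable_funU.
  exists (Num.max B1 B2) => t; rewrite in_itv /= => /andP[t1 t2].
  have [ty|/ltW ty] := leP t y; rewrite le_max.
    by rewrite hB1// in_itv /= t1.
  by rewrite hB2 ?orbT// in_itv /= ty.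
- move=> a b a0 ab b1 /(C1_on_derive ab)[g [[dg cg] gh gh']].
  split.
    apply: (@measurable_fun_itv_cc _ _ _ false true).
    apply: (eq_measurable_fun (derive1 g)); first by move=> x; rewrite inE => /gh' ->.
    by apply: measurable_funTS; exact: continuous_measurable_fun.
  have [c _ cmax] : exists2 c, c \in `[a, b] & forall t, t \in `[a, b] ->
      `|derive1 g t| <= `|derive1 g c|.
    apply: (@EVT_max _ (fun t => `|derive1 g t|)); first exact: ltW.
    apply: continuous_subspaceT => x; apply: continuous_comp; first exact: cg.
    exact: norm_continuous.
  exists (Num.max `|derive1 g c| (Num.max `|derive1 h a| `|derive1 h b|)) => t.
  rewrite in_itv /= => /andP[t1 t2]; rewrite !le_max.
  have [->|ta] := eqVneq t a; first by rewrite lexx orbT.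
  have [->|tb] := eqVneq t b; first by rewrite lexx !orbT.
  rewrite gh' ?cmax// in_itv /= ?t1 ?t2//.
  by rewrite !lt_neqAle t1 t2 eq_sym ta tb.
Qed.

End PieceChain.

(** * The fundamental theorem of calculus for curves *)

Section ComplexFTC.
Context {R : realType}.
Local Notation C := R[i].
Local Notation mu := (@lebesgue_measure R).
Implicit Types (f g : R -> C) (t a b : R).

(** The derivative of a complex-valued curve, by coordinates. *)
Definition cder f t (l : C) :=
  is_derive t 1 (fun s => complex.Re (f s)) (complex.Re l) /\
  is_derive t 1 (fun s => complex.Im (f s)) (complex.Im l).

Lemma cderM f g t l m : cder f t l -> cder g t m ->
  cder (fun s => f s * g s) t (l * g t + f t * m).
Proof.
move=> [f1 f2] [g1 g2]; split.
  have -> : (fun s => complex.Re (f s * g s)) =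
     (fun s => complex.Re (f s)) * (fun s => complex.Re (g s)) -
     (fun s => complex.Im (f s)) * (fun s => complex.Im (g s)).
    by apply/funext => s; rewrite ReM.
  apply: (is_derive_eq (is_deriveB (is_deriveM f1 g1) (is_deriveM f2 g2))).
  rewrite ReD !ReM /GRing.scale /=; ring.
have -> : (fun s => complex.Im (f s * g s)) =
   (fun s => complex.Re (f s)) * (fun s => complex.Im (g s)) +
   (fun s => complex.Im (f s)) * (fun s => complex.Re (g s)).
  by apply/funext => s; rewrite ImM.
apply: (is_derive_eq (is_deriveD (is_deriveM f1 g2) (is_deriveM f2 g1))).
rewrite ImD !ImM /GRing.scale /=; ring.
Qed.

Lemma cder_cst (c : C) t : cder (fun=> c) t 0.
Proof. by split; exact: is_derive_cst. Qed.

Lemma cderB_cst f t l (c : C) : cder f t l -> cder (fun s => f s - c) t l.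
Proof.
move=> [f1 f2]; split.
  have -> : (fun s => complex.Re (f s - c)) = (fun s => complex.Re (f s)) - cst (complex.Re c).
    by apply/funext => s; rewrite ReD ReN.
  by apply: is_derive_eq; rewrite subr0.
have -> : (fun s => complex.Im (f s - c)) = (fun s => complex.Im (f s)) - cst (complex.Im c).
  by apply/funext => s; rewrite ImD ImN.
by apply: is_derive_eq; rewrite subr0.
Qed.

Lemma cderV f t l : f t != 0 -> cder f t l ->
  cder (fun s => (f s)^-1) t (- l * (f t)^-1 ^+ 2).
Proof.
move=> ft0 [f1 f2].
pose N := (fun s => complex.Re (f s)) * (fun s => complex.Re (f s)) +
  (fun s => complex.Im (f s)) * (fun s => complex.Im (f s)).
have NE s : N s = cabs (f s) ^+ 2 by rewrite sqr_cabs.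
have Nt0 : N t != 0 by rewrite NE expf_neq0// cabs_eq0.
have dN : is_derive t 1 N (2 * complex.Re (f t) * complex.Re l +
    2 * complex.Im (f t) * complex.Im l).
  apply: (is_derive_eq (is_deriveD (is_deriveM f1 f1) (is_deriveM f2 f2))).
  rewrite /GRing.scale /=; ring.
have dNV := is_deriveV Nt0 dN.
have hN : N t = complex.Re (f t) ^+ 2 + complex.Im (f t) ^+ 2 by [].
have N0 := Nt0; rewrite hN in N0.
split.
  have -> : (fun s => complex.Re (f s)^-1) = (fun s => complex.Re (f s)) * (fun s => (N s)^-1).
    by apply/funext => s; rewrite ReV -NE.
  apply: (is_derive_eq (is_deriveM f1 dNV)).
  rewrite -exprVn ReM ReN ImN expr2 ReM ImM ReV ImV -NE /GRing.scale /= hN; field.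
  exact: N0.
have -> : (fun s => complex.Im (f s)^-1) = - ((fun s => complex.Im (f s)) * (fun s => (N s)^-1)).
  by apply/funext => s; rewrite ImV -NE.
apply: (is_derive_eq (is_deriveN (is_deriveM f2 dNV))).
rewrite -exprVn ImM ReN ImN expr2 ReM ImM ReV ImV -NE /GRing.scale /= hN; field.
exact: N0.
Qed.

Lemma cderX f t l n : cder f t l -> cder (fun s => f s ^+ n) t (n%:R * f t ^+ n.-1 * l).
Proof.
move=> fl; elim: n => [|n ih].
  rewrite /= mul0r mul0r.
  have -> : (fun s => f s ^+ 0) = (fun=> 1) by apply/funext => s; rewrite expr0.
  exact: cder_cst.
have -> : (fun s => f s ^+ n.+1) = (fun s => f s * f s ^+ n).
  by apply/funext => s; rewrite exprS.
have := cderM fl ih; congr cder; case: n {ih} => [|n] /=; first by rewrite !expr0; ring.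
by rewrite -[n.+2%:R]natr1 exprS; ring.
Qed.

Lemma cder_continuous f t l : cder f t l ->
  {for t, continuous (fun s => complex.Re (f s))} /\
  {for t, continuous (fun s => complex.Im (f s))}.
Proof.
by move=> [[f1 _] [f2 _]]; split; apply/differentiable_continuous/derivable1_diffP.
Qed.

Definition ccont f t := {for t, continuous (fun s => complex.Re (f s))} /\
  {for t, continuous (fun s => complex.Im (f s))}.

Lemma ccontM f g t : ccont f t -> ccont g t -> ccont (fun s => f s * g s) t.
Proof.
move=> [f1 f2] [g1 g2]; split.
  have -> : (fun s => complex.Re (f s * g s)) = (fun s =>
     complex.Re (f s) * complex.Re (g s) - complex.Im (f s) * complex.Im (g s)).
    by apply/funext => s; rewrite ReM.
  exact: (continuousB (continuousM f1 g1) (continuousM f2 g2)).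
have -> : (fun s => complex.Im (f s * g s)) = (fun s =>
   complex.Re (f s) * complex.Im (g s) + complex.Im (f s) * complex.Re (g s)).
  by apply/funext => s; rewrite ImM.
exact: (continuousD (continuousM f1 g2) (continuousM f2 g1)).
Qed.

Lemma ccont_cst (c : C) t : ccont (fun=> c) t.
Proof. by split; exact: cvg_cst. Qed.

Lemma ccontX f t n : ccont f t -> ccont (fun s => f s ^+ n) t.
Proof.
move=> h; elim: n => [|n ih]; first exact: ccont_cst.
by under eq_fun do rewrite exprS; exact: ccontM.
Qed.

Lemma cbm_ccont f a b : (forall t, t \in `[a, b] -> ccont f t) -> a <= b ->
  cbm `[a, b] f.
Proof.
move=> fc ab.
have c1 : {within `[a, b], continuous (fun s => complex.Re (f s))}.
  by apply: continuous_in_subspaceT => t /set_mem /= /fc [].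
have c2 : {within `[a, b], continuous (fun s => complex.Im (f s))}.
  by apply: continuous_in_subspaceT => t /set_mem /= /fc [].
split.
  by split; apply: subspace_continuous_measurable_fun => //; exact: measurable_itv.
have nc (h : R -> R) : {within `[a, b], continuous h} -> {within `[a, b], continuous (fun t => `|h t|)}.
  by move=> hc x; apply: continuous_comp; [exact: hc|exact: norm_continuous].
have [x1 _ h1] := EVT_max ab (nc _ c1).
have [x2 _ h2] := EVT_max ab (nc _ c2).
eexists => t tab; rewrite (le_trans (cabs_le_ReIm _))//.
by apply: lerD; [exact: h1|exact: h2].
Qed.

Lemma lebesgue_itv_lty a b : (mu `[a, b] < +oo)%E.
Proof.
rewrite lebesgue_measure_itv; case: ifP => _ //=.
by rewrite -EFinB ltry.
Qed.

Lemma real_FTC (F f : R -> R) a b : a < b ->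
  (forall t, t \in `[a, b] -> is_derive t 1 F (f t)) ->
  (forall t, t \in `[a, b] -> {for t, continuous f}) ->
  \int[mu]_(t in `[a, b]) f t = F b - F a.
Proof.
move=> ab dF cf; rewrite /Rintegral (@continuous_FTC2 _ f F a b)//.
- by apply: continuous_in_subspaceT => t /set_mem /=; exact: cf.
- have cF t : t \in `[a, b] -> {for t, continuous F}.
    by move=> /dF[? _]; exact/differentiable_continuous/derivable1_diffP.
  split.
  + by move=> t tab; have [] := dF t (subset_itv_oo_cc tab).
  + by apply: cvg_at_right_filter; apply: cF; rewrite bound_itvE ltW.
  + by apply: cvg_at_left_filter; apply: cF; rewrite bound_itvE ltW.
- move=> t tab; have [_ <-] := dF t (subset_itv_oo_cc tab).
  by rewrite derive1E.
Qed.

Lemma CI_FTC (F f : R -> C) a b : a < b ->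
  (forall t, t \in `[a, b] -> cder F t (f t)) ->
  (forall t, t \in `[a, b] -> ccont f t) ->
  CI mu `[a, b] f = F b - F a.
Proof.
move=> ab dF cf; apply: complexP; rewrite ?ReD ?ReN ?ImD ?ImN /=.
  apply: (@real_FTC (fun t => complex.Re (F t)) (fun t => complex.Re (f t))) => //.
    by move=> t /dF[].
  by move=> t /cf[].
apply: (@real_FTC (fun t => complex.Im (F t)) (fun t => complex.Im (f t))) => //.
  by move=> t /dF[].
by move=> t /cf[].
Qed.

Lemma CI_itv_split f a b c : a <= b -> b <= c -> cbm `[a, c] f ->
  CI mu `[a, c] f = CI mu `[a, b] f + CI mu `[b, c] f.
Proof.
move=> ab bc hf.
have [i1 i2] := cbm_integrable (mu := mu) (measurable_itv _) (lebesgue_itv_lty a c) hf.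
have acE : `[a, c]%classic = `[a, b]%classic `|` `]b, c]%classic :> set R.
  by rewrite -itv_bndbnd_setU.
have S1 : (`]b, c]%classic : set R) `<=` `[a, c]%classic.
  by move=> t /=; rewrite !in_itv /= => /andP[bt ->]; rewrite andbT (le_trans ab)// ltW.
have add h : mu.-integrable `[a, c] (EFin \o h) ->
    \int[mu]_(t in `[a, c]) h t = \int[mu]_(t in `[a, b]) h t + \int[mu]_(t in `[b, c]) h t.
  move=> ih; rewrite {1}acE Rintegral_setU//; [|by rewrite -acE|].
    rewrite Rintegral_itv_obnd_cbnd//.
    by apply: integrableS ih => //.
  rewrite disj_set2E; apply/eqP; rewrite -subset0 => t [] /=; rewrite !in_itv /=.
  by move=> /andP[_ tb] /andP[bt _]; move: bt; rewrite ltNge tb.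
by congr (_ +i* _); exact: add.
Qed.

End ComplexFTC.

(** * Contours and winding numbers *)

Section Contour.
Context {R : realType}.
Local Notation C := R[i].
Local Notation mu := (@lebesgue_measure R).
Local Notation D := (`[0 : R, 1]%classic).
Variable gamma : R -> C.
Hypothesis cg : contour gamma.
Local Notation image := (contour_image gamma).
Local Notation dgamma := (path_derive gamma).

Lemma contour_integralE f :
  contour_integral gamma f = CI mu D (fun t => f (gamma t) * dgamma t).
Proof. by []. Qed.

Lemma measurable_unit : measurable D.
Proof. exact: measurable_itv. Qed.

Lemma mu_unit : mu D = 1%E.
Proof. by rewrite lebesgue_measure_itv /= lte_fin ltr01 oppr0 adde0. Qed.

Lemma mu_unit_lty : (mu D < +oo)%E.
Proof. by rewrite mu_unit ltry. Qed.

Local Notation mD := measurable_unit.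
Local Notation muD := mu_unit_lty.

Lemma contour_within : {within D, continuous gamma}.
Proof.
case: cg => /piecewise_C1_continuous/subspace_continuousP h1 /piecewise_C1_continuous/subspace_continuousP h2 _ _.
by apply/subspace_continuousP => x Dx; apply: cvg_ReIm; [exact: h1|exact: h2].
Qed.

Lemma contour_compact : compact image.
Proof. by apply: continuous_compact; [exact: contour_within|exact: segment_compact]. Qed.

Lemma contour_bounded : exists2 L, 0 <= L & forall t, D t -> cabs (gamma t) <= L.
Proof.
have [t _ ht] : exists2 t, t \in `[0 : R, 1] & forall s, s \in `[0, 1] ->
    cabs (gamma s) <= cabs (gamma t).
  apply: (@EVT_max _ (fun s => cabs (gamma s))) => //.
  move=> x; apply: continuous_comp; first exact: contour_within.
  exact: continuous_cabs.
by exists (cabs (gamma t)); [exact: cabs_ge0|move=> s; exact: ht].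
Qed.

Lemma contour_far w : ~ image w -> exists2 b, 0 < b & forall t, D t -> b <= cabs (gamma t - w).
Proof.
move=> nw; have cI : closed image.
  by apply: compact_closed; [exact: norm_hausdorff|exact: contour_compact].
have : nbhs w (~` image) by apply: open_nbhs_nbhs; split => //; exact: closed_openC.
move=> /nbhs_cabsP[r r0 hr]; exists r => // t Dt.
by rewrite leNgt; apply/negP => /hr; apply; exists t.
Qed.

Lemma cbm_within (f : R -> C) : {within D, continuous f} -> cbm D f.
Proof.
move=> cf; split.
  split; apply: subspace_continuous_measurable_fun; rewrite ?mD// => x.
    by apply: continuous_comp; [exact: cf|exact: continuous_Re].
  by apply: continuous_comp; [exact: cf|exact: continuous_Im].
have [t _ ht] : exists2 t, t \in `[0 : R, 1] & forall s, s \in `[0, 1] ->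
    cabs (f s) <= cabs (f t).
  apply: (@EVT_max _ (fun s => cabs (f s))) => //.
  by move=> x; apply: continuous_comp; [exact: cf|exact: continuous_cabs].
by exists (cabs (f t)) => s; exact: ht.
Qed.

Lemma cbm_gamma : cbm D gamma.
Proof. exact/cbm_within/contour_within. Qed.

Lemma cbm_comp F : (forall z, image z -> holo F z) -> cbm D (fun t => F (gamma t)).
Proof.
move=> hF; apply: cbm_within; apply/subspace_continuousP => x Dx.
have /subspace_continuousP/(_ x Dx) h := contour_within.
apply: (cvg_comp _ _ h).
by apply: holo_continuous_at; apply: hF; exists x.
Qed.

Lemma cbm_dgamma : cbm D dgamma.
Proof.
case: cg => /piecewise_C1_derive_bounded[m1 [B1 h1]] /piecewise_C1_derive_bounded[m2 [B2 h2]] _ _.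
split; first by split.
by exists (B1 + B2) => t Dt; rewrite (le_trans (cabs_le_ReIm _))// lerD ?h1 ?h2.
Qed.

Lemma cbm_inv w : ~ image w -> cbm D (fun t => (gamma t - w)^-1).
Proof.
move=> /contour_far[b b0 hb]; apply: (cbmV b0 hb).
by apply: cmeasB; [exact: cbm_gamma.1|exact: cmeas_cst].
Qed.

(** A simple contour passes through w at one parameter of [0, 1[ at most; the
    point 1 is added for the closing point. *)
Lemma null_fiber w : exists S : set R, [/\ measurable S, mu S = 0%E &
  forall t, D t -> gamma t = w -> S t].
Proof.
have [[t0 [t0D t0w]]|nt] := pselect (exists t : R, (t \in `[0, 1[) /\ gamma t = w).
  exists [set t0; 1]; split.
  - by apply: measurableU.
  - by apply: countable_lebesgue_measure0; exact: finite_set_countable.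
  - move=> t; rewrite /= in_itv /= => /andP[t1 t2] tw.
    have [->|tn1] := eqVneq t 1; first by right.
    left; apply: (contour_simple cg) => //; last by rewrite tw.
    by rewrite in_itv /= t1 lt_neqAle tn1.
exists [set 1]; split => //; first exact: lebesgue_measure_set1.
move=> t; rewrite /= in_itv /= => /andP[t1 t2] tw.
apply/eqP; apply: contrapT => /negP tn1; apply: nt; exists t; split => //.
by rewrite in_itv /= t1 lt_neqAle tn1.
Qed.

(** Off w the integrand has the primitive - (z - w)^-1 ^+ m / m, and the
    contour is closed. *)
Lemma contour_pow w m : ~ image w -> (0 < m)%N ->
  contour_integral gamma (fun z => (z - w)^-1 ^+ m.+1) = 0.
Proof.
move=> nw m0; rewrite contour_integralE.
pose f t := (gamma t - w)^-1 ^+ m.+1 * dgamma t.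
pose c : C := - m%:R; pose Phi t := (gamma t - w)^-1 ^+ m.
have hf : cbm D f by apply: cbmM; [apply: cbmX; exact: cbm_inv|exact: cbm_dgamma].
have hcf : cbm D (fun t => c * f t) by apply: cbmM => //; exact: cbm_cst.
suff h : c * CI mu D f = 0.
  move/eqP : h; rewrite mulf_eq0 oppr_eq0 pnatr_eq0 eqn0Ngt m0 /= => /eqP h.
  by rewrite -[RHS]h.
rewrite -(CIZ (mu := mu) mD muD)//.
have subD (a b : R) : 0 <= a -> b <= 1 -> `[a, b]%classic `<=` D.
  move=> a0 b1 t /=; rewrite !in_itv /= => /andP[at_ tb].
  by rewrite (le_trans a0)// (le_trans tb).
have cbmS (g : R -> C) (a b : R) : 0 <= a -> b <= 1 -> cbm D g -> cbm `[a, b] g.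
  move=> a0 b1 [h1 [B hB]]; split; first exact: (cmeas_sub mD (subD _ _ a0 b1)) h1.
  by exists B => t /(subD _ _ a0 b1) /hB.
have : 0 <= (0:R) -> (1:R) <= 1 -> CI mu `[0, 1] (fun t => c * f t) = Phi 1 - Phi 0.
  case: (cg) => pc1 pc2 _ _.
  apply: (piecewise_ind2 (Q := fun a b => 0 <= a -> b <= 1 ->
     CI mu `[a, b] (fun t => c * f t) = Phi b - Phi a) pc1 pc2).
  - move=> x x0 x1; rewrite subrr set_itv1; apply: complexP; exact: Rintegral_set1.
  - move=> x y z xy yz hxy hyz x0 z1.
    rewrite (CI_itv_split xy yz); last exact: cbmS.
    by rewrite hxy ?hyz ?(le_trans x0)// ?(le_trans yz)//; ring.
  move=> a b a0 ab b1 /(C1_on_derive ab)[g1 [[d1 c1] e1 f1]].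
  move=> /(C1_on_derive ab)[g2 [[d2 c2] e2 f2]] _ _.
  pose G t := g1 t +i* g2 t; pose G' t := derive1 g1 t +i* derive1 g2 t.
  have GE t : t \in `[a, b] -> gamma t = G t.
    by move=> tab; apply: complexP => /=; [exact: e1|exact: e2].
  have Gw t : t \in `[a, b] -> G t - w != 0.
    move=> tab; rewrite -GE// subr_eq0; apply/eqP => gw; apply: nw.
    by exists t => //; exact: (subD _ _ a0 b1).
  have dG t : cder G t (G' t).
    by split => /=; rewrite derive1E; split.
  have cG t : ccont G t.
    by have [] := cder_continuous (dG t); split.
  have cG' t : ccont G' t by split; [exact: c1|exact: c2].
  have dPhi t : t \in `[a, b] ->
      cder (fun s => (G s - w)^-1 ^+ m) t (c * ((G t - w)^-1 ^+ m.+1 * G' t)).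
    move=> tab; have := cderX m (cderV (Gw t tab) (cderB_cst w (dG t))).
    congr cder; rewrite /c; case: (m) m0 => // k _ /=.
    by rewrite !exprS; move: ((G t - w)^-1) => e; rewrite expr0; ring.
  have cinv t : t \in `[a, b] -> ccont (fun s => (G s - w)^-1) t.
    move=> tab; have := cder_continuous (cderV (Gw t tab) (cderB_cst w (dG t))).
    by [].
  have cf t : t \in `[a, b] -> ccont (fun t => c * ((G t - w)^-1 ^+ m.+1 * G' t)) t.
    move=> tab; apply: ccontM; first exact: ccont_cst.
    by apply: ccontM => //; apply: ccontX; exact: cinv.
  rewrite {1}/Phi {1}/Phi !GE ?bound_itvE ?ltW//.
  rewrite -(CI_FTC ab dPhi cf).
  apply: (@CI_null _ _ _ mu _ (measurable_itv _) (lebesgue_itv_lty a b) _ _ [set a; b]).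
  - by apply: measurableU.
  - by apply: countable_lebesgue_measure0; exact: finite_set_countable.
  - exact: cbmS.
  - by apply: cbm_ccont => //; exact: ltW.
  - move=> t tab /= /not_orP[ta tb].
    have tab' : t \in `]a, b[.
      move: tab; rewrite /= !in_itv /= !lt_neqAle => /andP[-> ->].
      by rewrite !andbT; apply/andP; split; apply/eqP => // ?; exact: ta.
    congr (c * (_ * _)); first by rewrite GE.
    by apply: complexP => /=; [rewrite f1|rewrite f2].
move=> /(_ (lexx _) (lexx _)) ->.
by rewrite /Phi (contour_closed cg) subrr.
Qed.

(** This is 2 pi i times [winding_number]. *)
Definition winding_integral w := contour_integral gamma (fun z => (z - w)^-1).

(** The contour is bounded, so the denominators tend to infinity uniformly
    along it. *)
Lemma cauchy_decay f : cbm D f -> forall e, 0 < e -> exists L, forall w, L <= cabs w ->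
  cabs (CI mu D (fun t => f t / (gamma t - w))) < e.
Proof.
move=> [mf [B hB]] e e0; have [L L0 hL] := contour_bounded.
have B0 : 0 <= B.
  by apply: le_trans (hB 0 _); [exact: cabs_ge0|rewrite /= in_itv /= lexx ler01].
exists (L + (2 * B + 1) / e) => w hw.
have d0 : 0 < (2 * B + 1) / e by rewrite divr_gt0// ltr_wpDl// mulr_ge0.
have far t : D t -> (2 * B + 1) / e <= cabs (gamma t - w).
  move=> Dt; rewrite cabs_distC (le_trans _ (cabs_sub_le _ _))//.
  by have := hL t Dt; lra.
pose b := B / ((2 * B + 1) / e).
apply: (@le_lt_trans _ _ (2 * b * fine (mu D))).
  apply: (CI_le (mu := mu) (S := set0) mD muD) => //.
  - apply: cmeasM => //; apply: cmeasV; apply: cmeasB; first exact: cbm_gamma.1.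
    exact: cmeas_cst.
  - by rewrite divr_ge0// ltW.
  - move=> t Dt _; rewrite cabsM cabsV ler_pM ?cabs_ge0 ?invr_ge0 ?cabs_ge0//; first exact: hB.
    by rewrite lef_pV2 ?posrE//; [exact: far|exact: (lt_le_trans d0 (far t Dt))].
rewrite mu_unit /= mulr1 /b.
have h : 0 < 2 * B + 1 by rewrite ltr_wpDl// mulr_ge0.
have -> : 2 * (B / ((2 * B + 1) / e)) = 2 * B * e / (2 * B + 1).
  by field; rewrite !gt_eqF.
by rewrite ltr_pdivrMr//; nra.
Qed.

(** In the expansion of 1 / (z - w) in powers of w - w0, every term but the
    first integrates to zero by [contour_pow]. *)
Lemma winding_integral_locally_constant w0 : ~ image w0 ->
  exists2 r, 0 < r & forall w, cabs (w - w0) < r -> ~ image w /\ winding_integral w = winding_integral w0.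
Proof.
move=> nw0; have [b b0 hb] := contour_far nw0.
exists (b / 2); first by rewrite divr_gt0.
move=> w wb.
have far t : D t -> b / 2 <= cabs (gamma t - w).
  move=> Dt; have -> : gamma t - w = (gamma t - w0) - (w - w0) by ring.
  by rewrite (le_trans _ (cabs_sub_le _ _))//; have := hb t Dt; lra.
have nw : ~ image w.
  move=> [t Dt tw]; have := far t Dt; rewrite tw subrr cabs0 leNgt divr_gt0//.
split => //.
have [_ [B' hB']] := cbm_dgamma.
pose d M := CI mu D (fun t => (w - w0) ^+ M * ((gamma t - w0)^-1 ^+ M * (gamma t - w)^-1 * dgamma t)).
have cb M : cbm D (fun t => (gamma t - w0)^-1 ^+ M * (gamma t - w)^-1 * dgamma t).
  apply: cbmM; last exact: cbm_dgamma.
  by apply: cbmM; [apply: cbmX|]; exact: cbm_inv.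
have cbw M : cbm D (fun t => (w - w0) ^+ M * ((gamma t - w0)^-1 ^+ M * (gamma t - w)^-1 * dgamma t)).
  by apply: cbmM; [exact: cbm_cst|exact: cb].
(* d M is the remainder of the expansion after M terms *)
have dS M : d M - d M.+1 = (w - w0) ^+ M *
    contour_integral gamma (fun z => (z - w0)^-1 ^+ M.+1).
  rewrite contour_integralE -(CIZ (mu := mu) mD muD); last first.
    by apply: cbmM; [apply: cbmX; exact: cbm_inv|exact: cbm_dgamma].
  rewrite /d -(CIB (mu := mu) mD muD (cbw M) (cbw M.+1)).
  apply: CI_eq => t Dt; rewrite !exprS.
  have n0 : gamma t - w0 != 0.
    by rewrite -cabs_gt0 (lt_le_trans b0)// hb.
  have n1 : gamma t - w != 0.
    by rewrite -cabs_gt0 (lt_le_trans _ (far t Dt))// divr_gt0.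
  move: (_ ^+ M) (_ ^+ M) => e1 e2.
  by field; rewrite n0 n1.
have d0 : d 0%N = winding_integral w.
  by apply: CI_eq => t _; rewrite !expr0 !mul1r.
have d1 : d 0%N - d 1%N = winding_integral w0.
  by rewrite dS expr0 mul1r.
have dM M : d M.+1 = d 1%N.
  elim: M => // M <-; apply/eqP; rewrite eq_sym -subr_eq0 dS contour_pow// mulr0//.
apply/eqP; rewrite -subr_eq0 -d0 -d1 opprB addrC subrK -cabs_eq0 eq_le cabs_ge0 andbT.
have B'0 : 0 <= B'.
  by apply: le_trans (hB' 0 _); [exact: cabs_ge0|rewrite /= in_itv /= lexx ler01].
apply: (@le_geom_limit _ _ _ (2 * (2 / b * B'))) => n; rewrite add0r -(dM n).
apply: (@le_trans _ _ (2 * (2 / b * B' * 2^-1 ^+ n) * fine (mu D))); last first.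
  by rewrite mu_unit /= mulr1 mulrA.
apply: (CI_le (mu := mu) (S := set0) mD muD) => //; first exact: (cbw _).1.
  by rewrite !mulr_ge0// ?exprn_ge0// invr_ge0 ltW.
move=> t Dt _; rewrite mulrA mulrA -exprMn !cabsM !cabsX.
have h1 : cabs ((w - w0) / (gamma t - w0)) <= 2^-1.
  rewrite cabsM cabsV ler_pdivrMr ?(lt_le_trans b0) ?hb//.
  by have := hb t Dt; lra.
have h2 : cabs ((w - w0) / (gamma t - w0)) ^+ n.+1 <= 2^-1 ^+ n.
  rewrite exprS -[leRHS]mul1r ler_pM ?cabs_ge0 ?exprn_ge0 ?cabs_ge0//; last first.
    by rewrite lerXn2r ?nnegrE ?cabs_ge0.
  by rewrite (le_trans h1)//; lra.
have h3 : cabs (gamma t - w)^-1 <= 2 / b.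
  rewrite cabsV -[2 / b]invrK invf_div lef_pV2 ?posrE ?divr_gt0 ?far//.
  by rewrite (lt_le_trans _ (far t Dt))// divr_gt0.
rewrite [leRHS]mulrC mulrA; apply: ler_pM; rewrite ?mulr_ge0 ?exprn_ge0 ?cabs_ge0//; last exact: hB'.
by rewrite ler_pM ?exprn_ge0 ?cabs_ge0.
Qed.

(** The winding integral is constant on a component of the complement, by
    local constancy, and small far away, hence zero on an unbounded
    component. *)
Lemma winding_integral_outside w : ~ image w -> ~ contour_interior gamma w -> winding_integral w = 0.
Proof.
move=> nw ni; pose A := connected_component (~` image) w.
have Aw : A w by exact: connected_component_refl.
have AI z : A z -> ~ image z by move=> /connected_component_sub.
have Aci z : A z -> winding_integral z = winding_integral w.
  move: z; have : A `&` [set z | winding_integral z = winding_integral w] = A.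
    have lc (c : C) : open [set z | ~ image z /\ winding_integral z = c].
      rewrite openE => z [nz zc]; rewrite /interior.
      have [r r0 hr] := winding_integral_locally_constant nz.
      by apply/nbhs_cabsP; exists r => // u /hr[h1 h2]; split => //; rewrite h2.
    apply: (@component_connected _ (~` image) w).
    - by exists w.
    - exists [set z | ~ image z /\ winding_integral z = winding_integral w]; first exact: lc.
      by apply/seteqP; split => z /= [h1]; [move=> h2|move=> [_ h2]]; split => //; split => //; exact: AI.
    - exists (~` [set z | ~ image z /\ winding_integral z != winding_integral w]).
        apply: open_closedC; rewrite openE => z [nz zc]; rewrite /interior.
        have [r r0 hr] := winding_integral_locally_constant nz.
        by apply/nbhs_cabsP; exists r => // u /hr[h1 h2]; split => //; rewrite h2.
      apply/seteqP; split => z /= [h1].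
        by move=> h2; split => // -[_]; rewrite h2 eqxx.
      move=> h2; split => //; apply/eqP; apply: contrapT => /negP h3; apply: h2.
      by split => //; exact: AI.
  by move=> h z; rewrite -{1}h => -[].
have nb L : exists2 z, A z & L < cabs z.
  apply: contrapT => h; apply: ni; split => //.
  exists L%:C; split; first by apply/complex_realP; exists L.
  move=> M LM z Az; rewrite /= -cabsE (le_trans _ (ltW LM))// lecR leNgt.
  by apply/negP => zL; apply: h; exists z.
apply/eqP; rewrite -cabs_eq0 eq_le cabs_ge0 andbT; apply/ler_addgt0Pr => e e0.
have [L hL] := cauchy_decay cbm_dgamma e0.
have [z Az zL] := nb L.
rewrite add0r -(Aci z Az) (_ : winding_integral z = CI mu D (fun t => dgamma t / (gamma t - z))).
  by rewrite ltW// hL// ltW.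
by apply: CI_eq => t _; rewrite mulrC.
Qed.

End Contour.

(** * Cauchy's integral formula *)

Section Cauchy.
Context {R : realType}.
Local Notation C := R[i].
Local Notation mu := (@lebesgue_measure R).
Local Notation D := (`[0 : R, 1]%classic).
Variable gamma : R -> C.
Hypothesis cg : contour gamma.
Local Notation image := (contour_image gamma).
Local Notation dgamma := (path_derive gamma).
Local Notation mD := measurable_unit.
Local Notation muD := mu_unit_lty.
Implicit Types (F A : C -> C).

(** The expansion of the difference quotients is uniform along the contour,
    so it can be integrated term by term. The parameters where gamma passes
    through w0 or w, at which the quotient is 0 / 0, form null sets. *)
Lemma holo_cauchy_quotient F A w0 r :
  holo A w0 -> 0 < r -> cbm D (fun t => F (gamma t)) ->
  (forall t, D t -> cabs (gamma t - w0) < r -> F (gamma t) = A (gamma t)) ->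
  holo (fun w => CI mu D (fun t => (F (gamma t) - A w) / (gamma t - w) * dgamma t)) w0.
Proof.
move=> [a [B [q T]]] r0 hF FA.
have [mF [S hS]] := hF; have [_ [B2 hB2]] := cbm_dgamma cg.
have D0 : D 0 by rewrite /= in_itv /= lexx ler01.
have S0 : 0 <= S by apply: le_trans (hS 0 D0); exact: cabs_ge0.
have B20 : 0 <= B2 by apply: le_trans (hB2 0 D0); exact: cabs_ge0.
have [rho rho0 [B' B'0 hdq]] := quotient_taylor T r0 S0.
pose b m t := quotient_coef a (gamma t - w0) (F (gamma t)) m.
have FAy t : D t -> cabs (gamma t - w0) < r -> F (gamma t) = A (w0 + (gamma t - w0)).
  by move=> Dt h; rewrite FA// (addrC w0) subrK.
have cgw w : cbm D (fun t => gamma t - w).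
  by apply: cbmB; [exact: cbm_gamma|exact: cbm_cst].
have cb m : cbm D (b m).
  split.
    rewrite /b /quotient_coef; apply: cmeasM.
      apply: cmeasB => //; apply: cmeas_sum => i; apply: cmeasM; first exact: cmeas_cst.
      by apply: cmeasX; exact: (cgw w0).1.
    by apply: cmeasV; apply: cmeasX; exact: (cgw w0).1.
  (* b m t * u ^+ m is the difference of two consecutive partial sums at a
     point u of modulus rho / 2; u is chosen different from gamma t - w0 *)
  exists (2 * B' / (rho / 2) ^+ m) => t Dt.
  have rho2 : 0 < rho / 2 by rewrite divr_gt0.
  have [yt0|y0] := eqVneq (gamma t - w0) 0.
    rewrite /b /quotient_coef yt0 exprS mul0r invr0 mulr0 cabs0.
    by rewrite divr_ge0 ?mulr_ge0 ?exprn_ge0// ltW.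
  have [u [uy cu]] : exists u : C, gamma t - w0 != u /\ cabs u = rho / 2.
    have [yu|yu] := eqVneq (gamma t - w0) (rho / 2)%:C.
      exists (- (rho / 2)%:C); split; last by rewrite cabsN cabs_real ger0_norm// ltW.
      rewrite yu -addr_eq0 -mulr2n mulrn_eq0 /= -cabs_eq0 cabs_real.
      by rewrite gt_eqF// gtr0_norm.
    by exists (rho / 2)%:C; split => //; rewrite cabs_real ger0_norm// ltW.
  have ru : rho^-1 * cabs u = 2^-1 by rewrite cu; field; rewrite gt_eqF.
  have ru' : rho^-1 * cabs u <= 2^-1 by rewrite ru.
  have h1 := hdq _ _ u m ru' y0 uy (hS t Dt) (FAy t Dt).
  have h2 := hdq _ _ u m.+1 ru' y0 uy (hS t Dt) (FAy t Dt).
  rewrite ler_pdivlMr ?exprn_gt0// -cu -cabsX -cabsM.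
  have -> : b m t * u ^+ m =
    ((F (gamma t) - A (w0 + u)) / (gamma t - w0 - u) -
       \sum_(i < m) quotient_coef a (gamma t - w0) (F (gamma t)) i * u ^+ i) -
    ((F (gamma t) - A (w0 + u)) / (gamma t - w0 - u) -
       \sum_(i < m.+1) quotient_coef a (gamma t - w0) (F (gamma t)) i * u ^+ i).
    by rewrite big_ord_recr /= /b; ring.
  rewrite (le_trans (cabsB _ _))// (le_trans (lerD h1 h2))// ru mulr_natl mulr2n.
  have pw k : 2^-1 ^+ k <= 1 :> R by rewrite exprn_ile1//; lra.
  by apply: lerD; rewrite -[leRHS]mulr1 ler_wpM2l.
pose c m := CI mu D (fun t => b m t * dgamma t).
have cbd m : cbm D (fun t => b m t * dgamma t).
  by apply: cbmM => //; exact: cbm_dgamma.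
exists c, (2 * (B' * B2)), rho^-1; split; [by rewrite !mulr_ge0|by rewrite invr_gt0|].
move=> u M hu; pose w := w0 + u.
have [S1 [mS1 S10 hS1]] := null_fiber cg w0.
have [S2 [mS2 S20 hS2]] := null_fiber cg w.
have gE t : gamma t - w = gamma t - w0 - u by rewrite /w opprD addrA.
have cgq : cbm D (fun t => (F (gamma t) - A w) / (gamma t - w)).
  split.
    apply: cmeasM; first by apply: cmeasB => //; exact: cmeas_cst.
    by apply: cmeasV; exact: (cgw w).1.
  exists (Num.max B' (cabs ((A w0 - A w) / (w0 - w)))) => t Dt; rewrite le_max.
  have [yu|yu] := eqVneq (gamma t - w0) u.
    by rewrite gE yu subrr invr0 mulr0 cabs0 B'0.
  have [y0|y0] := eqVneq (gamma t - w0) 0.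
    rewrite FA//; last by rewrite y0 cabs0.
    by move/eqP: y0; rewrite subr_eq0 => /eqP ->; rewrite lexx orbT.
  have := hdq _ _ u 0%N hu y0 yu (hS t Dt) (FAy t Dt).
  by rewrite big_ord0 subr0 expr0 mulr1 gE => ->.
have cgqd : cbm D (fun t => (F (gamma t) - A w) / (gamma t - w) * dgamma t).
  by apply: cbmM => //; exact: cbm_dgamma.
have csum : cbm D (fun t => \sum_(m < M) u ^+ m * (b m t * dgamma t)).
  by apply: cbm_sum => i; apply: cbmM; [exact: cbm_cst|exact: cbd].
have -> : \sum_(n < M) c n * u ^+ n =
    CI mu D (fun t => \sum_(m < M) u ^+ m * (b m t * dgamma t)).
  rewrite (CI_sum (mu := mu) mD muD); last first.
    by move=> i; apply: cbmM; [exact: cbm_cst|exact: cbd].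
  apply: eq_bigr => i _; rewrite (CIZ (mu := mu) mD muD); last exact: cbd.
  by rewrite mulrC.
rewrite -(CIB (mu := mu) mD muD cgqd csum).
apply: (@le_trans _ _ (2 * (B' * (rho^-1 * cabs u) ^+ M * B2) * fine (mu D))); last first.
  by rewrite mu_unit /= mulr1 le_eqVlt; apply/orP; left; apply/eqP; ring.
apply: (@CI_le _ _ _ mu _ mD muD _ (S1 `|` S2)).
- exact: measurableU.
- exact: (etrans (@measureU0 _ _ _ mu S1 S2 mS1 mS2 S20) S10).
- exact: (cbmB cgqd csum).1.
- by rewrite !mulr_ge0// exprn_ge0// mulr_ge0 ?cabs_ge0// invr_ge0 ltW.
move=> t Dt /not_orP[nS1 nS2].
have y0 : gamma t - w0 != 0.
  by rewrite subr_eq0; apply/eqP => /(hS1 t Dt).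
have yu : gamma t - w0 != u.
  by rewrite -subr_eq0 -gE subr_eq0; apply/eqP => /(hS2 t Dt).
have -> : \sum_(m < M) u ^+ m * (b m t * dgamma t) =
    (\sum_(m < M) b m t * u ^+ m) * dgamma t.
  by rewrite mulr_suml; apply: eq_bigr => i _; ring.
rewrite -mulrBl cabsM ler_pM ?cabs_ge0 ?hB2// gE.
exact: (hdq _ _ u M hu y0 yu (hS t Dt) (FAy t Dt)).
Qed.

Variable F : C -> C.
Hypothesis po : positively_oriented gamma.
Hypothesis hF : forall z, image z \/ contour_interior gamma z -> holo F z.

Lemma two_pi_i_neq0 : 2 * 'i%C * pi%:C != 0 :> C.
Proof.
rewrite -cabs_eq0 !cabsM cabs_real gtr0_norm ?pi_gt0//.
rewrite [cabs 'i%C]cabsC /= expr0n /= add0r expr1n sqrtr1 mulr1.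
by rewrite mulf_neq0 ?gt_eqF ?pi_gt0// cabs_gt0 pnatr_eq0.
Qed.

Lemma winding_integral_interior w : contour_interior gamma w -> winding_integral gamma w = 2 * 'i%C * pi%:C.
Proof.
move=> /po; rewrite /winding_number -/(winding_integral gamma w) => h.
by rewrite -[LHS](mulVKf two_pi_i_neq0) h mulr1.
Qed.

Let K w := image w \/ contour_interior gamma w.

Let cF : cbm D (fun t => F (gamma t)).
Proof. by apply: cbm_comp => // z zI; apply: hF; left. Qed.

(** Dixon's function. Off the closed interior F is replaced by 0; there the
    winding integral vanishes, so the value chosen does not affect the
    analyticity of h. *)
Let h w := CI mu D (fun t =>
  (F (gamma t) - (if pselect (K w) then F w else 0)) / (gamma t - w) * dgamma t).

Let nKI w : ~ K w -> ~ image w.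
Proof. by move=> nK wI; apply: nK; left. Qed.

Let winding_integral_nK w : ~ K w -> winding_integral gamma w = 0.
Proof. by move=> nK; apply: winding_integral_outside => //; [exact: nKI|move=> wi; apply: nK; right]. Qed.

Let split_quotient w (c : C) : ~ image w ->
  CI mu D (fun t => (F (gamma t) - c) / (gamma t - w) * dgamma t) =
  CI mu D (fun t => F (gamma t) / (gamma t - w) * dgamma t) - c * winding_integral gamma w.
Proof.
move=> nw.
have c1 : cbm D (fun t => F (gamma t) / (gamma t - w) * dgamma t).
  by apply: cbmM; [apply: cbmM => //; exact: cbm_inv|exact: cbm_dgamma].
have c2 : cbm D (fun t => (gamma t - w)^-1 * dgamma t).
  by apply: cbmM; [exact: cbm_inv|exact: cbm_dgamma].
rewrite /winding_integral contour_integralE -(CIZ (mu := mu) mD muD)// -(CIB (mu := mu) mD muD)//.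
  by apply: CI_eq => t _; ring.
by apply: cbmM => //; exact: cbm_cst.
Qed.

(** Near a point of the closed interior, replacing 0 by F w changes h by F w
    times a vanishing winding integral. Near any other point the winding
    integral vanishes identically, by local constancy, and h is the Cauchy
    integral of F. *)
Let h_holo w0 : holo h w0.
Proof.
have [K0|nK0] := pselect (K w0).
  have := @holo_cauchy_quotient F F w0 1 (hF K0) ltr01 cF (fun _ _ _ => erefl).
  move=> [a [B [q T]]]; have [a1 [B1 [q1 [_ q10 _]]]] := hF K0.
  apply: (taylor_ext T); exists 1 => // u _.
  rewrite /h; case: pselect => //= nK.
  by rewrite !split_quotient ?winding_integral_nK ?mulr0//; exact: nKI.
have nw0 := nKI nK0.
have [b b0 hb] := contour_far cg nw0.
have := @holo_cauchy_quotient F (fun=> 0) w0 b (holo_cst _ _) b0 cF.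
case; first by move=> t Dt; rewrite ltNge hb.
move=> a [B [q T]]; apply: (taylor_ext T).
have [r r0 hr] := winding_integral_locally_constant cg nw0.
exists r => // u ur; rewrite /h; case: pselect => //= K1.
have [|ni hci] := hr (w0 + u); first by rewrite addrAC subrr add0r.
by rewrite !split_quotient// hci (winding_integral_nK nK0) !mulr0.
Qed.

(** Far from the contour the winding number is small, so it is not 1 and the
    point is not interior: h is then the Cauchy integral of F, which tends to
    0. *)
Let h_zero w : h w = 0.
Proof.
apply: (entire_vanishing h_holo) => e e0.
have c1 : cbm D (fun t => F (gamma t) * dgamma t).
  by apply: cbmM => //; exact: cbm_dgamma.
have [L1 h1] := cauchy_decay cg c1 e0.
have p0 : 0 < cabs (2 * 'i%C * pi%:C : C) by rewrite cabs_gt0 two_pi_i_neq0.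
have [L2 h2] := cauchy_decay cg (cbm_dgamma cg) p0.
have [L3 _ h3] := contour_bounded cg.
exists (Num.max L1 (Num.max L2 (L3 + 1))) => u; rewrite !ge_max => /and3P[u1 u2 u3].
have nI : ~ image u.
  by move=> [t Dt tu]; have := h3 t Dt; rewrite tu; lra.
have nK : ~ K u.
  move=> [//|/winding_integral_interior cu]; have := h2 u u2; rewrite ltNge => /negP; apply.
  rewrite -cu /winding_integral contour_integralE le_eqVlt; apply/orP; left; apply/eqP.
  by congr cabs; apply: CI_eq => t _; rewrite mulrC.
rewrite /h; case: pselect => //= _; apply: le_lt_trans (h1 u u1).
rewrite le_eqVlt; apply/orP; left; apply/eqP.
by congr cabs; apply: CI_eq => t _; rewrite subr0; ring.
Qed.

Lemma cauchy_outside w : ~ image w -> ~ contour_interior gamma w ->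
  contour_integral gamma (fun z => F z / (z - w)) = 0.
Proof.
move=> nI ni; have := h_zero w; rewrite /h; case: pselect; first by case.
by move=> nK /=; rewrite split_quotient// winding_integral_nK// mulr0 subr0.
Qed.

Lemma contour_interior_off x : contour_interior gamma x -> ~ image x.
Proof. by case. Qed.

Lemma cauchy_formula x : contour_interior gamma x ->
  contour_integral gamma (fun z => F z / (z - x)) = 2 * 'i%C * pi%:C * F x.
Proof.
move=> xi; have nI := contour_interior_off xi.
have := h_zero x; rewrite /h; case: pselect; last by case; right.
move=> Kx /=; rewrite split_quotient// winding_integral_interior// => /eqP.
by rewrite subr_eq0 => /eqP h1; rewrite contour_integralE h1 mulrC.
Qed.

(** F z = F z * z / (z - w) - w * F z / (z - w). For w outside the contour
    the second term integrates to zero; the first one tends to 0 as w goes to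
    infinity. *)
Lemma cauchy_theorem : contour_integral gamma F = 0.
Proof.
rewrite contour_integralE.
have c1 : cbm D (fun t => F (gamma t) * dgamma t).
  by apply: cbmM => //; exact: cbm_dgamma.
have c2 : cbm D (fun t => F (gamma t) * gamma t * dgamma t).
  by apply: cbmM; [apply: cbmM => //; exact: cbm_gamma|exact: cbm_dgamma].
have p0 : 0 < cabs (2 * 'i%C * pi%:C : C) by rewrite cabs_gt0 two_pi_i_neq0.
have [L2 h2] := cauchy_decay cg (cbm_dgamma cg) p0.
have [L3 L30 h3] := contour_bounded cg.
apply/eqP; rewrite -cabs_eq0 eq_le cabs_ge0 andbT; apply/ler_addgt0Pr => e e0.
have [L1 h1] := cauchy_decay cg c2 e0.
pose r := Num.max L1 (Num.max L2 (L3 + 1)); pose w : C := r%:C.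
have r0 : 0 <= r by rewrite /r !le_max (addr_ge0 L30)// !orbT.
have wr : cabs w = r by rewrite cabs_real ger0_norm.
have [u1 u2 u3] : [/\ L1 <= cabs w, L2 <= cabs w & L3 + 1 <= cabs w].
  by rewrite wr /r !le_max !lexx !orbT.
have nI : ~ image w.
  by move=> [t Dt tu]; have := h3 t Dt; rewrite tu; lra.
have ni : ~ contour_interior gamma w.
  move=> /winding_integral_interior cu; have := h2 w u2; rewrite ltNge => /negP; apply.
  rewrite -cu /winding_integral contour_integralE le_eqVlt; apply/orP; left; apply/eqP.
  by congr cabs; apply: CI_eq => t _; rewrite mulrC.
have := cauchy_outside nI ni; rewrite contour_integralE => z0.
have cz : cbm D (fun t => F (gamma t) / (gamma t - w) * dgamma t).
  by apply: cbmM; [apply: cbmM => //; exact: cbm_inv|exact: cbm_dgamma].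
have -> : CI mu D (fun t => F (gamma t) * dgamma t) =
    CI mu D (fun t => F (gamma t) * gamma t * dgamma t / (gamma t - w)).
  have c3 : cbm D (fun t => F (gamma t) * gamma t * dgamma t / (gamma t - w)).
    by apply: cbmM => //; exact: cbm_inv.
  have -> : CI mu D (fun t => F (gamma t) * dgamma t) =
    CI mu D (fun t => F (gamma t) * gamma t * dgamma t / (gamma t - w) -
      w * (F (gamma t) / (gamma t - w) * dgamma t)).
    apply: CI_eq => t Dt.
    have n0 : gamma t - w != 0.
      by rewrite subr_eq0; apply/eqP => tw; apply: nI; exists t.
    by field.
  rewrite (CIB (mu := mu) mD muD)//; last by apply: cbmM => //; exact: cbm_cst.
  by rewrite (CIZ (mu := mu) mD muD)// z0 mulr0 subr0.
by rewrite add0r ltW// h1.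
Qed.

End Cauchy.

(** * Measures with densities *)

Section Density.
Local Open Scope ereal_scope.
Context d (T : measurableType d) (R : realType).

(** The density g is almost everywhere equal to the Radon-Nikodym derivative
    of nu. *)
Lemma integral_density (m : {sigma_finite_measure set T -> \bar R})
    (nu : {finite_measure set T -> \bar R}) (g : T -> R) (G : T -> \bar R) :
  measurable_fun setT g -> (forall x, (0 <= g x)%R) ->
  (forall A, measurable A -> nu A = \int[m]_(x in A) (g x)%:E) ->
  measurable_fun setT G -> (forall x, 0 <= G x) ->
  \int[nu]_x G x = \int[m]_x (G x * (g x)%:E).
Proof.
move=> mg g0 nuE mG G0.
have meg : measurable_fun setT (EFin \o g) by exact/measurable_EFinP.
have dom : nu `<< m.
  apply/null_content_dominatesP => A mA mA0; rewrite nuE//.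
  apply: null_set_integral => //; exact: measurable_funTS.
rewrite -(Radon_Nikodym_SigmaFinite.change_of_variables dom G0 measurableT mG).
have mf := measurable_int _ (Radon_Nikodym_SigmaFinite.f_integrable dom).
apply: ae_eq_integral => //; try exact: emeasurable_funM.
have h : ae_eq m setT (Radon_Nikodym_SigmaFinite.f nu m) (EFin \o g).
  apply: integral_ae_eq => //; first exact: Radon_Nikodym_SigmaFinite.f_integrable.
  by move=> A _ mA; rewrite -Radon_Nikodym_SigmaFinite.f_integral// nuE.
by apply: filterS h => x /= h _; rewrite h.
Qed.

Lemma integral_pushforward_eq d' (T' : measurableType d') (phi : T -> T')
    (m : {measure set T -> \bar R}) (m' : {measure set T' -> \bar R}) (G : T' -> \bar R) :
  measurable_fun setT phi ->
  (forall A, measurable A -> m (phi @^-1` A) = m' A) ->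
  measurable_fun setT G -> (forall x, 0 <= G x) ->
  \int[m']_x G x = \int[m]_x G (phi x).
Proof.
move=> mphi mm' mG G0.
pose m1 : {measure set T' -> \bar R} :=
  measure_function_pushforward__canonical__measure_function_Measure m mphi.
transitivity (\int[m1]_x G x); last by rewrite ge0_integral_pushforward.
by apply: eq_measure_integral => A mA _; rewrite -mm'.
Qed.

Lemma pushforward_unique d' (T' : measurableType d') (phi : T -> T')
    (m : {measure set T -> \bar R}) (m' : {measure set T' -> \bar R})
    (S : set (set T')) (g : (set T')^nat) :
  measurable_fun setT phi -> m setT < +oo ->
  S `<=` measurable -> (forall i, S (g i)) -> \bigcup_k (g k) = setT -> setI_closed S ->
  (forall A, S A -> m (phi @^-1` A) = m' A) ->
  forall A, <<s S >> A -> m (phi @^-1` A) = m' A.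
Proof.
move=> mphi moo Sm Sg gT SI mm' A SA.
pose m1 : {measure set T' -> \bar R} :=
  measure_function_pushforward__canonical__measure_function_Measure m mphi.
apply: (@g_sigma_algebra_measure_unique _ _ _ S Sm g Sg gT m1 m' SI mm') => // k.
apply: le_lt_trans moo; change (m (phi @^-1` g k) <= m setT).
apply: le_measure; rewrite ?inE//.
by rewrite -[X in measurable X]setTI; exact: (mphi measurableT _ (Sm _ (Sg k))).
Qed.

End Density.

Section DensityMeasure.
Local Open Scope ereal_scope.
Context d (T : measurableType d) (R : realType).
Variables (m : {measure set T -> \bar R}) (g : T -> R).

(** The hypotheses are arguments of the definition, so that the measure
    structure can be attached to it. *)
Definition density_measure of (forall x, (0 <= g x)%R) & measurable_fun setT g &
    \int[m]_x (g x)%:E < +oo := fun A : set T => \int[m]_(x in A) (g x)%:E.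

Variables (g0 : forall x, (0 <= g x)%R) (mg : measurable_fun setT g)
  (gi : \int[m]_x (g x)%:E < +oo).

Let dm0 : density_measure g0 mg gi set0 = 0.
Proof. exact: integral_set0. Qed.

Let dm_ge0 A : 0 <= density_measure g0 mg gi A.
Proof. by apply: integral_ge0 => x _; rewrite lee_fin. Qed.

Let dm_sigma_additive : semi_sigma_additive (density_measure g0 mg gi).
Proof.
move=> F mF tF mUF; rewrite /density_measure ge0_integral_bigcup//.
- apply: is_cvg_nneseries => n _ _; exact: dm_ge0.
- by apply/measurable_EFinP; exact: measurable_funTS.
- by move=> x _; rewrite lee_fin.
Qed.

HB.instance Definition _ := isMeasure.Build _ _ _ (density_measure g0 mg gi)
  dm0 dm_ge0 dm_sigma_additive.

Let dm_finite : fin_num_fun (density_measure g0 mg gi).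
Proof.
move=> A mA; rewrite ge0_fin_numE ?dm_ge0// (le_lt_trans _ gi)//.
apply: ge0_subset_integral => //; first exact/measurable_EFinP.
by move=> x _; rewrite lee_fin.
Qed.

HB.instance Definition _ := Measure_isFinite.Build _ _ _ (density_measure g0 mg gi)
  dm_finite.

End DensityMeasure.

(** * Change of variables on an interval *)

Section Substitution.
Context {R : realType}.
Local Notation mu := (@lebesgue_measure R).
Variables (a b : R) (phi w : R -> R).
Hypothesis ab : a < b.
Hypothesis mphi : measurable_fun setT phi.
Hypothesis phia : phi a = a.
Hypothesis phib : phi b = b.
Hypothesis phi_incr : {in `[a, b] &, {mono phi : x y / x < y}}.
Hypothesis dphi : forall t, t \in `[a, b] -> is_derive t 1 phi (w t).
Hypothesis cw : forall t, t \in `[a, b] -> {for t, continuous w}.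
Hypothesis w0 : forall t, t \in `[a, b] -> 0 <= w t.

(** Densities are cut off to [a, b], so that all integrals run over the whole
    line and can be iterated. *)
Definition box_ind (x : R) : R := \1_(`[a, b]%classic) x.
Definition box_w (x : R) : R := w x * box_ind x.

Lemma box_ind_ge0 x : 0 <= box_ind x. Proof. by rewrite /box_ind indicE. Qed.

Lemma measurable_box_ind : measurable_fun setT box_ind.
Proof. exact: measurable_indic. Qed.

Lemma box_w_ge0 x : 0 <= box_w x.
Proof.
rewrite /box_w /box_ind indicE; case: (boolP (x \in _)) => [|_]; last by rewrite mulr0.
by rewrite inE mulr1 => /w0.
Qed.

Lemma box_wE : box_w = w \_ `[a, b]%classic.
Proof.
apply/funext => x; rewrite /box_w /box_ind patchE indicE.
by case: ifP => _; rewrite ?mulr1 ?mulr0.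
Qed.

Lemma measurable_box_w : measurable_fun setT box_w.
Proof.
rewrite box_wE; apply/(measurable_restrictT _ _).1; first exact: measurable_itv.
apply: subspace_continuous_measurable_fun; first exact: measurable_itv.
by apply: continuous_in_subspaceT => t /set_mem /=; exact: cw.
Qed.

Lemma integral_w_itv (c : R) : c \in `[a, b] ->
  (\int[mu]_(x in `[c, b]) (w x)%:E = (phi b - phi c)%:E)%E.
Proof.
rewrite in_itv /= => /andP[ac]; rewrite le_eqVlt => /predU1P[<-|cb].
  by rewrite set_itv1 integral_set1 subrr.
have sub t : t \in `[c, b] -> t \in `[a, b].
  by rewrite !in_itv /= => /andP[ct ->]; rewrite (le_trans ac).
have <- := @real_FTC _ phi w c b cb (fun t tcb => dphi (sub t tcb)) (fun t tcb => cw (sub t tcb)).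
rewrite /Rintegral fineK//; apply: integrable_fin_num; first exact: measurable_itv.
apply: continuous_compact_integrable; first exact: segment_compact.
by apply: continuous_in_subspaceT => t /set_mem /= /sub/cw.
Qed.

Lemma integral_box_w : (\int[mu]_x (box_w x)%:E = (b - a)%:E)%E.
Proof.
have := @integral_w_itv a; rewrite bound_itvE (ltW ab) phib phia => /(_ isT) <-.
rewrite [RHS]integral_mkcond; apply: eq_integral => x _.
by rewrite box_wE restrict_EFin.
Qed.

Lemma integral_box_w_lty : (\int[mu]_x (box_w x)%:E < +oo)%E.
Proof. by rewrite integral_box_w ltry. Qed.

(** Two finite measures that agree on the rays ]c, +oo[ are equal; the
    preimage of a ray under the increasing map phi meets [a, b] in an
    interval, whose mass is given by the fundamental theorem of calculus. *)
Lemma substitution_measure (A : set R) : measurable A ->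
  (\int[mu]_(x in phi @^-1` A) (box_w x)%:E = \int[mu]_(x in A) (box_ind x)%:E)%E.
Proof.
have indi : (\int[mu]_x (box_ind x)%:E < +oo)%E.
  by rewrite integral_indic ?setIT//; exact: lebesgue_itv_lty.
pose m0 := @density_measure _ _ _ mu box_w box_w_ge0 measurable_box_w integral_box_w_lty.
pose m2 := @density_measure _ _ _ mu box_ind box_ind_ge0 measurable_box_ind indi.
suff h : forall E, <<s (@RGenOInfty.G R) >> E -> m0 (phi @^-1` E) = m2 E.
  move=> mA; apply: h.
  have := RGenOInfty.measurableE R; rewrite /measurable /= => <-.
  exact: mA.
have indE (B : set R) : measurable B -> m2 B = mu (`[a, b]%classic `&` B).
  by move=> mB; rewrite /m2 /density_measure integral_indic.
have wE (B : set R) : measurable B ->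
    m0 (phi @^-1` B) = (\int[mu]_(x in (phi @^-1` B) `&` `[a, b]) (w x)%:E)%E.
  move=> mB; rewrite /m0 /density_measure /= integral_mkcondr.
  by apply: eq_integral => x _; rewrite box_wE restrict_EFin.
have ray x : @RGenOInfty.G R `]x, +oo[%classic by exists x.
apply: (@pushforward_unique _ (measurableTypeR R) R _ (measurableTypeR R) phi m0 m2 _
  (fun k : nat => `](- k%:R)%R, +oo[%classic)).
- exact: mphi.
- exact: integral_box_w_lty.
- by move=> B [x ->]; exact: measurable_itv.
- by move=> k; exact: ray.
- apply/seteqP; split => // x _; exists (Num.bound `|x|) => //=.
  rewrite in_itv /= andbT ltrNl (le_lt_trans (ler_norm _))// normrN.
  exact: archi_boundP.
- move=> B B' [x ->] [y ->]; exists (Num.max x y).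
  apply/seteqP; split => t /=; rewrite !in_itv /= !andbT gt_max.
    by move=> [-> ->].
  by move=> /andP[].
- move=> B [c ->]; apply: (etrans (wE _ (measurable_itv _))).
  apply: etrans (esym (indE _ (measurable_itv _))).
  have [ca|ac] := ltP c a.
    have -> : (phi @^-1` `]c, +oo[) `&` `[a, b] = `[a, b]%classic.
      apply/seteqP; split => [x []//|x xab]; split => //=.
      rewrite in_itv /= andbT (lt_le_trans ca)// -phia leNgt phi_incr//.
        by rewrite -leNgt; move: xab; rewrite /= in_itv /= => /andP[].
      by rewrite bound_itvE ltW.
    have -> : `[a, b]%classic `&` `]c, +oo[ = `[a, b]%classic :> set R.
      apply/seteqP; split => [x []//|x xab]; split => //=; move: xab.
      by rewrite /= !in_itv /= andbT => /andP[ax _]; exact: lt_le_trans ax.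
    rewrite integral_w_itv ?bound_itvE ?ltW// phia phib.
    by rewrite lebesgue_measure_itv /= lte_fin ab.
  have [cb|bc] := leP c b; last first.
    have -> : (phi @^-1` `]c, +oo[) `&` `[a, b] = set0.
      apply/seteqP; split => x //= [].
      rewrite in_itv /= andbT => cx xab; move: (xab); rewrite in_itv /= => /andP[_ xb].
      have : phi x <= phi b by rewrite leNgt phi_incr ?bound_itvE ?ltW// -leNgt.
      by rewrite phib => h; move: (lt_le_trans (lt_trans bc cx) h); rewrite ltxx.
    have -> : `[a, b]%classic `&` `]c, +oo[ = set0 :> set R.
      apply/seteqP; split => x //= []; rewrite !in_itv /= andbT => /andP[_ xb] cx.
      by move: (lt_le_trans (lt_trans bc cx) xb); rewrite ltxx.
    by rewrite integral_set0 measure0.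
  have [e eab phie] : exists2 e, e \in `[a, b] & phi e = c.
    apply: IVT; first exact: ltW.
      apply: continuous_in_subspaceT => t /set_mem /= /dphi[? _].
      exact/differentiable_continuous/derivable1_diffP.
    by rewrite phia phib minEle maxEle (ltW ab) ac cb.
  have -> : (phi @^-1` `]c, +oo[) `&` `[a, b] = `]e, b]%classic.
    apply/seteqP; split => x /=.
      move=> [+ xab]; rewrite !in_itv /= andbT -phie phi_incr// => ->.
      by move: xab; rewrite in_itv /= => /andP[].
    rewrite in_itv /= => /andP[ex xb].
    have xab : x \in `[a, b].
      by move: eab; rewrite !in_itv /= xb => /andP[ae _]; rewrite (le_trans ae)// ltW.
    by split => //; rewrite in_itv /= andbT -phie phi_incr.
  have -> : `[a, b]%classic `&` `]c, +oo[ = `]c, b]%classic :> set R.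
    apply/seteqP; split => x /=; rewrite !in_itv /= andbT.
      by move=> [/andP[_ ->] ->].
    by move=> /andP[cx ->]; rewrite cx (ltW (le_lt_trans ac cx)).
  rewrite integral_itv_obnd_cbnd; last first.
    apply/measurable_EFinP; apply: (@measurable_funS _ _ _ _ `[a, b]%classic); first exact: measurable_itv.
      move=> x /=; move: eab; rewrite !in_itv /= => /andP[ae _] /andP[ex ->].
      by rewrite (le_trans ae)// ltW.
    apply: subspace_continuous_measurable_fun; first exact: measurable_itv.
    by apply: continuous_in_subspaceT => t /set_mem /=; exact: cw.
  rewrite integral_w_itv// phie phib lebesgue_measure_itv /= lte_fin.
  by move: cb; rewrite le_eqVlt => /predU1P[->|->]; rewrite ?ltxx ?subrr// EFinB.
Qed.

Lemma substitution1 (G : R -> \bar R) : measurable_fun setT G -> (forall x, 0 <= G x)%E ->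
  (\int[mu]_x (G x * (box_ind x)%:E) = \int[mu]_x (G (phi x) * (box_w x)%:E))%E.
Proof.
move=> mG G0.
pose m0 := @density_measure _ _ _ mu box_w box_w_ge0 measurable_box_w integral_box_w_lty.
have indi : (\int[mu]_x (box_ind x)%:E < +oo)%E.
  by rewrite integral_indic ?setIT//; exact: lebesgue_itv_lty.
pose m2 := @density_measure _ _ _ mu box_ind box_ind_ge0 measurable_box_ind indi.
rewrite -(@integral_density _ _ _ mu m2 box_ind G measurable_box_ind box_ind_ge0)//.
have mGp : measurable_fun setT (G \o phi) by exact: measurableT_comp.
rewrite -(@integral_density _ _ _ mu m0 box_w (G \o phi) measurable_box_w box_w_ge0)//; last first.
  by move=> x; exact: G0.
apply: (@integral_pushforward_eq _ (measurableTypeR R) R _ (measurableTypeR R) phi m0 m2 G) => //.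
by move=> A mA; exact: substitution_measure.
Qed.

End Substitution.

(** * Change of variables in every coordinate *)

Section TupleSubstitution.
Local Open Scope ereal_scope.
Context {R : realType}.
Local Notation mu := (@lebesgue_measure R).
Variables (u W phi : R -> R).
Hypotheses (u0 : forall x, (0 <= u x)%R) (W0 : forall x, (0 <= W x)%R).
Hypotheses (mu_ : measurable_fun setT u) (mW : measurable_fun setT W).
Hypothesis mphi : measurable_fun setT phi.
Hypothesis sub1 : forall G : R -> \bar R, measurable_fun setT G -> (forall x, 0 <= G x) ->
  \int[mu]_x (G x * (u x)%:E) = \int[mu]_x (G (phi x) * (W x)%:E).

Definition tuple_prod (v : R -> R) n (t : n.-tuple R) : R := (\prod_(i < n) v (tnth t i))%R.

Lemma tuple_prod_ge0 v n (t : n.-tuple R) : (forall x, (0 <= v x)%R) -> (0 <= tuple_prod v t)%R.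
Proof. by move=> v0; apply: prodr_ge0. Qed.

Lemma tuple_prod_cons v n x (t : n.-tuple R) :
  tuple_prod v (cons_pair (x, t)) = (v x * tuple_prod v t)%R.
Proof.
rewrite /tuple_prod big_ord_recl; congr (_ * _)%R.
by apply: eq_bigr => i _; rewrite tnthS; congr (v (tnth _ _)); apply: val_inj.
Qed.

Lemma measurable_tuple_prod v n : measurable_fun setT v ->
  measurable_fun setT (@tuple_prod v n).
Proof.
move=> mv; apply: measurable_prod => i _.
by apply: (measurableT_comp mv); exact: measurable_tnth.
Qed.

Lemma measurable_map_tuple n :
  measurable_fun setT (fun t : n.-tuple R => [tuple of map phi t] : n.-tuple R).
Proof.
apply/measurable_fun_tnthP => i.
apply: (eq_measurable_fun (phi \o (fun t : n.-tuple R => tnth t i))).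
  by move=> t _ /=; rewrite tnth_map.
by apply: measurableT_comp => //; exact: measurable_tnth.
Qed.

Lemma map_cons_pair n x (t : n.-tuple R) :
  [tuple of map phi (cons_pair (x, t))] = cons_pair (phi x, [tuple of map phi t]).
Proof. exact: val_inj. Qed.

Lemma integral_tuple_cons n (H : n.+1.-tuple R -> \bar R) :
  measurable_fun setT H -> (forall t, 0 <= H t) ->
  \int[lebesgue_tuple n.+1]_t H t =
  \int[mu]_x \int[lebesgue_tuple n]_t H (cons_pair (x, t)).
Proof.
move=> mH H0.
have mc := @measurable_cons_pair R n.
transitivity (\int[pushforward (mu \x lebesgue_tuple n) (@cons_pair R n)]_t H t); first by [].
rewrite ge0_integral_pushforward// preimage_setT.
rewrite fubini_tonelli1//; first exact: measurableT_comp.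
by move=> x; exact: H0.
Qed.

(** By induction on the number of coordinates: the inner integral runs over
    all coordinates but the first. *)
Lemma substitution_tuple n (g : n.-tuple R -> \bar R) :
  measurable_fun setT g -> (forall t, 0 <= g t) ->
  \int[lebesgue_tuple n]_t (g t * (tuple_prod u t)%:E) =
  \int[lebesgue_tuple n]_t (g [tuple of map phi t] * (tuple_prod W t)%:E).
Proof.
elim: n g => [|n ih] g mg g0.
  apply: eq_integral => t _; rewrite /tuple_prod !big_ord0 !mule1.
  by rewrite (tuple0 t) (tuple0 [tuple of map phi [tuple]]).
have mcx (x : R) : measurable_fun setT (fun t : n.-tuple R => cons_pair (x, t)).
  by apply: (measurableT_comp (@measurable_cons_pair R n)); exact: measurable_pair1.
have mgx (x : R) : measurable_fun setT (fun t : n.-tuple R => g (cons_pair (x, t))).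
  exact: (measurableT_comp mg (mcx x)).
have mu_n := @measurable_tuple_prod u n mu_.
have mW_n := @measurable_tuple_prod W n mW.
have mmap := measurable_map_tuple.
rewrite integral_tuple_cons; last 2 first.
- apply: emeasurable_funM => //; apply/measurable_EFinP; exact: measurable_tuple_prod.
- by move=> t; rewrite mule_ge0// lee_fin tuple_prod_ge0.
rewrite [RHS]integral_tuple_cons; last 2 first.
- apply: emeasurable_funM; first exact: (measurableT_comp mg (mmap n.+1)).
  by apply/measurable_EFinP; exact: measurable_tuple_prod.
- by move=> t; rewrite mule_ge0// lee_fin tuple_prod_ge0.
pose G x := \int[lebesgue_tuple n]_t
  (g (cons_pair (x, [tuple of map phi t])) * (tuple_prod W t)%:E).
have mG : measurable_fun setT G.
  apply: (measurable_fun_fubini_tonelli_F (m2 := @lebesgue_tuple R n)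
    (fun p : R * n.-tuple R => g (cons_pair (p.1, [tuple of map phi p.2])) * (tuple_prod W p.2)%:E)); last first.
    by move=> p; rewrite mule_ge0// lee_fin tuple_prod_ge0.
  apply: emeasurable_funM; last first.
    by apply/measurable_EFinP; apply: (measurableT_comp mW_n); exact: measurable_snd.
  apply: (measurableT_comp mg); apply: (measurableT_comp (@measurable_cons_pair R n)).
  apply/measurable_fun_pair; first exact: measurable_fst.
  by apply: (measurableT_comp (mmap n)); exact: measurable_snd.
have G0 x : 0 <= G x.
  by apply: integral_ge0 => t _; rewrite mule_ge0// lee_fin tuple_prod_ge0.
transitivity (\int[mu]_x (G x * (u x)%:E)).
  apply: eq_integral => x _.
  have := ih _ (mgx x) (fun t => g0 _); rewrite -/(G x) => <-.
  rewrite muleC -ge0_integralZl//; last 3 first.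
  - by apply: emeasurable_funM => //; exact/measurable_EFinP.
  - by move=> t _; rewrite mule_ge0// lee_fin tuple_prod_ge0.
  - by rewrite lee_fin.
  by apply: eq_integral => t _; rewrite tuple_prod_cons EFinM muleCA.
rewrite sub1//; apply: eq_integral => x _.
rewrite muleC -ge0_integralZl//; last 3 first.
- apply: emeasurable_funM; last exact/measurable_EFinP.
  by apply: (measurableT_comp (mgx (phi x))); exact: mmap.
- by move=> t _; rewrite mule_ge0// lee_fin tuple_prod_ge0.
- by rewrite lee_fin.
apply: eq_integral => t _; rewrite map_cons_pair tuple_prod_cons EFinM.
by rewrite muleCA.
Qed.

Lemma substitution_pair n m (F : n.-tuple R * m.-tuple R -> \bar R) :
  measurable_fun setT F -> (forall p, 0 <= F p) ->
  \int[(@lebesgue_tuple R n \x @lebesgue_tuple R m)]_p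
     (F p * (tuple_prod u p.1 * tuple_prod u p.2)%:E) =
  \int[(@lebesgue_tuple R n \x @lebesgue_tuple R m)]_p
     (F ([tuple of map phi p.1], [tuple of map phi p.2]) *
      (tuple_prod W p.1 * tuple_prod W p.2)%:E).
Proof.
move=> mF F0.
have mu_n k := @measurable_tuple_prod u k mu_.
have mW_n k := @measurable_tuple_prod W k mW.
have mmap := measurable_map_tuple.
have pos v k l (s : k.-tuple R) (t : l.-tuple R) : (forall x, (0 <= v x)%R) ->
    0 <= (tuple_prod v s * tuple_prod v t)%:E.
  by move=> v0; rewrite lee_fin mulr_ge0// tuple_prod_ge0.
have mpp v : (forall k, measurable_fun setT (@tuple_prod v k)) ->
    measurable_fun setT (fun p : n.-tuple R * m.-tuple R => (tuple_prod v p.1 * tuple_prod v p.2)%:E).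
  move=> mv; apply/measurable_EFinP; apply: measurable_funM.
    by apply: (measurableT_comp (mv n)); exact: measurable_fst.
  by apply: (measurableT_comp (mv m)); exact: measurable_snd.
have mF2 : measurable_fun setT (fun p : n.-tuple R * m.-tuple R =>
    F ([tuple of map phi p.1], [tuple of map phi p.2])).
  apply: (measurableT_comp mF); apply/measurable_fun_pair.
    by apply: (measurableT_comp (mmap n)); exact: measurable_fst.
  by apply: (measurableT_comp (mmap m)); exact: measurable_snd.
rewrite fubini_tonelli1; last 2 first.
- by apply: emeasurable_funM => //; exact: mpp.
- by move=> p; rewrite mule_ge0// pos.
rewrite [RHS]fubini_tonelli1; last 2 first.
- by apply: emeasurable_funM => //; exact: mpp.
- by move=> p; rewrite mule_ge0// pos.
pose G s := \int[lebesgue_tuple m]_t (F (s, [tuple of map phi t]) * (tuple_prod W t)%:E).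
have mG : measurable_fun setT G.
  apply: (measurable_fun_fubini_tonelli_F (m2 := @lebesgue_tuple R m)
    (fun p : n.-tuple R * m.-tuple R => F (p.1, [tuple of map phi p.2]) * (tuple_prod W p.2)%:E)); last first.
    by move=> p; rewrite mule_ge0// lee_fin tuple_prod_ge0.
  apply: emeasurable_funM; last first.
    by apply/measurable_EFinP; apply: (measurableT_comp (mW_n m)); exact: measurable_snd.
  apply: (measurableT_comp mF); apply/measurable_fun_pair; first exact: measurable_fst.
  by apply: (measurableT_comp (mmap m)); exact: measurable_snd.
have G0 x : 0 <= G x.
  by apply: integral_ge0 => t _; rewrite mule_ge0// lee_fin tuple_prod_ge0.
have mFs s : measurable_fun setT (fun t => F (s, t)).
  by apply: (measurableT_comp mF); exact: measurable_pair1.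
transitivity (\int[lebesgue_tuple n]_s (G s * (tuple_prod u s)%:E)).
  apply: eq_integral => s _; rewrite /fubini_F /=.
  rewrite /G -(substitution_tuple (mFs s) (fun t => F0 _)).
  rewrite muleC -ge0_integralZl//; last 3 first.
  - by apply: emeasurable_funM => //; apply/measurable_EFinP; exact: mu_n.
  - by move=> t _; rewrite mule_ge0// lee_fin tuple_prod_ge0.
  - by rewrite lee_fin tuple_prod_ge0.
  by apply: eq_integral => t _; rewrite EFinM muleCA.
rewrite substitution_tuple//; apply: eq_integral => s _; rewrite /fubini_F /=.
rewrite muleC -ge0_integralZl//; last 3 first.
- apply: emeasurable_funM; last by apply/measurable_EFinP; exact: mW_n.
  by apply: (measurableT_comp (mFs _)); exact: mmap.
- by move=> t _; rewrite mule_ge0// lee_fin tuple_prod_ge0.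
- by rewrite lee_fin tuple_prod_ge0.
by apply: eq_integral => t _; rewrite EFinM muleCA.
Qed.

End TupleSubstitution.

(** * First-order expansions, uniform over configurations *)

Section Expansion.
Context {R : realType} (S : Type) (I : set S).
Implicit Types (c : S -> R) (U : R -> S -> R).

(** Here U eps p = 1 + eps * c p + o(eps) uniformly in p, and c is bounded.
    The class is stable under finite products and under composition with
    differentiable functions, so a product density is expanded factor by
    factor. *)
Definition expands c U :=
  (exists2 B : R, 0 <= B & forall p, I p -> `|c p| <= B) /\
  forall e : R, 0 < e -> exists2 d : R, 0 < d & forall eps : R, `|eps| < d -> forall p, I p ->
    `|U eps p - 1 - eps * c p| <= e * `|eps|.

Lemma expands_ext c c' U U' : (forall p, I p -> c p = c' p) ->
  (forall eps p, I p -> U eps p = U' eps p) -> expands c U -> expands c' U'.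
Proof.
move=> cc UU [[B B0 hB] h]; split; first by exists B => // p Ip; rewrite -cc// hB.
move=> e e0; have [d d0 hd] := h e e0; exists d => // eps ed p Ip.
by rewrite -cc// -UU// hd.
Qed.

Lemma expands1 : expands (fun=> 0) (fun _ _ => 1).
Proof.
split; first by exists 0 => // p _; rewrite normr0.
move=> e e0; exists 1 => // eps _ p _.
by rewrite subrr mulr0 subrr normr0 mulr_ge0// ltW.
Qed.

Lemma expands_lip c U : expands c U -> exists2 B : R, 0 <= B &
  exists2 d : R, 0 < d & forall eps : R, `|eps| < d -> forall p, I p -> `|U eps p - 1| <= B * `|eps|.
Proof.
move=> [[B B0 hB] h]; have [d d0 hd] := h 1 ltr01.
exists (B + 1); first by rewrite addr_ge0.
exists d => // eps ed p Ip.
have -> : U eps p - 1 = (U eps p - 1 - eps * c p) + eps * c p by ring.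
rewrite (le_trans (ler_normD _ _))// addrC mulrDl lerD ?hd//.
by rewrite normrM mulrC ler_wpM2r// hB.
Qed.

Lemma expandsM c c' U U' : expands c U -> expands c' U' ->
  expands (fun p => c p + c' p) (fun eps p => U eps p * U' eps p).
Proof.
move=> eU eU'; have [[B B0 hB] h] := eU; have [[B' B'0 hB'] h'] := eU'.
have [L L0 [d1 d10 hL]] := expands_lip eU'.
split.
  exists (B + B'); first by rewrite addr_ge0.
  by move=> p Ip; rewrite (le_trans (ler_normD _ _))// lerD ?hB ?hB'.
move=> e e0; have e4 : 0 < e / 4 by rewrite divr_gt0.
have [d2 d20 h2] := h _ e4; have [d3 d30 h3] := h' _ e4.
have pL : 0 < L + 1 by rewrite ltr_wpDl.
have pBL : 0 < B * L + 1 by rewrite ltr_wpDl// mulr_ge0.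
pose d := Num.min (Num.min d1 d2) (Num.min d3 (Num.min (L + 1)^-1 (e / 4 / (B * L + 1)))).
exists d; first by rewrite !lt_min d10 d20 d30 invr_gt0 pL divr_gt0.
move=> eps; rewrite !lt_min => /andP[/andP[x1 x2] /and3P[x3 x4 x5]] p Ip.
pose a : R := `|eps|; have a0 : 0 <= a by exact: normr_ge0.
rewrite -/a in x1 x2 x3 x4 x5 *.
have k1 : a * L <= 1.
  have : a * (L + 1) < 1 by rewrite -ltr_pdivlMr// div1r.
  by rewrite mulrDr mulr1; lra.
have k2 : a * (B * L) <= e / 4.
  have : a * (B * L + 1) < e / 4 by rewrite -ltr_pdivlMr.
  by rewrite mulrDr mulr1; lra.
have b1 := h2 _ x2 p Ip; have b2 := h3 _ x3 p Ip; have b3 := hL _ x1 p Ip.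
have b4 := hB p Ip.
have -> : U eps p * U' eps p - 1 - eps * (c p + c' p) =
  (U eps p - 1 - eps * c p) * U' eps p + (U' eps p - 1 - eps * c' p) +
  eps * c p * (U' eps p - 1) by ring.
rewrite -/a in b1 b2 b3.
have b5 : `|U' eps p| <= 2.
  rewrite -[U' eps p](subrK 1) (le_trans (ler_normD _ _))// normr1 -[2]/(1 + 1) lerD2r.
  by rewrite (le_trans b3)// mulrC.
rewrite (le_trans (ler_normD _ _))//.
have t3 : `|eps * c p * (U' eps p - 1)| <= e / 4 * a.
  rewrite !normrM -/a (le_trans (ler_pM _ _ (lexx _) b3))// ?mulr_ge0//.
  rewrite (_ : a * _ * _ = `|c p| * (L * a) * a); last by ring.
  rewrite ler_wpM2r// (le_trans _ k2)// (_ : a * (B * L) = B * (L * a)); last by ring.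
  by rewrite ler_wpM2r// mulr_ge0.
have t1 : `|(U eps p - 1 - eps * c p) * U' eps p| <= e / 4 * a * 2.
  by rewrite normrM ler_pM.
rewrite (@le_trans _ _ (e / 4 * a * 2 + e / 4 * a + e / 4 * a))//; last by lra.
by rewrite lerD// (le_trans (ler_normD _ _))// lerD.
Qed.

Lemma expands_prod (J : Type) (r : seq J) (Q : pred J) (c : J -> S -> R) (U : J -> R -> S -> R) :
  (forall j, Q j -> expands (c j) (U j)) ->
  expands (fun p => \sum_(j <- r | Q j) c j p) (fun eps p => \prod_(j <- r | Q j) U j eps p).
Proof.
move=> h; elim: r => [|j r ih].
  by apply: expands_ext expands1 => [p|eps p] _; rewrite big_nil.
have [Qj|nQj] := boolP (Q j).
  by apply: expands_ext (expandsM (h j Qj) ih) => [p|eps p] _; rewrite big_cons Qj.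
by apply: expands_ext ih => [p|eps p] _; rewrite big_cons (negbTE nQj).
Qed.

Lemma expands_comp (g : R -> R) (g1 : R) c U : g 1 = 1 -> is_derive (1 : R) 1 g g1 ->
  expands c U -> expands (fun p => g1 * c p) (fun eps p => g (U eps p)).
Proof.
move=> g11 dg eU; have [[B B0 hB] h] := eU; have [L L0 [d1 d10 hL]] := expands_lip eU.
split.
  exists (`|g1| * B); first by rewrite mulr_ge0.
  by move=> p Ip; rewrite normrM ler_wpM2l// hB.
move=> e e0.
have pL : 0 < L + 1 by rewrite ltr_wpDl.
have pg : 0 < `|g1| + 1 by rewrite ltr_wpDl.
have e1 : 0 < e / 2 / (L + 1) by rewrite !divr_gt0.
have e2 : 0 < e / 2 / (`|g1| + 1) by rewrite !divr_gt0.
have [d2 d20 h2] := derivable_cabs dg e1.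
have [d3 d30 h3] := h _ e2.
pose d := Num.min d1 (Num.min d3 (d2 / (L + 1))).
exists d; first by rewrite !lt_min d10 d30 divr_gt0.
move=> eps; rewrite !lt_min => /and3P[x1 x3 x2] p Ip.
have b1 := hL _ x1 p Ip; have b3 := h3 _ x3 p Ip.
pose k := U eps p - 1.
have kd2 : `|k| < d2.
  rewrite (le_lt_trans b1)// (@le_lt_trans _ _ (`|eps| * (L + 1)))//; last by rewrite -ltr_pdivlMr.
  by rewrite mulrC ler_wpM2l// lerDl.
have gk : `|g (U eps p) - 1 - g1 * k| <= e / 2 / (L + 1) * `|k|.
  have [k0|k0] := eqVneq k 0.
    have -> : U eps p = 1 by move/eqP : k0; rewrite subr_eq0 => /eqP.
    by rewrite g11 k0 mulr0 subrr subrr normr0 mulr0.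
  have := h2 k k0 kd2; rewrite g11 (_ : k + 1 = U eps p)//.
  by rewrite /k subrK.
have -> : g (U eps p) - 1 - eps * (g1 * c p) =
  (g (U eps p) - 1 - g1 * k) + g1 * (U eps p - 1 - eps * c p) by rewrite /k; ring.
rewrite (le_trans (ler_normD _ _))// (_ : e * _ = e / 2 * `|eps| + e / 2 * `|eps|); last by field.
apply: lerD.
  rewrite (le_trans gk)// (le_trans (ler_wpM2l (ltW e1) b1))// mulrA ler_wpM2r//.
  by rewrite mulrAC ler_pdivrMr// ler_wpM2l ?lerDl// ltW// divr_gt0.
rewrite normrM (le_trans (ler_wpM2l _ b3))// mulrA ler_wpM2r//.
by rewrite mulrC mulrAC ler_pdivrMr// ler_wpM2l ?lerDl// ltW// divr_gt0.
Qed.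

Lemma expands_linear c : (exists2 B : R, 0 <= B & forall p, I p -> `|c p| <= B) ->
  expands c (fun eps p => 1 + eps * c p).
Proof.
move=> hB; split => // e e0; exists 1 => // eps _ p _.
rewrite (_ : 1 + eps * c p - 1 - eps * c p = 0); last by ring.
by rewrite normr0 mulr_ge0// ltW.
Qed.

Lemma expands_powR c U (s : R) : expands c U ->
  expands (fun p => s * c p) (fun eps p => U eps p `^ s).
Proof.
apply: (expands_comp (g := fun x => x `^ s)); first by rewrite powR1.
have dln : is_derive (1 : R) 1 (fun x : R => s * ln x) s.
  apply: is_derive_eq; first exact: (is_deriveZ s (@is_derive1_ln R 1 ltr01)).
  by rewrite /GRing.scale /= invr1 mulr1.
have de : is_derive (1 : R) 1 (fun x : R => expR (s * ln x)) s.
  by have := is_derive1_comp (is_derive_expR _) dln; rewrite ln1 mulr0 expR0 mul1r.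
apply: near_eq_is_derive de.
near=> x; rewrite /= /powR ifF//; apply/negbTE; rewrite gt_eqF//.
near: x; exact: lt_nbhsr.
Unshelve. all: by end_near. Qed.

Lemma expands_expR c (E : R -> S -> R) :
  expands c (fun eps p => 1 + E eps p) -> expands c (fun eps p => expR (E eps p)).
Proof.
move=> h; have d1 : is_derive (1 : R) 1 (fun x : R => expR (x - 1)) 1.
  have dx : is_derive (1 : R) 1 (fun x : R => x - 1) 1.
    have := @is_deriveB _ _ _ _ _ _ _ _ _ (@is_derive_id _ _ (1 : R) 1) (@is_derive_cst _ _ _ (1 : R) (1 : R) (1 : R)).
    by rewrite subr0.
  by have := is_derive1_comp (is_derive_expR _) dx; rewrite subrr expR0 mul1r.
have g1 : expR (1 - 1) = 1 :> R by rewrite subrr expR0.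
apply: expands_ext (expands_comp (g := fun x => expR (x - 1)) g1 d1 h) => [p|eps p] _.
  by rewrite mul1r.
by rewrite addrAC subrr add0r.
Qed.

End Expansion.

(** * Interlacing configurations *)

Section Interlacing.
Context {R : realType} (N : nat) (a b : R).
Local Notation space := (N.-tuple R * N.-1.-tuple R)%type.
Local Notation I := (@interlacing R N a b).
Hypothesis N0 : (0 < N)%N.
Implicit Types p : space.

Lemma chain_lt (s : nat -> R) (m : nat) : (forall i, (i < m)%N -> s i < s i.+1) ->
  forall i j, (i < j)%N -> (j <= m)%N -> s i < s j.
Proof.
move=> h i j; elim: j => // j ih; rewrite ltnS leq_eqVlt => /predU1P[->|ij] jm; first exact: h.
by apply: lt_trans (h j jm); apply: ih => //; exact: ltnW.
Qed.

Lemma interlacing_lt_x p i j : I p -> (i < j < N)%N -> nth 0 p.1 i < nth 0 p.1 j.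
Proof.
move=> [_ _ h] /andP[ij jN]; apply: (@chain_lt (nth 0 p.1) N.-1) => //.
  by move=> k kN; have [h1 h2] := h k kN; exact: lt_trans h2.
by rewrite -ltnS prednK.
Qed.

Lemma interlacing_lt_y p i j : I p -> (i < j < N.-1)%N -> nth 0 p.2 i < nth 0 p.2 j.
Proof.
move=> [_ _ h] /andP[ij jN]; apply: (@chain_lt (nth 0 p.2) N.-2) => //.
  move=> k kN; have k1 : (k.+1 < N.-1)%N by rewrite -ltn_predRL.
  have [_ h2] := h k (ltnW k1); have [h1 _] := h _ k1; exact: lt_trans h1.
by move: jN; case: (N.-1).
Qed.

Lemma interlacing_x p i : I p -> (i < N)%N -> a < nth 0 p.1 i < b.
Proof.
move=> Ip iN; have [h1 h2 _] := Ip.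
have iN1 : (i <= N.-1)%N by rewrite -ltnS prednK.
apply/andP; split.
  case: i iN {iN1} => // i iN; apply: (lt_trans h1).
  exact: interlacing_lt_x.
move: iN1; rewrite leq_eqVlt => /predU1P[->//|iN1]; apply: lt_trans h2.
by apply: interlacing_lt_x => //; rewrite iN1 ltn_predL.
Qed.

Lemma interlacing_y p i : I p -> (i < N.-1)%N -> a < nth 0 p.2 i < b.
Proof.
move=> Ip iN; have [_ _ h] := Ip; have [h1 h2] := h i iN.
have iN' : (i.+1 < N)%N by rewrite -ltn_predRL.
have /andP[x1 _] := interlacing_x Ip (ltnW iN'); have /andP[_ x2] := interlacing_x Ip iN'.
by rewrite (lt_trans x1 h1) (lt_trans h2 x2).
Qed.

Definition in_box n (t : n.-tuple R) := forall i, tnth t i \in `[a, b].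

Lemma interlacing_box p : I p -> in_box p.1 /\ in_box p.2.
Proof.
move=> Ip; split => i; rewrite (tnth_nth 0) in_itv /=.
  by have /andP[x1 x2] := interlacing_x Ip (ltn_ord i); rewrite !ltW.
by have /andP[x1 x2] := interlacing_y Ip (ltn_ord i); rewrite !ltW.
Qed.

Lemma measurable_nth n i : measurable_fun setT (fun t : n.-tuple R => nth 0 t i).
Proof.
have [i_n|n_i] := ltnP i n.
  apply: (eq_measurable_fun (fun t : n.-tuple R => tnth t (Ordinal i_n))).
    by move=> t _; rewrite (tnth_nth 0).
  exact: measurable_tnth.
rewrite (_ : (fun t => _) = cst 0); first exact: measurable_cst.
by apply/funext => t; rewrite nth_default// size_tuple.
Qed.

Lemma measurable_interlacing : measurable I.
Proof.
have m1 i : measurable_fun setT (fun p : space => nth 0 p.1 i).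
  by apply: (measurableT_comp (@measurable_nth N i)); exact: measurable_fst.
have m2 i : measurable_fun setT (fun p : space => nth 0 p.2 i).
  by apply: (measurableT_comp (@measurable_nth N.-1 i)); exact: measurable_snd.
have mlt (f g : space -> R) : measurable_fun setT f -> measurable_fun setT g ->
    measurable [set p | f p < g p].
  move=> mf mg; rewrite -[X in measurable X]setTI.
  by have := measurable_fun_ltr mf mg measurableT (Y := [set true]); exact.
have -> : I = ([set p : space | a < nth 0 p.1 0] `&` [set p : space | nth 0 p.1 N.-1 < b]) `&`
   \bigcap_(i in [set: 'I_N.-1]) ([set p : space | nth 0 p.1 i < nth 0 p.2 i] `&`
     [set p : space | nth 0 p.2 i < nth 0 p.1 i.+1]).
  apply/seteqP; split => p /=.
    by move=> [h1 h2 h3]; split => // i _; exact: h3.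
  move=> [[h1 h2] h3]; split => // i iN; exact: (h3 (Ordinal iN) Logic.I).
apply: measurableI; first by apply: measurableI; apply: mlt.
by apply: fin_bigcap_measurable => // i _; apply: measurableI; apply: mlt.
Qed.

Variable phi : R -> R.
Hypothesis phia : phi a = a.
Hypothesis phib : phi b = b.
Hypothesis ab : a < b.
Hypothesis phi_incr : {in `[a, b] &, {mono phi : x y / x < y}}.

Definition map_pair (p : space) : space := ([tuple of map phi p.1], [tuple of map phi p.2]).

(** The map phi is strictly increasing on [a, b] and fixes the end points, so
    it preserves all the inequalities. *)
Lemma interlacing_map p : in_box p.1 -> in_box p.2 -> I (map_pair p) <-> I p.
Proof.
move=> b1 b2.
have n1 i : (i < N)%N -> nth 0 (map_pair p).1 i = phi (nth 0 p.1 i) /\ nth 0 p.1 i \in `[a, b].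
  move=> iN; rewrite /= (nth_map 0) ?size_tuple//; split => //.
  by have := b1 (Ordinal iN); rewrite (tnth_nth 0).
have n2 i : (i < N.-1)%N -> nth 0 (map_pair p).2 i = phi (nth 0 p.2 i) /\ nth 0 p.2 i \in `[a, b].
  move=> iN; rewrite /= (nth_map 0) ?size_tuple//; split => //.
  by have := b2 (Ordinal iN); rewrite (tnth_nth 0).
have [aab bab] : a \in `[a, b] /\ b \in `[a, b] by rewrite !bound_itvE !ltW.
have [e0 i0] := n1 _ N0.
have [eN iN] : _ /\ _ := n1 N.-1 (etrans (ltn_predL N) N0).
rewrite /interlacing /mkset e0 eN -{1}phia -{1}phib !phi_incr//.
split => -[h1 h2 h3]; split => // i i1; have [h4 h5] := h3 i i1; move: h4 h5.
  have iN1 : (i.+1 < N)%N by rewrite -ltn_predRL.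
  have [-> ?] := n1 _ iN1; have [-> ?] := n1 _ (ltnW iN1); have [-> ?] := n2 _ i1.
  by rewrite !phi_incr.
have iN1 : (i.+1 < N)%N by rewrite -ltn_predRL.
have [-> ?] := n1 _ iN1; have [-> ?] := n1 _ (ltnW iN1); have [-> ?] := n2 _ i1.
by rewrite !phi_incr.
Qed.

End Interlacing.

(** * Integrals of expanding families *)

Section MassDerivative.
Context {R : realType} d (T : measurableType d) (mu : {measure set T -> \bar R}).

Lemma expands_comp_fun (S S' : Type) (I : set S) (I' : set S') (g : S' -> S) c (U : R -> S -> R) :
  (forall w, I' w -> I (g w)) -> expands I c U ->
  expands I' (c \o g) (fun eps w => U eps (g w)).
Proof.
move=> gI [[B B0 hB] h]; split; first by exists B => // w /gI; exact: hB.
move=> e e0; have [dd d0 hd] := h e e0; exists dd => // eps ed w /gI; exact: hd.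
Qed.

(** All the functions U eps have the same integral, so the first-order
    coefficient integrates to zero. *)
Lemma expands_integral0 (D : set T) (c : T -> R) (U : R -> T -> R) (d0 : R) :
  measurable D -> (mu D < +oo)%E -> expands D c U -> measurable_fun D c -> 0 < d0 ->
  (forall eps, `|eps| < d0 -> measurable_fun D (U eps)) ->
  (forall eps, `|eps| < d0 -> \int[mu]_(x in D) U eps x = fine (mu D)) ->
  \int[mu]_(x in D) c x = 0.
Proof.
move=> mD muD eU mc d00 mU hU; have [[B B0 hB] h] := eU.
have [L L0 [d1 d10 hL]] := expands_lip eU.
set m := fine (mu D) in hU *; have m0 : 0 <= m by rewrite fine_ge0.
apply/eqP; rewrite -normr_eq0 eq_le normr_ge0 andbT.
rewrite -(mul0r m); apply/ler_addgt0Pl => e' e'0; rewrite mul0r addr0.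
pose e := e' / (m + 1); have e0 : 0 < e by rewrite divr_gt0// ltr_wpDl.
have [d2 d20 h2] := h _ e0.
(* a single small time suffices to bound the integral of c by e * m, for
   every e *)
pose eps := Num.min d0 (Num.min d1 d2) / 2.
have mpos : 0 < Num.min d0 (Num.min d1 d2) by rewrite !lt_min d00 d10 d20.
have eps0 : 0 < eps by rewrite divr_gt0.
have : `|eps| < Num.min d0 (Num.min d1 d2) by rewrite gtr0_norm// ltr_pdivrMr// ltr_pMr// ltr1n.
rewrite !lt_min => /and3P[x0 x1 x2].
have bnd (f : T -> R) K : measurable_fun D f -> (forall x, D x -> `|f x| <= K) ->
    mu.-integrable D (EFin \o f).
  move=> mf fK; apply: measurable_bounded_integrable => //.
  exists K; split; rewrite ?num_real// => M KM x Dx /=.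
  by rewrite (le_trans (fK _ Dx))// ltW.
have i1 : mu.-integrable D (EFin \o U eps).
  apply: (bnd _ (L * `|eps| + 1)); first exact: mU.
  move=> x Dx; rewrite -[U eps x](subrK 1) (le_trans (ler_normD _ _))// normr1.
  by rewrite lerD2r hL.
have ic : mu.-integrable D (EFin \o c) by exact: (bnd _ B).
have i2 : mu.-integrable D (EFin \o (fun x => eps * c x)) by exact: integrableZl_EFin.
have i3 : mu.-integrable D (EFin \o cst 1).
  by apply: (bnd _ 1) => [|x _]; rewrite ?normr1//; exact: measurable_cst.
have i4 : mu.-integrable D (EFin \o (fun x => U eps x - 1)).
  by have := integrableB mD i1 i3.
have key : \int[mu]_(x in D) (U eps x - 1 - eps * c x) = - (eps * \int[mu]_(x in D) c x).
  rewrite RintegralB// RintegralB// Rintegral_cst// hU// RintegralZl// mul1r subrr.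
  by rewrite add0r.
have mm : measurable_fun D (fun x => U eps x - 1 - eps * c x).
  apply: measurable_funB; last by apply: measurable_funM => //; exact: measurable_cst.
  by apply: measurable_funB; [exact: mU|exact: measurable_cst].
have nn : 0 <= e * `|eps| by rewrite mulr_ge0// ltW.
have hh := @Rintegral_null_le _ _ _ mu D mD muD _ set0
  (e * `|eps|) measurable0 (measure0 mu) mm nn (fun x Dx _ => h2 _ x2 x Dx).
clearbody eps; move: hh; rewrite key normrN normrM -/m (_ : e * `|eps| * m = `|eps| * (e * m)); last by ring.
rewrite ler_pM2l ?normr_gt0 ?gt_eqF// => hh; apply: le_trans hh _.
by rewrite /e mulrAC ler_pdivrMr ?ltr_wpDl// ler_wpM2l ?lerDl// ltW.
Qed.

End MassDerivative.

(** * Deforming the ensemble along a flow *)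

Section Deformation.
Context {R : realType}.
Variables (N : nat) (theta a b : R) (h : R -> R) (q : R -> R -> R) (Cq : R).
Local Notation space := (N.-tuple R * N.-1.-tuple R)%type.
Local Notation I := (@interlacing R N a b).
Hypothesis N0 : (0 < N)%N.
Hypothesis ab : a < b.
Hypothesis hqE : forall x y, x \in `[a, b] -> y \in `[a, b] -> h x - h y = (x - y) * q x y.
Hypothesis Cq0 : 0 <= Cq.
Hypothesis qB : forall x y, x \in `[a, b] -> y \in `[a, b] -> `|q x y| <= Cq.
Hypotheses (ha : h a = 0) (hb : h b = 0).
Hypothesis mh : measurable_fun setT h.
Hypothesis mq : measurable_fun setT (fun z : R * R => q z.1 z.2).
Hypothesis dh : forall t, t \in `[a, b] -> is_derive t 1 h (q t t).
Hypothesis cq : forall t, t \in `[a, b] -> {for t, continuous (fun t => q t t)}.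
Implicit Types (p : space) (U dU : R -> R).

Definition flow (eps x : R) := x + eps * h x.

Definition potential_factor U n (t : n.-tuple R) : R :=
  \prod_(i < n) expR (- (N%:R * theta * U (tnth t i))).

(** The weight of the ensemble for arbitrary real potentials. It is applied
    to the restrictions of V^t and V^b to [a, b], which are measurable
    functions on the line. *)
Definition potential_weight Ut Ub p : R :=
  vandermonde p.1 * vandermonde p.2 *
  (\prod_(i < N.-1) \prod_(j < N) `|tnth p.2 i - tnth p.1 j| `^ (theta - 1)) *
  potential_factor Ub p.2 * potential_factor Ut p.1.

Definition vandermonde_ratio n eps (t : n.-tuple R) : R :=
  \prod_(i < n) \prod_(j < n | (i < j)%N) (1 + eps * q (tnth t j) (tnth t i)).
Definition cross_ratio eps p : R :=
  \prod_(i < N.-1) \prod_(j < N) (1 + eps * q (tnth p.2 i) (tnth p.1 j)) `^ (theta - 1).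
Definition potential_ratio U n eps (t : n.-tuple R) : R :=
  \prod_(i < n) expR (- (N%:R * theta * (U (flow eps (tnth t i)) - U (tnth t i)))).
Definition jacobian n eps (t : n.-tuple R) : R :=
  \prod_(i < n) (1 + eps * q (tnth t i) (tnth t i)).
(** The factor by which the density changes along the flow, Jacobian
    included. *)
Definition weight_ratio Ut Ub eps p : R :=
  vandermonde_ratio eps p.1 * vandermonde_ratio eps p.2 * cross_ratio eps p *
  potential_ratio Ub eps p.2 * potential_ratio Ut eps p.1 *
  (jacobian eps p.1 * jacobian eps p.2).

Definition vandermonde_rate n (t : n.-tuple R) : R :=
  \sum_(i < n) \sum_(j < n | (i < j)%N) q (tnth t j) (tnth t i).
Definition cross_rate p : R :=
  \sum_(i < N.-1) \sum_(j < N) (theta - 1) * q (tnth p.2 i) (tnth p.1 j).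
Definition potential_rate dU n (t : n.-tuple R) : R :=
  \sum_(i < n) - (N%:R * theta * (dU (tnth t i) * h (tnth t i))).
Definition jacobian_rate n (t : n.-tuple R) : R :=
  \sum_(i < n) q (tnth t i) (tnth t i).
(** The derivative of [weight_ratio] at time 0. *)
Definition loop_rate dUt dUb p : R :=
  vandermonde_rate p.1 + vandermonde_rate p.2 + cross_rate p +
  potential_rate dUb p.2 + potential_rate dUt p.1 +
  (jacobian_rate p.1 + jacobian_rate p.2).

(** A vector field with bounded difference quotients multiplies every
    difference of coordinates by a factor close to 1. *)
Lemma flow_sub eps x y : x \in `[a, b] -> y \in `[a, b] ->
  flow eps x - flow eps y = (x - y) * (1 + eps * q x y).
Proof.
move=> xab yab.
have -> : flow eps x - flow eps y = x - y + eps * (h x - h y) by rewrite /flow; ring.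
by rewrite hqE//; ring.
Qed.

Section FixedTime.
Variable eps : R.
Hypothesis eps_small : `|eps| * Cq < 1.

Lemma factor_gt0 x y : x \in `[a, b] -> y \in `[a, b] -> 0 < 1 + eps * q x y.
Proof.
move=> xab yab; have : `|eps * q x y| < 1.
  by rewrite normrM (le_lt_trans _ eps_small)// ler_wpM2l// qB.
by rewrite ltr_norml => /andP[h1 _]; lra.
Qed.

Lemma flow_mono : {in `[a, b] &, {mono (flow eps) : x y / x < y}}.
Proof.
move=> x y xab yab; rewrite -subr_lt0 flow_sub// pmulr_llt0 ?subr_lt0//.
exact: factor_gt0.
Qed.

Lemma flow_a : flow eps a = a. Proof. by rewrite /flow ha mulr0 addr0. Qed.
Lemma flow_b : flow eps b = b. Proof. by rewrite /flow hb mulr0 addr0. Qed.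

Lemma flow_in x : x \in `[a, b] -> flow eps x \in `[a, b].
Proof.
move=> xab; have [aab bab] : a \in `[a, b] /\ b \in `[a, b] by rewrite !bound_itvE !ltW.
move: (xab); rewrite !in_itv /= => /andP[ax xb].
by rewrite -[a in X in X && _]flow_a -[b in X in _ && X]flow_b !leNgt !flow_mono// -!leNgt ax xb.
Qed.

Lemma measurable_flow : measurable_fun setT (flow eps).
Proof.
apply: measurable_funD; first exact: measurable_id.
by apply: measurable_funM => //; exact: measurable_cst.
Qed.

Lemma is_derive_flow t : t \in `[a, b] -> is_derive t 1 (flow eps) (1 + eps * q t t).
Proof.
move=> tab; have := @is_deriveD _ _ _ _ _ _ _ _ _ (@is_derive_id _ _ t 1)
  (@is_deriveZ _ _ _ _ eps t 1 _ (dh tab)).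
by [].
Qed.

Lemma continuous_factor t : t \in `[a, b] -> {for t, continuous (fun t => 1 + eps * q t t)}.
Proof.
move=> tab; apply: cvgD; first exact: cvg_cst.
by apply: cvgM; [exact: cvg_cst|exact: cq].
Qed.

Lemma vandermonde_flow n (t : n.-tuple R) : in_box a b t ->
  vandermonde [tuple of map (flow eps) t] = vandermonde t * vandermonde_ratio eps t.
Proof.
move=> tab; rewrite /vandermonde /vandermonde_ratio -big_split /=.
apply: eq_bigr => i _; rewrite -big_split /=; apply: eq_bigr => j _.
by rewrite !tnth_map flow_sub.
Qed.

Lemma cross_flow p : in_box a b p.1 -> in_box a b p.2 ->
  \prod_(i < N.-1) \prod_(j < N)
    `|tnth (map_pair (flow eps) p).2 i - tnth (map_pair (flow eps) p).1 j| `^ (theta - 1) =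
  (\prod_(i < N.-1) \prod_(j < N) `|tnth p.2 i - tnth p.1 j| `^ (theta - 1)) * cross_ratio eps p.
Proof.
move=> b1 b2; rewrite /cross_ratio -big_split /=.
apply: eq_bigr => i _; rewrite -big_split /=; apply: eq_bigr => j _.
rewrite !tnth_map flow_sub// normrM (gtr0_norm (factor_gt0 _ _))//.
by rewrite powRM// ltW// factor_gt0.
Qed.

Lemma potential_flow U n (t : n.-tuple R) :
  potential_factor U [tuple of map (flow eps) t] = potential_factor U t * potential_ratio U eps t.
Proof.
rewrite /potential_factor /potential_ratio -big_split /=; apply: eq_bigr => i _.
by rewrite tnth_map -expRD; congr expR; ring.
Qed.

(** By [flow_sub], even the factors |y - x| ^ (theta - 1), which may be
    singular, are multiplied by functions close to 1. *)
Lemma potential_weight_flow Ut Ub p : in_box a b p.1 -> in_box a b p.2 ->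
  potential_weight Ut Ub (map_pair (flow eps) p) * (jacobian eps p.1 * jacobian eps p.2) =
  potential_weight Ut Ub p * weight_ratio Ut Ub eps p.
Proof.
move=> b1 b2; rewrite /potential_weight cross_flow// !vandermonde_flow// !potential_flow /weight_ratio.
set A := vandermonde p.1; set B := vandermonde p.2; set C := \prod_i _.
set D := potential_factor _ _; set E := potential_factor _ _.
set A' := vandermonde_ratio _ _; set B' := vandermonde_ratio _ _; set C' := cross_ratio _ _.
set D' := potential_ratio _ _ _; set E' := potential_ratio _ _ _; set J := _ * jacobian _ _.
by ring.
Qed.

Lemma weight_ratio_ge0 Ut Ub p : I p -> 0 <= weight_ratio Ut Ub eps p.
Proof.
move=> /(interlacing_box N0)[b1 b2].
have f0 x y : x \in `[a, b] -> y \in `[a, b] -> 0 <= 1 + eps * q x y by move=> *; exact/ltW/factor_gt0.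
rewrite /weight_ratio !mulr_ge0//.
- by apply: prodr_ge0 => i _; apply: prodr_ge0 => j _; exact: f0.
- by apply: prodr_ge0 => i _; apply: prodr_ge0 => j _; exact: f0.
- by apply: prodr_ge0 => i _; apply: prodr_ge0 => j _; exact: powR_ge0.
- by apply: prodr_ge0 => i _; exact: expR_ge0.
- by apply: prodr_ge0 => i _; exact: expR_ge0.
- by apply: prodr_ge0 => i _; exact: f0.
- by apply: prodr_ge0 => i _; exact: f0.
Qed.

End FixedTime.
End Deformation.

(** * The loop equation of a real vector field *)

Section ProductSigmaFinite.
Local Open Scope ereal_scope.
Context d1 d2 (T1 : measurableType d1) (T2 : measurableType d2) (R : realType).
Variable m1 : {sigma_finite_measure set T1 -> \bar R}.
Variable m2 : {sigma_finite_measure set T2 -> \bar R}.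

(** The product measure, with a sigma-finite structure inherited from factors
    that are sigma-finite. *)
Definition sigma_product : set (T1 * T2) -> \bar R := m1 \x m2.

HB.instance Definition _ := Measure.copy sigma_product (m1 \x m2).

Let product_sigma_finite : sigma_finite setT sigma_product.
Proof.
have /sigma_finiteP[F [TF ndF Foo]] := sigma_finiteT m1.
have /sigma_finiteP[G [TG ndG Goo]] := sigma_finiteT m2.
exists (fun n => F n `*` G n).
  apply/seteqP; split => // -[x y] _.
  have [n _ Fnx] : (\bigcup_i F i) x by rewrite -TF.
  have [k _ Gky] : (\bigcup_i G i) y by rewrite -TG.
  exists (maxn n k) => //; split => /=.
    by move: x Fnx; exact/subsetPset/ndF/leq_maxl.
  by move: y Gky; exact/subsetPset/ndG/leq_maxr.
move=> k; have [mF Fk] := Foo k; have [mG Gk] := Goo k.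
split; first exact: measurableX.
by rewrite /sigma_product product_measure1E// lte_mul_pinfty// ge0_fin_numE.
Qed.

HB.instance Definition _ := Measure_isSigmaFinite.Build _ _ _ sigma_product
  product_sigma_finite.

End ProductSigmaFinite.

Section LoopEquation.
Context {R : realType}.
Variables (N : nat) (theta a b : R) (h : R -> R) (q : R -> R -> R) (Cq : R).
Local Notation space := (N.-tuple R * N.-1.-tuple R)%type.
Local Notation I := (@interlacing R N a b).
Hypothesis N0 : (0 < N)%N.
Hypothesis theta0 : 0 < theta.
Hypothesis ab : a < b.
Hypothesis hqE : forall x y, x \in `[a, b] -> y \in `[a, b] -> h x - h y = (x - y) * q x y.
Hypothesis Cq0 : 0 <= Cq.
Hypothesis qB : forall x y, x \in `[a, b] -> y \in `[a, b] -> `|q x y| <= Cq.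
Hypotheses (ha : h a = 0) (hb : h b = 0).
Hypothesis mh : measurable_fun setT h.
Hypothesis mq : measurable_fun setT (fun z : R * R => q z.1 z.2).
Hypothesis dh : forall t, t \in `[a, b] -> is_derive t 1 h (q t t).
Hypothesis cq : forall t, t \in `[a, b] -> {for t, continuous (fun t => q t t)}.
Implicit Types (p : space) (U dU : R -> R).

(** A quadratic bound on the remainder, uniform over [a, b]. Only increments
    inside [a, b] matter, since the flow preserves this interval. *)
Definition C11_on U dU := [/\ measurable_fun setT U, measurable_fun setT dU &
  exists2 K : R, 0 <= K & exists2 e : R, 0 < e &
   (forall x, x \in `[a, b] -> `|dU x| <= K) /\
   (forall x k, x \in `[a, b] -> x + k \in `[a, b] -> `|k| < e ->
     `|U (x + k) - U x - k * dU x| <= K * k ^+ 2)].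

Lemma h_bound x : x \in `[a, b] -> `|h x| <= (b - a) * Cq.
Proof.
move=> xab; have aab : a \in `[a, b] by rewrite bound_itvE ltW.
have := hqE xab aab; rewrite ha subr0 => ->; rewrite normrM ler_pM// ?qB//.
by move: xab; rewrite in_itv /= => /andP[ax xb]; rewrite ger0_norm ?subr_ge0// lerD2r.
Qed.

Lemma small_time : exists2 d : R, 0 < d & forall eps : R, `|eps| < d -> `|eps| * Cq < 1.
Proof.
have Cq1 : 0 < Cq + 1 by rewrite ltr_wpDl.
exists (Cq + 1)^-1; rewrite ?invr_gt0// => eps.
rewrite -[_^-1]div1r ltr_pdivlMr// mulrDr mulr1; have := normr_ge0 eps; lra.
Qed.

Lemma expands_factor (S : Type) (J : set S) (f g : S -> R) :
  (forall w, J w -> f w \in `[a, b]) -> (forall w, J w -> g w \in `[a, b]) ->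
  expands J (fun w => q (f w) (g w)) (fun eps w => 1 + eps * q (f w) (g w)).
Proof.
by move=> fJ gJ; apply: expands_linear; exists Cq => // w Jw; apply: qB; [exact: fJ|exact: gJ].
Qed.

Lemma expands_potential (S : Type) (J : set S) (f : S -> R) U dU :
  C11_on U dU -> (forall w, J w -> f w \in `[a, b]) ->
  expands J (fun w => - (N%:R * theta * (dU (f w) * h (f w))))
    (fun eps w => expR (- (N%:R * theta * (U (flow h eps (f w)) - U (f w))))).
Proof.
move=> [_ _ [K K0 [e e0 [dUK UK]]]] fJ; apply: expands_expR.
have H0 : 0 <= (b - a) * Cq by rewrite mulr_ge0// subr_ge0 ltW.
have hB := h_bound; move: H0 hB; move: ((b - a) * Cq) => H H0 hB.
have L0 : 0 <= N%:R * theta by rewrite mulr_ge0// ltW.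
move: (N%:R * theta) L0 => L L0.
split.
  exists (L * (K * H)); first by rewrite !mulr_ge0//.
  move=> w Jw; rewrite normrN !normrM (ger0_norm L0) ler_wpM2l// ler_pM//.
    by rewrite dUK// fJ.
  by rewrite hB// fJ.
move=> e1 e10.
have [d0 d00 hd0] := small_time.
have pH : 0 < H + 1 by rewrite ltr_wpDl.
have pL : 0 < L * (K * H ^+ 2) + 1 by rewrite ltr_wpDl// !mulr_ge0// sqr_ge0.
exists (Num.min d0 (Num.min (e / (H + 1)) (e1 / (L * (K * H ^+ 2) + 1)))).
  by rewrite !lt_min d00 !divr_gt0.
move=> eps; rewrite !lt_min => /and3P[x0]; rewrite !ltr_pdivlMr// => x1 x2 w Jw.
have fw := fJ w Jw; have hw := hB _ fw.
have epsh : `|eps * h (f w)| <= `|eps| * H by rewrite normrM ler_wpM2l.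
have ke : `|eps * h (f w)| < e.
  apply: le_lt_trans epsh _; move: x1; rewrite mulrDr mulr1; have := normr_ge0 eps; lra.
have flw : f w + eps * h (f w) \in `[a, b] by exact: (flow_in ab hqE qB ha hb (hd0 _ x0) fw).
have k2 := UK _ _ fw flw ke.
rewrite (_ : 1 + _ - 1 - _ = - (L * (U (f w + eps * h (f w)) - U (f w) - eps * h (f w) * dU (f w)))); last first.
  by rewrite /flow; ring.
rewrite normrN normrM (ger0_norm L0) (le_trans (ler_wpM2l L0 k2))//.
have sq : (eps * h (f w)) ^+ 2 <= (`|eps| * H) ^+ 2.
  by rewrite -real_normK ?num_real// lerXn2r ?nnegrE ?mulr_ge0.
have s1 := ler_wpM2l L0 (ler_wpM2l K0 sq).
rewrite (le_trans s1)// (_ : L * _ = (`|eps| * (L * (K * H ^+ 2))) * `|eps|); last by ring.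
rewrite ler_wpM2r//; move: x2; rewrite mulrDr mulr1; have := normr_ge0 eps; lra.
Qed.

Lemma expands_weight_ratio Ut dUt Ub dUb : C11_on Ut dUt -> C11_on Ub dUb ->
  expands I (@loop_rate R N theta h q dUt dUb) (@weight_ratio R N theta h q Ut Ub).
Proof.
move=> ht hbb.
have bx i p : I p -> tnth p.1 i \in `[a, b] by move=> /(interlacing_box N0)[].
have bY i p : I p -> tnth p.2 i \in `[a, b] by move=> /(interlacing_box N0)[].
rewrite /loop_rate /weight_ratio.
apply: expandsM; [apply: expandsM; [apply: expandsM; [apply: expandsM; [apply: expandsM|]|]|]|apply: expandsM].
- apply: expands_prod => i _; apply: expands_prod => j _.
  by apply: expands_factor => p; exact: bx.
- apply: expands_prod => i _; apply: expands_prod => j _.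
  by apply: expands_factor => p; exact: bY.
- apply: expands_prod => i _; apply: expands_prod => j _.
  by apply: expands_powR; apply: expands_factor => p; [exact: bY|exact: bx].
- by apply: expands_prod => i _; apply: expands_potential => // p; exact: bY.
- by apply: expands_prod => i _; apply: expands_potential => // p; exact: bx.
- by apply: expands_prod => i _; apply: expands_factor => p; exact: bx.
- by apply: expands_prod => i _; apply: expands_factor => p; exact: bY.
Qed.

Let mx i : measurable_fun setT (fun p : space => tnth p.1 i).
Proof. by apply: (measurableT_comp (measurable_tnth i)); exact: measurable_fst. Qed.
Let my i : measurable_fun setT (fun p : space => tnth p.2 i).
Proof. by apply: (measurableT_comp (measurable_tnth i)); exact: measurable_snd. Qed.
Let mqc d (S : measurableType d) (f g : S -> R) : measurable_fun setT f ->
  measurable_fun setT g -> measurable_fun setT (fun w => q (f w) (g w)).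
Proof. by move=> mf mg; apply: (measurableT_comp mq (measurable_fun_pair mf mg)). Qed.
Let mqe eps d (S : measurableType d) (f g : S -> R) : measurable_fun setT f ->
  measurable_fun setT g -> measurable_fun setT (fun w => 1 + eps * q (f w) (g w)).
Proof.
move=> mf mg; apply: measurable_funD; first exact: measurable_cst.
by apply: measurable_funM; [exact: measurable_cst|exact: mqc].
Qed.

Let msum d (S : measurableType d) n (Q : pred 'I_n) (F : 'I_n -> S -> R) :
  (forall i, measurable_fun setT (F i)) ->
  measurable_fun setT (fun w => \sum_(i < n | Q i) F i w).
Proof.
move=> mF; under eq_fun do rewrite big_mkcond.
by apply: measurable_sum => i; case: (Q i).
Qed.

Let mprod d (S : measurableType d) n (Q : pred 'I_n) (F : 'I_n -> S -> R) :
  (forall i, measurable_fun setT (F i)) ->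
  measurable_fun setT (fun w => \prod_(i < n | Q i) F i w).
Proof.
move=> mF; under eq_fun do rewrite big_mkcond.
by apply: measurable_prod => i _; case: (Q i).
Qed.

Lemma measurable_loop_rate dUt dUb : measurable_fun setT dUt -> measurable_fun setT dUb ->
  measurable_fun setT (@loop_rate R N theta h q dUt dUb).
Proof.
move=> mt mb; have mpot dU d (S : measurableType d) (f : S -> R) : measurable_fun setT dU ->
    measurable_fun setT f -> measurable_fun setT (fun w => - (N%:R * theta * (dU (f w) * h (f w)))).
  move=> mU mf; apply: measurable_funN; apply: measurable_funM; first exact: measurable_cst.
  by apply: measurable_funM; exact: measurableT_comp.
rewrite /loop_rate; apply: measurable_funD; last first.
  by apply: measurable_funD; apply: msum => i; exact: mqc.
apply: measurable_funD; last by apply: msum => i; exact: mpot.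
apply: measurable_funD; last by apply: msum => i; exact: mpot.
apply: measurable_funD; last first.
  apply: msum => i; apply: msum => j; apply: measurable_funM; first exact: measurable_cst.
  exact: mqc.
by apply: measurable_funD; apply: msum => i; apply: msum => j; exact: mqc.
Qed.

Lemma measurable_weight_ratio Ut Ub eps : measurable_fun setT Ut -> measurable_fun setT Ub ->
  measurable_fun setT (@weight_ratio R N theta h q Ut Ub eps).
Proof.
move=> mt mb; have mflow := @measurable_flow R h mh eps.
have mpot U d (S : measurableType d) (f : S -> R) : measurable_fun setT U ->
    measurable_fun setT f ->
    measurable_fun setT (fun w => expR (- (N%:R * theta * (U (flow h eps (f w)) - U (f w))))).
  move=> mU mf; apply: measurableT_comp => //; apply: measurable_funN.
  apply: measurable_funM; first exact: measurable_cst.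
  apply: measurable_funB; last exact: measurableT_comp.
  by apply: measurableT_comp => //; exact: measurableT_comp.
rewrite /weight_ratio; apply: measurable_funM; last first.
  by apply: measurable_funM; apply: mprod => i; exact: mqe.
apply: measurable_funM; last by apply: measurable_prod => i _; exact: mpot.
apply: measurable_funM; last by apply: measurable_prod => i _; exact: mpot.
apply: measurable_funM; last first.
  apply: mprod => i; apply: mprod => j.
  by apply: (measurableT_comp (measurable_powR _)); exact: mqe.
by apply: measurable_funM; apply: mprod => i; apply: mprod => j; exact: mqe.
Qed.

Lemma measurable_potential_weight Ut Ub : measurable_fun setT Ut -> measurable_fun setT Ub ->
  measurable_fun setT (@potential_weight R N theta Ut Ub).
Proof.
move=> mt mb.
have mvan n : measurable_fun setT (@vandermonde R n).
  apply: mprod => i; apply: mprod => j.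
  by apply: measurable_funB; exact: measurable_tnth.
have mpot U n : measurable_fun setT U -> measurable_fun setT (@potential_factor R N theta U n).
  move=> mU; apply: measurable_prod => i _; apply: measurableT_comp => //; apply: measurable_funN.
  apply: measurable_funM; first exact: measurable_cst.
  by apply: measurableT_comp => //; exact: measurable_tnth.
rewrite /potential_weight; apply: measurable_funM; last first.
  by apply: (measurableT_comp (mpot Ut N mt)); exact: measurable_fst.
apply: measurable_funM; last first.
  by apply: (measurableT_comp (mpot Ub N.-1 mb)); exact: measurable_snd.
apply: measurable_funM; last first.
  apply: mprod => i; apply: mprod => j.
  apply: (measurableT_comp (measurable_powR _)); apply: measurableT_comp => //.
  exact: measurable_funB.
apply: measurable_funM.
  by apply: (measurableT_comp (mvan N)); exact: measurable_fst.
by apply: (measurableT_comp (mvan N.-1)); exact: measurable_snd.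
Qed.

Lemma potential_weight_ge0 Ut Ub p : I p -> 0 <= @potential_weight R N theta Ut Ub p.
Proof.
move=> Ip; rewrite /potential_weight !mulr_ge0//.
- apply: prodr_ge0 => i _; apply: prodr_ge0 => j ij; rewrite subr_ge0 ltW// !(tnth_nth 0).
  by apply: (interlacing_lt_x N0 Ip); rewrite ij ltn_ord.
- apply: prodr_ge0 => i _; apply: prodr_ge0 => j ij; rewrite subr_ge0 ltW// !(tnth_nth 0).
  by apply: (interlacing_lt_y Ip); rewrite ij ltn_ord.
- by apply: prodr_ge0 => i _; apply: prodr_ge0 => j _; exact: powR_ge0.
- by apply: prodr_ge0 => i _; exact: expR_ge0.
- by apply: prodr_ge0 => i _; exact: expR_ge0.
Qed.

Section Law.
Local Notation mu := (@lebesgue_tuple R N \x @lebesgue_tuple R N.-1)%E.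
Variables (Ut dUt Ub dUb : R -> R) (Z : R).
Hypotheses (ht : C11_on Ut dUt) (hbb : C11_on Ub dUb).
Local Notation f := (fun p => Z * @potential_weight R N theta Ut Ub p * \1_I p).
Hypothesis f1 : (\int[mu]_p (f p)%:E = 1)%E.

Let mUt : measurable_fun setT Ut. Proof. by case: ht. Qed.
Let mUb : measurable_fun setT Ub. Proof. by case: hbb. Qed.
Let mI : measurable I. Proof. exact: measurable_interlacing. Qed.

Lemma measurable_law_density : measurable_fun setT f.
Proof.
apply: measurable_funM; last exact: measurable_indic.
by apply: measurable_funM; [exact: measurable_cst|exact: measurable_potential_weight].
Qed.

(** The weight is nonnegative on interlacing configurations, so the sign of
    the constant is forced by the total mass. *)
Lemma normalization_ge0 : 0 <= Z.
Proof.
rewrite leNgt; apply/negP => Z0.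
have f0 p : 0 <= - f p.
  rewrite /= indicE oppr_ge0; have [|_] := boolP (p \in _); last by rewrite mulr0.
  by rewrite inE => Ip; rewrite mulr1 nmulr_rle0// potential_weight_ge0.
have : (0 <= \int[mu]_p (- f p)%:E)%E by apply: integral_ge0 => p _; rewrite lee_fin f0.
have := @integral_ge0N _ _ _ mu setT (fun p => (- f p)%:E).
move=> /(_ (fun p _ => f0 p)); under eq_integral do rewrite -EFinN opprK /=.
rewrite f1; set J := (\int[mu]__ _)%E => J1 J0.
by move: J0; rewrite -leeN2 -J1 oppe0 lee_fin ler10.
Qed.

Lemma law_density_ge0 p : 0 <= f p.
Proof.
rewrite /= indicE; have [|_] := boolP (p \in _); last by rewrite mulr0.
by rewrite inE => Ip; rewrite mulr1 mulr_ge0 ?normalization_ge0// potential_weight_ge0.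
Qed.

Local Notation ratio := (@weight_ratio R N theta h q Ut Ub).

(** The flow maps the interlacing configurations onto themselves, so the
    change of variables returns the mass of the original density. *)
Lemma flow_mass eps : `|eps| * Cq < 1 ->
  (\int[mu]_p ((ratio eps p * \1_I p)%:E * (f p)%:E) = 1)%E.
Proof.
move=> small.
have mflow := @measurable_flow R h mh eps.
have pos t : t \in `[a, b] -> 0 <= 1 + eps * q t t.
  by move=> tab; apply/ltW; exact: (factor_gt0 qB small).
have mono := flow_mono hqE qB small.
pose w t := 1 + eps * q t t.
have sub1 := @substitution1 R a b (flow h eps) w ab mflow (flow_a ha eps) (flow_b hb eps) mono
  (is_derive_flow dh eps) (@continuous_factor _ _ _ _ cq eps) pos.
have bi0 := @box_ind_ge0 R a b.
have bw0 := @box_w_ge0 R a b w pos.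
have mbi := @measurable_box_ind R a b.
have mbw := @measurable_box_w R a b w (@continuous_factor _ _ _ _ cq eps).
have mf := measurable_law_density; have f0 := law_density_ge0.
have mef : measurable_fun setT (EFin \o f) by exact/measurable_EFinP.
have ef0 p : (0 <= (EFin \o f) p)%E by rewrite lee_fin.
have E := esym (@substitution_pair R _ _ _ bi0 bw0 mbi mbw mflow sub1 N N.-1 _ mef ef0).
have one n (t : n.-tuple R) : in_box a b t -> tuple_prod (@box_ind R a b) t = 1.
  by move=> tb; apply: big1 => i _; rewrite /box_ind indicE mem_set//=; exact: tb.
have jac n (t : n.-tuple R) : in_box a b t -> tuple_prod (box_w a b w) t = jacobian q eps t.
  move=> tb; apply: eq_bigr => i _; rewrite /box_w /box_ind indicE mem_set ?mulr1//=; exact: tb.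
have out n (t : n.-tuple R) : ~ in_box a b t -> tuple_prod (box_w a b w) t = 0.
  move=> /existsNP[i ti]; rewrite /tuple_prod (bigD1 i)//= /box_w /box_ind indicE memNset ?mulr0 ?mul0r//.
transitivity (\int[mu]_p ((EFin \o f) ([tuple of map (flow h eps) p.1], [tuple of map (flow h eps) p.2]) *
      (tuple_prod (box_w a b w) p.1 * tuple_prod (box_w a b w) p.2)%:E))%E.
  apply: eq_integral => p _; rewrite -!EFinM; congr EFin.
  have [[b1 b2]|nb] := pselect (in_box a b p.1 /\ in_box a b p.2); last first.
    rewrite [in LHS]indicE memNset => [|/(interlacing_box N0)//].
    rewrite mulr0 mul0r; have [b1|/out->] := pselect (in_box a b p.1); last by rewrite mul0r mulr0.
    by have [b2|/out->] := pselect (in_box a b p.2); [case: nb|rewrite !mulr0].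
  have mm := interlacing_map N0 (flow_a ha eps) (flow_b hb eps) ab mono b1 b2.
  rewrite !jac//=; have [Ip|nIp] := pselect (I p); last first.
    by rewrite indicE memNset// mulr0 mul0r indicE memNset ?mulr0 ?mul0r// => /mm.
  rewrite !indicE !mem_set//=; last exact/mm.
  have gf := potential_weight_flow theta hqE qB small Ut Ub b1 b2.
  rewrite !mulr1 [LHS](_ : _ = Z * (potential_weight theta Ut Ub p * ratio eps p)); last by ring.
  by rewrite -gf mulrA.
rewrite E -f1; apply: eq_integral => p _; rewrite -EFinM; congr EFin.
have [Ip|nIp] := pselect (I p).
  by have [b1 b2] := interlacing_box N0 Ip; rewrite !one// !mulr1.
by rewrite /= indicE memNset// mulr0 mul0r.
Qed.

Section Probability.
Variables (d : measure_display) (T : measurableType d) (P : probability T R) (XY : T -> space).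
Hypothesis mXY : measurable_fun setT XY.
Hypothesis law : forall A, measurable A -> (P (XY @^-1` A) = \int[mu]_(p in A) (f p)%:E)%E.
Let D := XY @^-1` I.

Lemma measurable_law_support : measurable D.
Proof. by rewrite -[D]setTI; exact: mXY. Qed.

Lemma law_support : P D = 1%E.
Proof.
rewrite law//; apply: etrans f1; rewrite integral_mkcond; apply: eq_integral => p _.
by rewrite patchE /= indicE; case: (p \in I); rewrite ?mulr1 ?mulr0.
Qed.

Lemma integral_law (G : space -> \bar R) : measurable_fun setT G -> (forall p, 0 <= G p)%E ->
  (\int[P]_w G (XY w) = \int[mu]_p (G p * (f p)%:E))%E.
Proof.
move=> mG G0.
have mf := measurable_law_density; have f0 := law_density_ge0.
have foo : (\int[mu]_p (f p)%:E < +oo)%E by rewrite f1 ltry.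
pose m : {sigma_finite_measure set space -> \bar R} := sigma_product (@lebesgue_tuple R N) (@lebesgue_tuple R N.-1).
pose nu : {finite_measure set space -> \bar R} := @density_measure _ _ _ m f f0 mf foo.
rewrite -(@integral_density _ _ _ m nu f G mf f0)//.
by apply/esym; apply: integral_pushforward_eq.
Qed.

Lemma flow_mass_law eps : `|eps| * Cq < 1 ->
  \int[P]_(w in D) ratio eps (XY w) = fine (P D).
Proof.
move=> small; rewrite law_support /Rintegral; congr fine.
have mr := @measurable_weight_ratio Ut Ub eps mUt mUb.
rewrite -[RHS](flow_mass small) -integral_law; last 2 first.
- by apply/measurable_EFinP; apply: measurable_funM => //; exact: measurable_indic.
- move=> p; rewrite lee_fin indicE; have [|_] := boolP (p \in _); last by rewrite mulr0.
  by rewrite inE mulr1; exact: (weight_ratio_ge0 theta h N0 qB small Ut Ub).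
rewrite integral_mkcond; apply: eq_integral => w _.
rewrite patchE indicE; have -> : (w \in D) = (XY w \in I) by apply/idP/idP; rewrite !inE.
by case: ifP; rewrite ?mulr1 ?mulr0.
Qed.

(** By [flow_mass_law] the expectation of [weight_ratio] is 1 for all small
    times, and its first-order coefficient is [loop_rate]. *)
Theorem real_loop_equation : \int[P]_(w in D) @loop_rate R N theta h q dUt dUb (XY w) = 0.
Proof.
have [d0 d00 hd0] := small_time.
have [_ mdUt _] := ht; have [_ mdUb _] := hbb.
have mloc (g : space -> R) : measurable_fun setT g -> measurable_fun D (fun w => g (XY w)).
  by move=> mg; apply: measurable_funTS; exact: measurableT_comp.
apply: (@expands_integral0 _ _ _ P D (@loop_rate R N theta h q dUt dUb \o XY)
  (fun eps w => ratio eps (XY w)) d0).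
- exact: measurable_law_support.
- exact: (le_lt_trans (probability_le1 P measurable_law_support) (ltry 1)).
- by apply: (expands_comp_fun (I := I)) => //; exact: expands_weight_ratio.
- by apply: mloc; exact: measurable_loop_rate.
- by [].
- by move=> eps _; apply: mloc; exact: measurable_weight_ratio.
- by move=> eps /hd0; exact: flow_mass_law.
Qed.

End Probability.
End Law.
End LoopEquation.

(** * The rational vector field and its contour kernel *)

Section Kernel.
Context {R : realType}.
Local Notation C := R[i].
Local Notation mu := (@lebesgue_measure R).
Local Notation D := (`[0 : R, 1]%classic).
Implicit Types (z w : C).
Variables (am ap : R) (v : C).
Local Notation pv := ((v - am%:C) * (v - ap%:C)).

(** In partial fractions, the vector field p x / ((v - x) * p v) with p z =
    (z - am) * (z - ap). It vanishes at both end points, so that no boundary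
    term appears. *)
Definition loop_field (x : C) : C := (v - x)^-1 - (x + v - (am%:C + ap%:C)) / pv.

Definition loop_quotient (x y : C) : C := (v - x)^-1 * (v - y)^-1 - pv^-1.

Lemma loop_fieldB x y : v != x -> v != y ->
  loop_field x - loop_field y = (x - y) * loop_quotient x y.
Proof.
rewrite -(subr_eq0 v x) -(subr_eq0 v y) => vx vy; rewrite /loop_field /loop_quotient [RHS]mulrBr.
set P := pv^-1; have -> : (x - y) * ((v - x)^-1 * (v - y)^-1) = (v - x)^-1 - (v - y)^-1.
  by field; rewrite vx vy.
by ring.
Qed.

Lemma loop_field_am : v != am%:C -> v != ap%:C -> loop_field am%:C = 0.
Proof.
rewrite -(subr_eq0 v am%:C) -(subr_eq0 v ap%:C) => va vb; rewrite /loop_field; apply/eqP; rewrite subr_eq0; apply/eqP.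
by field; rewrite va vb.
Qed.

Lemma loop_field_ap : v != am%:C -> v != ap%:C -> loop_field ap%:C = 0.
Proof.
rewrite -(subr_eq0 v am%:C) -(subr_eq0 v ap%:C) => va vb; rewrite /loop_field; apply/eqP; rewrite subr_eq0; apply/eqP.
by field; rewrite va vb.
Qed.

Variable gamma : R -> C.
Hypothesis cg : contour gamma.
Local Notation image := (contour_image gamma).
Variable F : C -> C.
Hypothesis po : positively_oriented gamma.
Hypothesis hF : forall z, image z \/ contour_interior gamma z -> holo F z.

(** With s = am + ap, the kernel p z / ((z - v) * p v) equals (z + v - s) / p
    v + 1 / (z - v). Partial fractions in z then leave multiples of F z, F z
    / (z - x) and F z / (z - v), whose integrals are given by Cauchy's
    theorem and integral formula; the coefficient of F z / (z - x) is -
    loop_field x. *)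
Lemma contour_kernel x : contour_interior gamma x -> ~ image v -> ~ contour_interior gamma v ->
  v != am%:C -> v != ap%:C ->
  contour_integral gamma (fun z => (z - am%:C) * (z - ap%:C) /
    ((z - v) * (v - am%:C) * (v - ap%:C)) * (F z / (z - x))) =
  - (2 * 'i%C * pi%:C * (loop_field x * F x)).
Proof.
move=> ix nv niv; rewrite -!(subr_eq0 v) => va vb.
have nx := contour_interior_off ix.
have xv : x - v != 0 by apply/eqP => /subr0_eq xv; apply: niv; rewrite -xv.
have c0 := cauchy_theorem cg po hF.
have c1 := cauchy_formula cg po hF ix.
have c2 := cauchy_outside cg po hF nv niv.
move: c0 c1 c2; rewrite !contour_integralE => c0 c1 c2.
have mD := @measurable_unit R; have muD := @mu_unit_lty R.
have bF : cbm D (fun t => F (gamma t)) by apply: cbm_comp => // z iz; apply: hF; left.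
have bg := cbm_dgamma cg.
have b0 : cbm D (fun t => F (gamma t) * path_derive gamma t) by exact: cbmM.
have b1 : cbm D (fun t => F (gamma t) / (gamma t - x) * path_derive gamma t).
  by apply: cbmM => //; apply: cbmM => //; exact: cbm_inv.
have b2 : cbm D (fun t => F (gamma t) / (gamma t - v) * path_derive gamma t).
  by apply: cbmM => //; apply: cbmM => //; exact: cbm_inv.
have bZ (c : C) f : cbm D f -> cbm D (fun t => c * f t) by move=> hf; apply: cbmM => //; exact: cbm_cst.
transitivity (CI mu D (fun t => (pv^-1 * (F (gamma t) * path_derive gamma t) +
   - loop_field x * (F (gamma t) / (gamma t - x) * path_derive gamma t)) +
   - (x - v)^-1 * (F (gamma t) / (gamma t - v) * path_derive gamma t))).
  apply: CI_eq => t Dt.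
  have gx : gamma t - x != 0 by apply/eqP => /subr0_eq gx; apply: nx; exists t.
  have gv : gamma t - v != 0 by apply/eqP => /subr0_eq gv; apply: nv; exists t.
  rewrite /loop_field (_ : v - x = - (x - v)); last by rewrite opprB.
  by field; rewrite va vb gv gx xv.
rewrite (CID (mu := mu) mD muD)//; last 2 first.
- by apply: cbmD; apply: bZ.
- exact: bZ.
rewrite (CID (mu := mu) mD muD)//; [|exact: bZ|exact: bZ].
rewrite !(CIZ (mu := mu) mD muD)// c0 c1 c2 !mulr0 add0r addr0.
by rewrite mulNr; congr (- _); ring.
Qed.

End Kernel.

(** * Analytic potentials on the real axis *)

Section RealLine.
Context {R : realType}.
Local Notation C := R[i].
Variables (a b : R) (ab : a < b) (F : C -> C) (M : set C).
Hypothesis hF : forall x, x \in `[a, b] -> holo F x%:C.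
Hypothesis openM : open M.
Hypothesis segM : segment a b `<=` M.
Hypothesis realF : forall x : R, M x%:C -> complex.Im (F x%:C) = 0.

(** The derivative at a real point is a limit of difference quotients along
    the real axis. *)
Lemma real_derive1 x : x \in `[a, b] -> derive1 F x%:C = (complex.Re (derive1 F x%:C))%:C.
Proof.
move=> xab; have [_ [r r0 [K K0 hK]]] := holo_deriv (hF xab).
have Mx : M x%:C by apply: segM; exists x.
have := openM; rewrite openE => /(_ _ Mx); rewrite /interior => /nbhs_cabsP[r1 r10 hM].
set l := derive1 F x%:C in hK *.
suff Il : complex.Im l = 0 by apply: complexP; rewrite ?Il.
apply/eqP; rewrite -normr_eq0 eq_le normr_ge0 andbT.
apply/ler_addgt0Pl => e e0; rewrite addr0.
pose k : R := Num.min (Num.min r r1) (e / (K + 1)) / 2.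
have K1 : 0 < K + 1 by rewrite ltr_wpDl.
have m0 : 0 < Num.min (Num.min r r1) (e / (K + 1)) by rewrite !lt_min r0 r10 divr_gt0.
have k0 : 0 < k by rewrite divr_gt0.
have : k < Num.min (Num.min r r1) (e / (K + 1)) by rewrite ltr_pdivrMr// ltr_pMr// ltr1n.
rewrite !lt_min => /andP[/andP[kr kr1] ke].
have ck : cabs k%:C = k by rewrite cabs_real gtr0_norm.
have h : cabs (F (x%:C + k%:C) - F x%:C - k%:C * l) <= K * k ^+ 2.
  by rewrite -{3}ck; apply: hK; rewrite ?subrr ?cabs0// addrAC subrr add0r ck.
have Mxk : M (x%:C + k%:C) by apply: hM; rewrite addrAC subrr add0r ck.
have -> : `|complex.Im l| = `|complex.Im (F (x%:C + k%:C) - F x%:C - k%:C * l)| / k.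
  rewrite !ImD !ImN -(rmorphD (real_complex R)) realF ?rmorphD//= realF// ImM /= mul0r addr0.
  by rewrite subrr add0r normrN normrM (gtr0_norm k0) mulrAC mulfV ?gt_eqF// mul1r.
rewrite ler_pdivrMr// (le_trans (Im_le_cabs _))// (le_trans h)//.
rewrite expr2 mulrA ler_wpM2r ?(ltW k0)//.
move: ke; rewrite ltr_pdivlMr// mulrDr mulr1 mulrC; have := ltW k0; lra.
Qed.

(** The values outside [a, b] are discarded because measurability is known
    only where G is continuous. *)
Definition restricted_real (G : C -> C) : R -> R :=
  (fun x => complex.Re (G x%:C)) \_ `[a, b]%classic.

Lemma restricted_realE G x : x \in `[a, b] -> restricted_real G x = complex.Re (G x%:C).
Proof. by move=> xab; rewrite /restricted_real patchE mem_set. Qed.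

Lemma measurable_restricted_real (G : C -> C) : (forall x, x \in `[a, b] -> holo G x%:C) ->
  measurable_fun setT (restricted_real G).
Proof.
move=> hG; apply/(measurable_restrictT _ _).1; first exact: measurable_itv.
apply: subspace_continuous_measurable_fun; first exact: measurable_itv.
apply: continuous_in_subspaceT => x /set_mem /= xab.
have h1 : (fun y : R => y%:C) @ nbhs x --> x%:C.
  apply/cvg_cabsP => e e0; exists e => //= y /= xy.
  by rewrite -rmorphB cabs_real distrC.
have h2 := holo_continuous_at (hG x xab).
exact: (cvg_comp _ _ (cvg_comp _ _ h1 h2) (@continuous_Re R (G x%:C))).
Qed.

Let bound_split (t k c m n : R) : t + k + c + 1 < m -> m <= n -> 0 < t -> 0 <= k -> 0 <= c ->
  [/\ t <= n, k <= n & c + 1 <= n].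
Proof. by move=> *; split; lra. Qed.

(** The local estimates of [holo_deriv] become uniform by compactness of [a,
    b]. *)
Lemma uniform_expansion : exists2 K : R, 0 <= K & exists2 e : R, 0 < e &
  (forall x, x \in `[a, b] -> cabs (derive1 F x%:C) <= K) /\
  (forall x k, x \in `[a, b] -> `|k| < e ->
    cabs (F (x + k)%:C - F x%:C - k%:C * derive1 F x%:C) <= K * k ^+ 2).
Proof.
have cpt : compact `[a, b]%classic := @segment_compact R a b.
have := cpt => /compact_near_coveringP /near_covering_withinP.
pose Q (n : nat) (x : R) := cabs (derive1 F x%:C) <= n%:R /\ forall k : R, `|k| < n.+1%:R^-1 ->
    cabs (F (x + k)%:C - F x%:C - k%:C * derive1 F x%:C) <= n%:R * k ^+ 2.
move=> /(_ nat \oo Q _) [].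
  move=> x xab; have [hF' [r r0 [K K0 hK]]] := holo_deriv (hF xab).
  have := holo_continuous_at hF' => /cvg_cabsP/(_ 1 ltr01)/nbhs_cabsP[r1 r10 h1].
  pose n0 := (Num.bound ((2 / r) + K + cabs (derive1 F x%:C) + 1)).
  have n0b : (2 / r) + K + cabs (derive1 F x%:C) + 1 < n0%:R.
    by apply: archi_boundP; rewrite !addr_ge0 ?cabs_ge0// divr_ge0// ltW.
  have r20 : 0 < 2 / r by rewrite divr_gt0.
  exists (ball x (Num.min (r / 2) r1), [set n | (n0 <= n)%N]) => /=.
    split; first by apply: nbhsx_ballx; rewrite lt_min r10 divr_gt0.
    by exists n0.
  move=> [y n] /= [xy n0n] yab.
  have n0n' : n0%:R <= n%:R :> R by rewrite ler_nat.
  have [rn Kn cn] := bound_split n0b n0n' r20 K0 (cabs_ge0 _).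
  move: xy; rewrite /ball /= lt_min => /andP[xy1 xy2].
  have cyx : cabs (y%:C - x%:C) = `|x - y| by rewrite -rmorphB cabs_real distrC.
  split.
    have := h1 y%:C; rewrite cyx => /(_ xy2) => h2.
    apply: le_trans cn; rewrite -lerBlDl (le_trans (cabs_sub_le _ _))//; exact: ltW.
  move=> k kn; rewrite rmorphD.
  have kr : `|k| < r / 2.
    rewrite (lt_le_trans kn)// -[r / 2]invrK lef_pV2 ?posrE// ?invr_gt0 ?divr_gt0//.
    by rewrite invf_div; apply: (le_trans rn); rewrite ler_nat.
  apply: le_trans (hK _ _ _ _) _.
  - by rewrite cyx (lt_le_trans xy1)// ler_pdivrMr// ler_peMr ?ltW// ltr1n.
  - by rewrite addrAC (le_lt_trans (cabsD _ _))// cyx cabs_real [r]splitr ltrD.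
  - by rewrite [cabs _]cabs_real real_normK ?num_real// ler_wpM2r ?sqr_ge0.
move=> n _ h; have /h {h} h := leqnn n.
exists n%:R => //; exists n.+1%:R^-1; rewrite ?invr_gt0//; split.
  by move=> x /h[].
by move=> x k /h[_]; exact.
Qed.

Lemma C11_restricted : C11_on a b (restricted_real F) (restricted_real (derive1 F)).
Proof.
split; first exact: measurable_restricted_real.
  by apply: measurable_restricted_real => x /hF/holo_deriv[].
have [K K0 [e e0 [h1 h2]]] := uniform_expansion.
exists K => //; exists e => //; split.
  by move=> x xab; rewrite restricted_realE// (le_trans (Re_le_cabs _))// h1.
move=> x k xab xkab ke; rewrite !restricted_realE//.
apply: le_trans (h2 x k xab ke); apply: le_trans (Re_le_cabs _).
by rewrite !ReD !ReN ReM /= mul0r subr0.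
Qed.

End RealLine.

(** * Expectations under contour integrals *)

Section Swap.
Context {R : realType} d1 d2 (T1 : measurableType d1) (T2 : measurableType d2).
Local Notation C := R[i].
Variables (m1 : {sigma_finite_measure set T1 -> \bar R}) (m2 : {sigma_finite_measure set T2 -> \bar R}).
Variables (D1 : set T1) (D2 : set T2).
Hypotheses (mD1 : measurable D1) (mD2 : measurable D2).
Hypotheses (fD1 : (m1 D1 < +oo)%E) (fD2 : (m2 D2 < +oo)%E).

Lemma measurable_fun_section1 (f : T1 * T2 -> R) x : D1 x ->
  measurable_fun (D1 `*` D2) f -> measurable_fun D2 (fun y => f (x, y)).
Proof.
move=> D1x mf; apply: (measurable_comp (measurableX mD1 mD2) _ mf) => //.
  by move=> _ [y D2y <-].
by apply: measurable_funTS; exact: measurable_pair1.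
Qed.

Lemma measurable_fun_section2 (f : T1 * T2 -> R) y : D2 y ->
  measurable_fun (D1 `*` D2) f -> measurable_fun D1 (fun x => f (x, y)).
Proof.
move=> D2y mf; apply: (measurable_comp (measurableX mD1 mD2) _ mf) => //.
  by move=> _ [x D1x <-].
by apply: measurable_funTS; exact: measurable_pair2.
Qed.

Lemma Rintegral_swap (f : T1 * T2 -> R) B : measurable_fun (D1 `*` D2) f ->
  (forall x y, D1 x -> D2 y -> `|f (x, y)| <= B) ->
  \int[m1]_(x in D1) \int[m2]_(y in D2) f (x, y) =
  \int[m2]_(y in D2) \int[m1]_(x in D1) f (x, y).
Proof.
move=> mf fB.
have bint d (T : measurableType d) (m : {measure set T -> \bar R}) (A : set T) (g : T -> R) :
    measurable A -> (m A < +oo)%E -> measurable_fun A g -> (forall x, A x -> `|g x| <= B) ->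
    m.-integrable A (EFin \o g).
  move=> mA fA mg gB; apply: measurable_bounded_integrable => //.
  exists B; split; rewrite ?num_real// => M BM x Ax /=.
  by rewrite (le_trans (gB _ Ax))// ltW.
have mDD := measurableX mD1 mD2.
have i12 : (m1 \x m2)%E.-integrable setT ((EFin \o f) \_ (D1 `*` D2)).
  apply/(integrable_mkcond _ mDD); apply: bint => //.
    by rewrite [X in (X < _)%E]product_measure1E// lte_mul_pinfty// ge0_fin_numE.
  by move=> [x y] /= [? ?]; exact: fB.
have in2 x : D1 x -> (\int[m2]_(y in D2) f (x, y))%:E = (\int[m2]_(y in D2) (f (x, y))%:E)%E.
  move=> D1x; rewrite /Rintegral fineK//; apply: integrable_fin_num => //.
  apply: (bint _ _ m2 D2 (fun y => f (x, y))) => //; last by move=> y; exact: fB.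
  exact: measurable_fun_section1.
have in1 y : D2 y -> (\int[m1]_(x in D1) f (x, y))%:E = (\int[m1]_(x in D1) (f (x, y))%:E)%E.
  move=> D2y; rewrite /Rintegral fineK//; apply: integrable_fin_num => //.
  apply: (bint _ _ m1 D1 (fun x => f (x, y))) => //; last by move=> x D1x; exact: fB.
  exact: measurable_fun_section2.
rewrite /Rintegral; congr fine.
transitivity (\int[m1]_x \int[m2]_y ((EFin \o f) \_ (D1 `*` D2)) (x, y))%E.
  rewrite [LHS]integral_mkcond; apply: eq_integral => x _; rewrite patchE.
  case: ifPn => [/set_mem D1x|/negP D1x].
    rewrite in2// integral_mkcond; apply: eq_integral => y _; rewrite !patchE in_setX.
    by rewrite /= [x \in D1]mem_set.
  rewrite integral0_eq// => y _; rewrite patchE in_setX.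
  by move/negP/negbTE : D1x => ->.
rewrite (Fubini i12).
rewrite [RHS]integral_mkcond; apply: eq_integral => y _; rewrite patchE.
case: ifPn => [/set_mem D2y|/negP D2y].
  rewrite in1// [RHS]integral_mkcond; apply: eq_integral => x _; rewrite !patchE in_setX.
  by rewrite [y \in D2]mem_set// andbT.
rewrite integral0_eq// => x _; rewrite patchE in_setX.
by move/negP/negbTE : D2y => ->; rewrite andbF.
Qed.

(** Fubini's theorem for a function cut off to the rectangle, on which it is
    bounded. *)
Lemma CI_swap (H : T1 * T2 -> C) : cbm (D1 `*` D2) H ->
  CI m1 D1 (fun x => CI m2 D2 (fun y => H (x, y))) =
  CI m2 D2 (fun y => CI m1 D1 (fun x => H (x, y))).
Proof.
move=> [[h1 h2] [B hB]]; congr (_ +i* _).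
  apply: (@Rintegral_swap _ B h1) => x y D1x D2y.
  by apply: le_trans (Re_le_cabs _) _; exact: hB.
apply: (@Rintegral_swap _ B h2) => x y D1x D2y.
by apply: le_trans (Im_le_cabs _) _; exact: hB.
Qed.

Lemma cmeas_fst (f : T1 -> C) : cmeas D1 f -> cmeas (D1 `*` D2) (fun p => f p.1).
Proof.
move=> [h1 h2]; split.
  apply: (measurable_comp mD1 _ h1) => //; first by move=> _ [[x y] [? ?] <-].
  by apply: measurable_funTS; exact: measurable_fst.
apply: (measurable_comp mD1 _ h2) => //; first by move=> _ [[x y] [? ?] <-].
by apply: measurable_funTS; exact: measurable_fst.
Qed.

Lemma cmeas_snd (f : T2 -> C) : cmeas D2 f -> cmeas (D1 `*` D2) (fun p => f p.2).
Proof.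
move=> [h1 h2]; split.
  apply: (measurable_comp mD2 _ h1) => //; first by move=> _ [[x y] [? ?] <-].
  by apply: measurable_funTS; exact: measurable_snd.
apply: (measurable_comp mD2 _ h2) => //; first by move=> _ [[x y] [? ?] <-].
by apply: measurable_funTS; exact: measurable_snd.
Qed.

End Swap.

(** A positive distance from each point of a compact interval to A is bounded
    below over the interval. *)
Lemma uniform_distance {R : realType} (a b : R) (A : set R[i]) :
  (forall x : R, x \in `[a, b] -> exists2 e : R, 0 < e & forall z, A z -> e <= cabs (z - x%:C)) ->
  exists2 e : R, 0 < e & forall (x : R) z, x \in `[a, b] -> A z -> e <= cabs (z - x%:C).
Proof.
move=> hA; have := @segment_compact R a b => /compact_near_coveringP /near_covering_withinP.
pose Q (n : nat) (x : R) := forall z, A z -> n.+1%:R^-1 <= cabs (z - x%:C).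
move=> /(_ nat \oo Q _) [].
  move=> x xab; have [e e0 he] := hA x xab.
  pose n0 := Num.bound (2 / e).
  have n0b : 2 / e < n0%:R by apply: archi_boundP; rewrite divr_ge0// ltW.
  have e20 : 0 < e / 2 by rewrite divr_gt0.
  exists (ball x (e / 2), [set n | (n0 <= n)%N]) => /=.
    by split; [exact: nbhsx_ballx|exists n0].
  move=> [y n] /= [xy n0n] yab z Az.
  apply: (@le_trans _ _ (e / 2)).
    rewrite -[leRHS]invrK lef_pV2 ?posrE ?invr_gt0// invf_div (le_trans (ltW n0b))// ler_nat.
    exact: leqW.
  have := he z Az; have := cabsD (z - y%:C) (y%:C - x%:C).
  rewrite addrA subrK => t1 t2; have := le_trans t2 t1; rewrite -rmorphB cabs_real -lerBlDr.
  apply: le_trans; rewrite {2}[e]splitr -addrA lerDl subr_ge0 distrC; exact: ltW.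
move=> n _ h; have /h {h} h := leqnn n.
by exists n.+1%:R^-1 => [|x z /h]; [rewrite invr_gt0|exact].
Qed.

Lemma point_distance {R : realType} (a b : R) (v : R[i]) :
  (forall x : R, x \in `[a, b] -> v != x%:C) ->
  exists2 e : R, 0 < e & forall x : R, x \in `[a, b] -> e <= cabs (v - x%:C).
Proof.
move=> vab; have [e e0 he] : exists2 e : R, 0 < e &
    forall (x : R) z, x \in `[a, b] -> [set v] z -> e <= cabs (z - x%:C).
  apply: uniform_distance => x xab; exists (cabs (v - x%:C)); last by move=> z ->.
  by rewrite cabs_gt0 subr_eq0 vab.
by exists e => // x xab; exact: he.
Qed.

Lemma cabs_shift {R : realType} (u x k : R[i]) (r : R) :
  r <= cabs (u - x) -> cabs k <= r / 2 -> r / 2 <= cabs (k + u - x).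
Proof.
have := cabs_sub_le (u - x) (- k).
rewrite cabsN opprK (_ : u - x + k = k + u - x); last by ring.
by move=> h ur kr; apply: le_trans h; lra.
Qed.

Section Expectation.
Context {R : realType} d (T : measurableType d) (P : probability T R).
Local Notation C := R[i].
Local Notation leb := (@lebesgue_measure R).
Variable D : set T.
Hypotheses (mD : measurable D) (PD : P D = 1%E).

Lemma support_lty : (P D < +oo)%E. Proof. by rewrite PD ltry. Qed.

(** Stieltjes transforms are bounded only when the configuration stays in [a,
    b]. Discarding a null set of outcomes makes every integrand bounded. *)
Lemma Cexpectation_support (Z : T -> C) : cmeas setT Z -> Cexpectation P Z = CI P D Z.
Proof.
move=> [m1 m2].
have h (f : T -> R) : measurable_fun setT f -> fine ('E_P[f])%E = \int[P]_(w in D) f w.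
  move=> mf; rewrite unlock /Rintegral; congr fine.
  rewrite [RHS]integral_mkcond; apply: ae_eq_integral => //.
  - exact/measurable_EFinP.
  - by apply/(measurable_restrictT _ _).1 => //; apply: measurable_funTS; exact/measurable_EFinP.
  exists (~` D); split; first exact: measurableC.
    by have := probability_setC P mD; rewrite PD subee// => h; exact: h.
  by move=> w /= /not_implyP[_]; rewrite patchE; case: ifPn => // /negP Dw _ /mem_set.
by rewrite /Cexpectation !h.
Qed.

Variables (a b : R) (n : nat) (W : T -> n.-tuple R).
Hypothesis mW : measurable_fun setT W.
Hypothesis WD : forall w, D w -> in_box a b (W w).

Let mWi i : measurable_fun setT (fun w => tnth (W w) i).
Proof. exact: measurableT_comp (measurable_tnth i) mW. Qed.

Lemma cmeas_point A i : cmeas A (fun w => (tnth (W w) i)%:C).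
Proof. by apply: cmeas_real; apply: measurable_funTS; exact: mWi. Qed.

Lemma cmeas_stieltjes A u : cmeas A (fun w => stieltjes_sum (W w) u).
Proof.
apply: cmeas_sum => i; apply: cmeasV; apply: cmeasB; first exact: cmeas_cst.
exact: cmeas_point.
Qed.

Section Far.
Variables (u : C) (r : R).
Hypothesis r0 : 0 < r.
Hypothesis far : forall x : R, x \in `[a, b] -> r <= cabs (u - x%:C).

Lemma cbm_resolvent i : cbm D (fun w => (u - (tnth (W w) i)%:C)^-1).
Proof.
apply: (cbmV r0); first by move=> w Dw; apply: far; exact: WD.
by apply: cmeasB; [exact: cmeas_cst|exact: cmeas_point].
Qed.

Lemma cbm_stieltjes : cbm D (fun w => stieltjes_sum (W w) u).
Proof. by apply: cbm_sum => i; exact: cbm_resolvent. Qed.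

End Far.

Lemma resolvent_expansion (u x k : C) (r : R) : 0 < r -> r <= cabs (u - x) -> cabs k <= r / 2 ->
  cabs ((k + u - x)^-1 - (u - x)^-1 + k * (u - x)^-1 ^+ 2) <= 2 / r ^+ 3 * cabs k ^+ 2.
Proof.
move=> r0 ur kr.
have kur := cabs_shift ur kr.
have ux0 : u - x != 0 by rewrite -cabs_gt0 (lt_le_trans r0).
have kx0 : k + u - x != 0 by rewrite -cabs_gt0 (lt_le_trans _ kur)// divr_gt0.
have -> : (k + u - x)^-1 - (u - x)^-1 + k * (u - x)^-1 ^+ 2 =
    k ^+ 2 * ((k + u - x)^-1 * (u - x)^-1 ^+ 2).
  by field; rewrite ux0 kx0.
rewrite cabsM cabsX mulrC ler_wpM2r ?sqr_ge0// cabsM cabsX !cabsV.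
have -> : 2 / r ^+ 3 = (r / 2)^-1 * r^-1 ^+ 2 by field; rewrite gt_eqF.
rewrite ler_pM ?invr_ge0 ?cabs_ge0 ?sqr_ge0//.
  by rewrite lef_pV2 ?posrE ?(lt_le_trans _ kur) ?divr_gt0.
by rewrite lerXn2r ?nnegrE ?invr_ge0 ?cabs_ge0 ?(ltW r0)// lef_pV2 ?posrE ?(lt_le_trans r0).
Qed.

(** The second-order remainder of the resolvent is uniform in x as long as u
    stays away from [a, b], hence can be integrated. *)
Lemma derive_stieltjes (v : C) (r : R) : 0 < r ->
  (forall x : R, x \in `[a, b] -> r <= cabs (v - x%:C)) ->
  derive1 (fun u => Cexpectation P (fun w => stieltjes_sum (W w) u)) v =
  - CI P D (fun w => \sum_(i < n) (v - (tnth (W w) i)%:C)^-1 ^+ 2).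
Proof.
move=> r0 far.
have bR i := cbm_resolvent r0 far i.
have bS : cbm D (fun w => \sum_(i < n) (v - (tnth (W w) i)%:C)^-1 ^+ 2).
  by apply: cbm_sum => i; exact: cbmX.
apply: derive1_cabs => e e0.
pose K : R := n%:R * (2 / r ^+ 3); have K0 : 0 <= K by rewrite mulr_ge0// divr_ge0// exprn_ge0// ltW.
have K1 : 0 < 2 * K + 1 by rewrite ltr_wpDl// mulr_ge0.
exists (Num.min (r / 2) (e / (2 * K + 1))); first by rewrite lt_min !divr_gt0.
move=> k k0; rewrite lt_min => /andP[kr ke].
have r20 : 0 < r / 2 by rewrite divr_gt0.
have far' x : x \in `[a, b] -> r / 2 <= cabs (k + v - x%:C).
  by move=> xab; apply: cabs_shift; [exact: far|exact: ltW].
rewrite !Cexpectation_support; [|exact: cmeas_stieltjes|exact: cmeas_stieltjes].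
have bk := cbm_stieltjes r20 far'; have bv := cbm_stieltjes r0 far.
have bkS : cbm D (fun w => k * \sum_(i < n) (v - (tnth (W w) i)%:C)^-1 ^+ 2).
  by apply: cbmM => //; exact: cbm_cst.
rewrite mulNr opprK (mulrC _ k) -(CIZ (mu := P) mD support_lty)// -(CIB (mu := P) mD support_lty)//.
rewrite -(CID (mu := P) mD support_lty)//; last exact: cbmB.
have bb := cbmD (cbmB bk bv) bkS.
apply: le_trans (@CI_le _ _ _ P _ mD support_lty _ set0 (K * cabs k ^+ 2) measurable0 (measure0 _) bb.1 _ _) _.
- by rewrite mulr_ge0// sqr_ge0.
- move=> w Dw _; rewrite /stieltjes_sum mulr_sumr -sumrB -big_split /=.
  rewrite (le_trans (cabs_sum _))//.
  apply: (@le_trans _ _ (\sum_(i < n) 2 / r ^+ 3 * cabs k ^+ 2)).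
    apply: ler_sum => i _; apply: resolvent_expansion => //; last exact: ltW.
    by apply: far; exact: WD.
  by rewrite sumr_const card_ord /K -[leLHS]mulr_natl mulrA.
set p := fine _; have -> : p = 1 by exact: (congr1 fine PD).
rewrite mulr1 (_ : 2 * _ = 2 * K * cabs k * cabs k); last by ring.
rewrite ler_wpM2r ?cabs_ge0//.
move: ke; rewrite ltr_pdivlMr// mulrDr mulr1 => ke.
have := cabs_ge0 k; rewrite mulrC; lra.
Qed.

End Expectation.

Section ContourExpectation.
Context {R : realType} d (T : measurableType d) (P : probability T R).
Local Notation C := R[i].
Local Notation leb := (@lebesgue_measure R).
Local Notation U := (`[0 : R, 1]%classic).
Variable D : set T.
Hypotheses (mD : measurable D) (PD : P D = 1%E).
Variables (a b : R) (n m : nat) (X : T -> n.-tuple R) (Y : T -> m.-tuple R).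
Hypotheses (mX : measurable_fun setT X) (mY : measurable_fun setT Y).
Hypothesis XD : forall w, D w -> in_box a b (X w).
Hypothesis YD : forall w, D w -> in_box a b (Y w).
Variable gamma : R -> C.
Hypothesis cg : contour gamma.
Local Notation image := (contour_image gamma).
Variables (F G : C -> C) (v : C).
Hypothesis po : positively_oriented gamma.
Hypothesis hF : forall z, image z \/ contour_interior gamma z -> holo F z.
Hypothesis hG : forall z, image z \/ contour_interior gamma z -> holo G z.
Hypothesis seg : forall x, x \in `[a, b] -> contour_interior gamma x%:C.
Hypotheses (nv : ~ image v) (niv : ~ contour_interior gamma v).
Hypotheses (va : v != a%:C) (vb : v != b%:C).
Local Notation ker z := ((z - a%:C) * (z - b%:C) / ((z - v) * (v - a%:C) * (v - b%:C))).
Local Notation field := (loop_field a b v).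

Let mU := @measurable_unit R.
Let fU := @mu_unit_lty R.
Let fD : (P D < +oo)%E := support_lty PD.

Lemma cbm_kernel (H : C -> C) : (forall z, image z \/ contour_interior gamma z -> holo H z) ->
  cbm U (fun t => ker (gamma t) * H (gamma t) * path_derive gamma t).
Proof.
move=> hH; apply: cbmM; last exact: cbm_dgamma.
apply: cbmM; last by apply: cbm_comp => // z iz; apply: hH; left.
have bg := cbm_gamma cg.
apply: cbmM; first by apply: cbmM; apply: cbmB => //; exact: cbm_cst.
rewrite (_ : (fun t => _) = (fun t => (gamma t - v)^-1 * ((v - a%:C) * (v - b%:C))^-1)); last first.
  by apply/funext => t; rewrite -mulrA invfM.
by apply: cbmM; [exact: cbm_inv|exact: cbm_cst].
Qed.

Lemma cbm_joint (H : C -> C) k (W : T -> k.-tuple R) :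
  (forall z, image z \/ contour_interior gamma z -> holo H z) ->
  measurable_fun setT W -> (forall w, D w -> in_box a b (W w)) ->
  cbm (U `*` D) (fun p => ker (gamma p.1) * H (gamma p.1) * path_derive gamma p.1 *
    stieltjes_sum (W p.2) (gamma p.1)).
Proof.
move=> hH mW WD.
have [e e0 he] : exists2 e : R, 0 < e &
    forall (x : R) z, x \in `[a, b] -> image z -> e <= cabs (z - x%:C).
  apply: uniform_distance => x xab; have [e e0 he] := contour_far cg (contour_interior_off (seg xab)).
  by exists e => // _ [t Dt <-]; exact: he.
have lift (f : R -> C) : cbm U f -> cbm (U `*` D) (fun p => f p.1).
  move=> [mf [B hB]]; split; first exact: cmeas_fst.
  by exists B => -[t w] [Ut _]; exact: hB.
apply: cbmM; first exact: (lift _ (cbm_kernel hH)).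
apply: cbm_sum => i; apply: (cbmV e0).
  move=> [t w] [/= Ut Dw]; apply: he; first exact: WD.
  by exists t.
apply: cmeasB; first exact: (lift _ (cbm_gamma cg)).1.
apply: (@cmeas_snd _ _ _ _ _ U D mD (fun w => (tnth (W w) i)%:C)).
exact: cmeas_point.
Qed.

Lemma contour_stieltjes_pointwise (H : C -> C) k (t : k.-tuple R) :
  (forall z, image z \/ contour_interior gamma z -> holo H z) -> in_box a b t ->
  CI leb U (fun s => ker (gamma s) * H (gamma s) * path_derive gamma s * stieltjes_sum t (gamma s)) =
  - (2 * 'i%C * pi%:C * \sum_(i < k) field (tnth t i)%:C * H (tnth t i)%:C) /\
  cbm U (fun s => ker (gamma s) * H (gamma s) * path_derive gamma s * stieltjes_sum t (gamma s)).
Proof.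
move=> hH tb.
have bi i : cbm U (fun s => ker (gamma s) * H (gamma s) * path_derive gamma s *
    (gamma s - (tnth t i)%:C)^-1).
  apply: cbmM; first exact: cbm_kernel.
  by apply: cbm_inv => //; apply: contour_interior_off; apply: seg; exact: tb.
have E : (fun s => ker (gamma s) * H (gamma s) * path_derive gamma s * stieltjes_sum t (gamma s)) =
    (fun s => \sum_(i < k) ker (gamma s) * H (gamma s) * path_derive gamma s *
    (gamma s - (tnth t i)%:C)^-1).
  by apply/funext => s; rewrite mulr_sumr.
rewrite E; split; last exact: cbm_sum.
rewrite (CI_sum (mu := leb) mU fU)// mulr_sumr -sumrN; apply: eq_bigr => i _.
rewrite -(contour_kernel cg po hH (seg (tb i)) nv niv va vb) contour_integralE.
by apply: CI_eq => s _; ring.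
Qed.

Variables (f g : R -> R) (Kf Kg : R).
Hypotheses (mf : measurable_fun setT f) (mg : measurable_fun setT g).
Hypotheses (fK : forall x, x \in `[a, b] -> `|f x| <= Kf).
Hypotheses (gK : forall x, x \in `[a, b] -> `|g x| <= Kg).
Hypothesis Ff : forall x, x \in `[a, b] -> F x%:C = (f x)%:C.
Hypothesis Gg : forall x, x \in `[a, b] -> G x%:C = (g x)%:C.

Definition field_sum (h : R -> R) k (t : k.-tuple R) : C :=
  \sum_(i < k) field (tnth t i)%:C * (h (tnth t i))%:C.

Lemma cbm_field_sum (h : R -> R) (K : R) k (W : T -> k.-tuple R) : measurable_fun setT h ->
  (forall x, x \in `[a, b] -> `|h x| <= K) ->
  measurable_fun setT W -> (forall w, D w -> in_box a b (W w)) ->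
  cbm D (fun w => field_sum h (W w)).
Proof.
move=> mh hK mW WD.
have [e e0 he] : exists2 e : R, 0 < e & forall x : R, x \in `[a, b] -> e <= cabs (v - x%:C).
  by apply: point_distance => x xab; apply/eqP => vx; apply: niv; rewrite vx; exact: seg.
have bx i : cbm D (fun w => (tnth (W w) i)%:C).
  split; first exact: cmeas_point.
  exists (`|a| + `|b|) => w Dw; have := WD w Dw i; rewrite in_itv /= cabs_real => /andP[ax xb].
  rewrite ler_norml; have := ler_norm b; have := ler_norm (- a); rewrite normrN.
  have := normr_ge0 a; have := normr_ge0 b; move=> *; apply/andP; split; lra.
apply: cbm_sum => i; apply: cbmM; last first.
  split.
    by apply: cmeas_real; apply: measurable_funTS; apply: measurableT_comp => //;
      exact: measurableT_comp (measurable_tnth i) mW.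
  by exists K => w Dw; rewrite cabs_real; apply: hK; exact: WD.
apply: cbmB.
  by apply: (@cbm_resolvent _ _ _ D a b _ W mW WD v e e0) => x xab; exact: he.
apply: cbmM; last exact: cbm_cst.
by apply: cbmB; [apply: cbmD => //; exact: cbm_cst|exact: cbm_cst].
Qed.

(** Expectation and contour integral are exchanged, and [contour_kernel] is
    applied at each coordinate of the configuration. *)
Lemma contour_stieltjes :
  contour_integral gamma (fun z => ker z *
    (Cexpectation P (fun w => stieltjes_sum (X w) z) * F z +
     Cexpectation P (fun w => stieltjes_sum (Y w) z) * G z)) =
  - (2 * 'i%C * pi%:C * CI P D (fun w => field_sum f (X w) + field_sum g (Y w))).
Proof.
have jX := cbm_joint hF mX XD; have jY := cbm_joint hG mY YD.
rewrite contour_integralE.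
have bS t k (W : T -> k.-tuple R) : U t -> measurable_fun setT W -> (forall w, D w -> in_box a b (W w)) ->
    cbm D (fun w => stieltjes_sum (W w) (gamma t)).
  move=> Ut mW WD.
  have [e e0 he] : exists2 e : R, 0 < e & forall x : R, x \in `[a, b] -> e <= cabs (gamma t - x%:C).
    by apply: point_distance => x /seg/contour_interior_off nx; apply/eqP => tx; apply: nx; exists t.
  exact: (@cbm_stieltjes _ _ _ D a b _ W mW WD (gamma t) e e0).
transitivity (CI leb U (fun t => CI P D (fun w =>
   ker (gamma t) * F (gamma t) * path_derive gamma t * stieltjes_sum (X w) (gamma t) +
   ker (gamma t) * G (gamma t) * path_derive gamma t * stieltjes_sum (Y w) (gamma t)))).
  apply: CI_eq => t Ut.
  rewrite !(Cexpectation_support mD PD); [|exact: cmeas_stieltjes|exact: cmeas_stieltjes].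
  have bX := bS t _ X Ut mX XD; have bY := bS t _ Y Ut mY YD.
  rewrite (CID (mu := P) mD fD); [|by apply: cbmM => //; exact: cbm_cst..].
  rewrite !(CIZ (mu := P) mD fD)//; ring.
rewrite (@CI_swap _ _ _ _ _ leb P U D mU mD fU fD (fun p =>
   ker (gamma p.1) * F (gamma p.1) * path_derive gamma p.1 * stieltjes_sum (X p.2) (gamma p.1) +
   ker (gamma p.1) * G (gamma p.1) * path_derive gamma p.1 * stieltjes_sum (Y p.2) (gamma p.1))); last exact: cbmD.
transitivity (CI P D (fun w => - (2 * 'i%C * pi%:C) * (field_sum f (X w) + field_sum g (Y w)))).
  apply: CI_eq => w Dw.
  have [eX bX] := contour_stieltjes_pointwise hF (XD Dw).
  have [eY bY] := contour_stieltjes_pointwise hG (YD Dw).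
  rewrite (CID (mu := leb) mU fU)// eX eY mulrDr !mulNr /field_sum; congr (- (_ * _) - _ * _).
    by apply: eq_bigr => i _; rewrite Ff//; exact: XD.
  by apply: eq_bigr => i _; rewrite Gg//; exact: YD.
have bX := cbm_field_sum mf fK mX XD; have bY := cbm_field_sum mg gK mY YD.
by rewrite (CIZ (mu := P) mD fD) ?mulNr//; exact: cbmD.
Qed.

End ContourExpectation.

(** * The loop equation of the rational vector field *)

Section PairSums.
Context {R : realType}.
Local Notation C := R[i].

Lemma pair_sum n (u : 'I_n -> C) :
  \sum_(i < n) \sum_(j < n | (i < j)%N) u j * u i =
  ((\sum_(i < n) u i) ^+ 2 - \sum_(i < n) u i ^+ 2) / 2.
Proof.
elim: n u => [|n ih] u; first by rewrite !big_ord0 expr0n subrr mul0r.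
rewrite 3!big_ord_recl (eq_bigr (fun i : 'I_n => \sum_(j < n | (i < j)%N) u (lift ord0 j) * u (lift ord0 i))); last first.
  move=> i _; rewrite big_mkcond big_ord_recl /= add0r [RHS]big_mkcond /=.
  by apply: eq_bigr => j _; rewrite /bump !leq0n !add1n ltnS.
rewrite (ih (fun i => u (lift ord0 i))).
rewrite big_mkcond big_ord_recl /= add0r (eq_bigr (fun i => u (lift ord0 i) * u ord0)); last first.
  by move=> i _.
rewrite -mulr_suml; set s := \sum_(i < n) u _; set t := \sum_(i < n) _ ^+ 2.
by field.
Qed.

Lemma pair_sum_cst n (c : C) :
  \sum_(i < n) \sum_(j < n | (i < j)%N) c = n%:R * (n%:R - 1) / 2 * c.
Proof.
have := @pair_sum n (fun=> 1); rewrite (eq_bigr (fun i : 'I_n => \sum_(j < n | (i < j)%N) 1)); last first.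
  by move=> i _; apply: eq_bigr => j _; rewrite mulr1.
rewrite [X in X ^+ 2]sumr_const [X in _ - X](eq_bigr (fun=> 1)); last by move=> i _; rewrite expr1n.
rewrite sumr_const card_ord => h.
transitivity (c * \sum_(i < n) \sum_(j < n | (i < j)%N) 1).
  by rewrite mulr_sumr; apply: eq_bigr => i _; rewrite mulr_sumr; apply: eq_bigr => j _; rewrite mulr1.
by rewrite h; field.
Qed.

End PairSums.

Section MoreDerivatives.
Context {R : realType}.
Local Notation C := R[i].

Lemma cderD (f g : R -> C) t l m : cder f t l -> cder g t m -> cder (fun s => f s + g s) t (l + m).
Proof.
move=> [f1 f2] [g1 g2]; split.
  have -> : (fun s => complex.Re (f s + g s)) =
      (fun s => complex.Re (f s)) + (fun s => complex.Re (g s)).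
    by apply/funext => s; rewrite ReD.
  by rewrite ReD; exact: is_deriveD.
have -> : (fun s => complex.Im (f s + g s)) =
    (fun s => complex.Im (f s)) + (fun s => complex.Im (g s)).
  by apply/funext => s; rewrite ImD.
by rewrite ImD; exact: is_deriveD.
Qed.

Lemma cder_csub (c : C) (t : R) : cder (fun x : R => c - x%:C) t (-1).
Proof.
split.
  have -> : (fun x : R => complex.Re (c - x%:C)) = cst (complex.Re c) - id.
    by apply/funext => x; rewrite ReD ReN.
  have := @is_deriveB _ _ _ _ _ _ _ _ _ (@is_derive_cst _ _ _ (complex.Re c) t 1) (@is_derive_id _ _ t 1).
  by rewrite sub0r ReN.
have -> : (fun x : R => complex.Im (c - x%:C)) = cst (complex.Im c).
  by apply/funext => x; rewrite ImD ImN /= subr0.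
by rewrite ImN /= oppr0; exact: is_derive_cst.
Qed.

End MoreDerivatives.

Section ComplexLoop.
Context {R : realType}.
Local Notation C := R[i].
Variables (N : nat) (theta a b : R) (v : C).
Local Notation space := (N.-tuple R * N.-1.-tuple R)%type.
Local Notation I := (@interlacing R N a b).
Hypothesis N0 : (0 < N)%N.
Hypothesis theta0 : 0 < theta.
Hypothesis ab : a < b.
Hypothesis vab : forall x : R, x \in `[a, b] -> v != x%:C.
Local Notation pv := ((v - a%:C) * (v - b%:C)).
Local Notation H x := (loop_field a b v x%:C).
Local Notation Q x y := (loop_quotient a b v x%:C y%:C).

Lemma cmeas_loop_field : cmeas setT (fun x : R => H x).
Proof.
have mx : cmeas setT (fun x : R => x%:C) by apply: cmeas_real; exact: measurable_id.
apply: cmeasB; first by apply: cmeasV; apply: cmeasB => //; exact: cmeas_cst.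
apply: cmeasM; last exact: cmeas_cst.
by apply: cmeasB; [apply: cmeasD => //; exact: cmeas_cst|exact: cmeas_cst].
Qed.

Lemma cmeas_loop_quotient : cmeas setT (fun z : R * R => Q z.1 z.2).
Proof.
have m1 : cmeas setT (fun z : R * R => (z.1)%:C) by apply: cmeas_real; exact: measurable_fst.
have m2 : cmeas setT (fun z : R * R => (z.2)%:C) by apply: cmeas_real; exact: measurable_snd.
apply: cmeasB; last exact: cmeas_cst.
by apply: cmeasM; apply: cmeasV; apply: cmeasB => //; exact: cmeas_cst.
Qed.

Lemma loop_quotient_bound : exists2 K : R, 0 <= K &
  forall x y, x \in `[a, b] -> y \in `[a, b] -> cabs (Q x y) <= K.
Proof.
have [e e0 he] := point_distance vab.
exists (e^-1 * e^-1 + cabs pv^-1); first by rewrite addr_ge0 ?cabs_ge0// mulr_ge0 ?invr_ge0 ?ltW.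
have inv x : x \in `[a, b] -> cabs (v - x%:C)^-1 <= e^-1.
  by move=> xab; rewrite cabsV lef_pV2 ?posrE ?(lt_le_trans e0) ?he.
move=> x y xab yab; rewrite (le_trans (cabsB _ _))// lerD2r cabsM.
by rewrite ler_pM ?cabs_ge0 ?inv.
Qed.

Lemma cder_loop_field (t : R) : t \in `[a, b] -> cder (fun x : R => H x) t (Q t t).
Proof.
move=> tab; have vt0 : v - t%:C != 0 by rewrite subr_eq0 vab.
have did c := cder_csub c t.
have d1 := cderV vt0 (did v).
have d2 := cderM (did (a%:C + b%:C - v)) (cder_cst pv^-1 t).
have -> : (fun x : R => H x) = (fun x : R => (v - x%:C)^-1 + (a%:C + b%:C - v - x%:C) * pv^-1).
  by apply/funext => x; rewrite /loop_field; ring.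
have -> : Q t t = - -1 * (v - t%:C)^-1 ^+ 2 + (-1 * pv^-1 + (a%:C + b%:C - v - t%:C) * 0).
  by rewrite /loop_quotient; ring.
exact: cderD.
Qed.

Lemma ccont_loop_quotient (t : R) : t \in `[a, b] -> ccont (fun x : R => Q x x) t.
Proof.
move=> tab; have vt0 : v - t%:C != 0 by rewrite subr_eq0 vab.
have d1 := cderV vt0 (cder_csub v t).
have d2 := cderB_cst pv^-1 (cderM d1 d1).
exact: cder_continuous d2.
Qed.

Definition complex_potential_rate (dU : R -> R) n (t : n.-tuple R) : C :=
  \sum_(i < n) - ((N%:R * theta)%:C * ((dU (tnth t i))%:C * H (tnth t i))).

Definition complex_loop_rate dUt dUb (p : space) : C :=
  \sum_(i < N) \sum_(j < N | (i < j)%N) Q (tnth p.1 j) (tnth p.1 i) +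
  \sum_(i < N.-1) \sum_(j < N.-1 | (i < j)%N) Q (tnth p.2 j) (tnth p.2 i) +
  \sum_(i < N.-1) \sum_(j < N) (theta - 1)%:C * Q (tnth p.2 i) (tnth p.1 j) +
  complex_potential_rate dUb p.2 + complex_potential_rate dUt p.1 +
  (\sum_(i < N) Q (tnth p.1 i) (tnth p.1 i) + \sum_(i < N.-1) Q (tnth p.2 i) (tnth p.2 i)).

Section Law.
Local Notation mu := (@lebesgue_tuple R N \x @lebesgue_tuple R N.-1)%E.
Variables (Ut dUt Ub dUb : R -> R) (Z : R).
Hypotheses (ht : C11_on a b Ut dUt) (hbb : C11_on a b Ub dUb).
Local Notation f := (fun p => Z * @potential_weight R N theta Ut Ub p * \1_I p).
Hypothesis f1 : (\int[mu]_p (f p)%:E = 1)%E.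
Variables (d : measure_display) (T : measurableType d) (P : probability T R) (XY : T -> space).
Hypothesis mXY : measurable_fun setT XY.
Hypothesis law : forall A, measurable A -> (P (XY @^-1` A) = \int[mu]_(p in A) (f p)%:E)%E.
Let D := XY @^-1` I.

Section Part.
Variable g : C -> R.
Hypothesis hg : g = @complex.Re R \/ g = @complex.Im R.

Let gD x y : g (x + y) = g x + g y.
Proof. by case: hg => ->; rewrite ?ReD ?ImD. Qed.
Let g0 : g 0 = 0. Proof. by case: hg => ->. Qed.
Let gZ (r : R) z : g (r%:C * z) = r * g z.
Proof. by case: hg => ->; rewrite ?ReM ?ImM /= mul0r ?subr0 ?addr0. Qed.
Let gN z : g (- z) = - g z.
Proof. by case: hg => ->; rewrite ?ReN ?ImN. Qed.
Let gsum n (pr : pred 'I_n) (F : 'I_n -> C) :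
  g (\sum_(i < n | pr i) F i) = \sum_(i < n | pr i) g (F i).
Proof. exact: (big_morph g gD g0). Qed.
Let gle z : `|g z| <= cabs z.
Proof. by case: hg => ->; rewrite ?Re_le_cabs ?Im_le_cabs. Qed.
Let gmeas d' (T' : measurableType d') (F : T' -> C) : cmeas setT F ->
  measurable_fun setT (fun w => g (F w)).
Proof. by case: hg => -> []. Qed.

Lemma part_loop_rate p : g (complex_loop_rate dUt dUb p) =
  loop_rate theta (fun x => g (H x)) (fun x y => g (Q x y)) dUt dUb p.
Proof.
rewrite /complex_loop_rate !gD !gsum /loop_rate; congr (_ + _ + _ + _ + _ + (_ + _)).
- by apply: eq_bigr => i _; rewrite gsum.
- by apply: eq_bigr => i _; rewrite gsum.
- by apply: eq_bigr => i _; rewrite gsum; apply: eq_bigr => j _; rewrite gZ.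
- by apply: eq_bigr => i _; rewrite gN !gZ.
- by apply: eq_bigr => i _; rewrite gN !gZ.
Qed.

(** A flow on the line needs a real vector field. As the loop equation is
    linear in the field, it holds for the complex field as soon as it holds
    for its real and imaginary parts. *)
Lemma part_loop_equation : \int[P]_(w in D) g (complex_loop_rate dUt dUb (XY w)) = 0.
Proof.
have [K K0 hK] := loop_quotient_bound.
have [aab bab] : a \in `[a, b] /\ b \in `[a, b] by rewrite !bound_itvE !ltW.
have va := vab aab; have vb := vab bab.
under eq_Rintegral do rewrite part_loop_rate.
apply: (@real_loop_equation _ _ _ _ _ _ _ K N0 theta0 ab _ K0 _ _ _ _ _ _ _ _ _ _ _ _ ht hbb f1) => //.
- move=> x y xab yab; rewrite -gN -gD loop_fieldB ?vab// -rmorphB gZ//.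
- by move=> x y xab yab; rewrite (le_trans (gle _))// hK.
- by rewrite loop_field_am.
- by rewrite loop_field_ap.
- exact: gmeas cmeas_loop_field.
- exact: gmeas cmeas_loop_quotient.
- by move=> t /cder_loop_field; case: hg => -> [].
- by move=> t /ccont_loop_quotient; case: hg => -> [].
Qed.

End Part.

Lemma complex_loop_equation : CI P D (fun w => complex_loop_rate dUt dUb (XY w)) = 0.
Proof.
apply: complexP; rewrite /= part_loop_equation//; first by left.
by right.
Qed.

End Law.

(** Sums of products of resolvents are polynomials in Stieltjes transforms
    and their derivatives. The constants - 1 / p v of the quotients add up
    over the N (N + 1) / 2 pairs i <= j of the first species, the N (N - 1) /
    2 pairs of the second one, and, with weight theta - 1, the N (N - 1)
    mixed pairs. *)
Lemma complex_loop_rateE dUt dUb (p : space) : in_box a b p.1 -> in_box a b p.2 ->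
  complex_loop_rate dUt dUb p =
  stieltjes_sum p.1 v ^+ 2 / 2 + stieltjes_sum p.2 v ^+ 2 / 2 +
  (\sum_(i < N) (v - (tnth p.1 i)%:C)^-1 ^+ 2 +
   \sum_(i < N.-1) (v - (tnth p.2 i)%:C)^-1 ^+ 2) / 2 -
  (1 - theta%:C) * (stieltjes_sum p.1 v * stieltjes_sum p.2 v) -
  (N%:R ^+ 2 - (1 - theta%:C) * N%:R * (N%:R - 1)) / pv -
  N%:R * theta%:C * (field_sum a b v dUt p.1 + field_sum a b v dUb p.2).
Proof.
move=> b1 b2; rewrite /complex_loop_rate.
have vand n (t : n.-tuple R) : \sum_(i < n) \sum_(j < n | (i < j)%N) Q (tnth t j) (tnth t i) =
    (stieltjes_sum t v ^+ 2 - \sum_(i < n) (v - (tnth t i)%:C)^-1 ^+ 2) / 2 -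
    n%:R * (n%:R - 1) / 2 * pv^-1.
  rewrite -pair_sum_cst -pair_sum -sumrB; apply: eq_bigr => i _.
  by rewrite -sumrB.
have jac n (t : n.-tuple R) : \sum_(i < n) Q (tnth t i) (tnth t i) =
    \sum_(i < n) (v - (tnth t i)%:C)^-1 ^+ 2 - n%:R * pv^-1.
  by rewrite sumrB sumr_const card_ord mulr_natl.
have pot (dU : R -> R) n (t : n.-tuple R) : complex_potential_rate dU t =
    - (N%:R * theta%:C * field_sum a b v dU t).
  rewrite /complex_potential_rate /field_sum mulr_sumr -sumrN; apply: eq_bigr => i _.
  by rewrite rmorphM rmorph_nat [_%:C * H _]mulrC.
have cross : \sum_(i < N.-1) \sum_(j < N) (theta - 1)%:C * Q (tnth p.2 i) (tnth p.1 j) =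
    (theta%:C - 1) * (stieltjes_sum p.1 v * stieltjes_sum p.2 v - N%:R * (N%:R - 1) * pv^-1).
  rewrite (eq_bigr (fun i => (theta%:C - 1) * ((v - (tnth p.2 i)%:C)^-1 * stieltjes_sum p.1 v - N%:R * pv^-1))); last first.
    move=> i _; rewrite -mulr_sumr rmorphB rmorph1; congr (_ * _).
    by rewrite /loop_quotient sumrB -mulr_sumr sumr_const card_ord mulr_natl.
  rewrite -mulr_sumr sumrB -mulr_suml sumr_const card_ord -[_ *+ _]mulr_natl.
  have -> : N.-1%:R = N%:R - 1 :> C by rewrite -[in RHS](prednK N0) -natr1 addrK.
  by rewrite -/(stieltjes_sum p.2 v); ring.
rewrite !vand !jac !pot cross.
have -> : N.-1%:R = N%:R - 1 :> C by rewrite -[in RHS](prednK N0) -natr1 addrK.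
set A := stieltjes_sum p.1 v; set B := stieltjes_sum p.2 v.
set A2 := \sum_(i < N) _; set B2 := \sum_(i < N.-1) _.
set F1 := field_sum _ _ _ _ _; set F2 := field_sum _ _ _ _ _.
set P1 := pv^-1; set n : C := N%:R; set t := theta%:C.
by field.
Qed.

End ComplexLoop.

(** * The loop equation for Stieltjes transforms *)

(** Interlacing configurations lie in [am, ap], where the restricted
    potentials agree with V^t and V^b. *)
Lemma weight_restricted {R : realType} (N : nat) (theta am ap : R) (Vt Vb : R[i] -> R[i]) Zc p :
  (0 < N)%N ->
  density N theta am ap Vt Vb Zc p =
  Zc^-1 * potential_weight theta (restricted_real am ap Vt) (restricted_real am ap Vb) p * \1_(interlacing N am ap) p.
Proof.
move=> N0; rewrite /density indicE; have [/set_mem Ip|] := boolP (p \in _); last by rewrite !mulr0.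
have [b1 b2] := interlacing_box N0 Ip; congr (_ * _ * _); rewrite /weight /potential_weight.
congr (_ * _ * _); last by apply: eq_bigr => i _; rewrite restricted_realE.
by apply: eq_bigr => i _; rewrite restricted_realE.
Qed.

Theorem theorem1p7 (R : realType) (N : nat) (theta am ap : R)
  (Vt Vb : R[i] -> R[i]) (M : set R[i])
  (d : measure_display) (T : measurableType d) (P : probability T R)
  (X : {RV P >-> N.-tuple R}) (Y : {RV P >-> N.-1.-tuple R}) (Zc : R)
  (v : R[i]) (gamma : R -> R[i])
  (mu := (@lebesgue_tuple R N \x @lebesgue_tuple R N.-1)%E)
  (f := density N theta am ap Vt Vb Zc)
  (Gt := fun z w => stieltjes_sum (X w) z)
  (Gb := fun z w => stieltjes_sum (Y w) z)
  (E := Cexpectation P) :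
  (2 <= N)%N -> 0 < theta -> am < ap ->
  open M -> segment am ap `<=` M ->
  (forall z, M z -> analytic_at Vt z) ->
  (forall z, M z -> analytic_at Vb z) ->
  (forall x : R, M x%:C -> complex.Im (Vt x%:C) = 0) ->
  (forall x : R, M x%:C -> complex.Im (Vb x%:C) = 0) ->
  (\int[mu]_(p in interlacing N am ap) (f p)%:E = 1)%E ->
  (forall A, measurable A ->
     P [set w | A (X w, Y w)] = \int[mu]_(p in A) (f p)%:E)%E ->
  ~ segment am ap v ->
  contour gamma -> positively_oriented gamma ->
  contour_image gamma `<=` M -> contour_interior gamma `<=` M ->
  segment am ap `<=` contour_interior gamma ->
  ~ contour_image gamma v -> ~ contour_interior gamma v ->
  0 = (N%:R * theta%:C) / (2 * 'i%C * pi%:C) *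
        contour_integral gamma (fun z =>
          (z - am%:C) * (z - ap%:C) / ((z - v) * (v - am%:C) * (v - ap%:C)) *
          (E (Gt z) * derive1 Vt z + E (Gb z) * derive1 Vb z))
      + E (fun w => Gt v w ^+ 2) / 2 + E (fun w => Gb v w ^+ 2) / 2
      - (derive1 (fun u => E (Gt u)) v + derive1 (fun u => E (Gb u)) v) / 2
      - (1 - theta%:C) * E (fun w => Gt v w * Gb v w)
      - (N%:R ^+ 2 - (1 - theta%:C) * N%:R * (N%:R - 1)) /
          ((v - am%:C) * (v - ap%:C)).
Proof.
move=> N2 theta0 ab openM segM anVt anVb reVt reVb f1 law nsv cg po imM intM segI nv niv.
have N0 : (0 < N)%N by exact: ltnW.
have holoVt z : M z -> holo Vt z by move=> /anVt/analytic_holo.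
have holoVb z : M z -> holo Vb z by move=> /anVb/analytic_holo.
have Mseg x : x \in `[am, ap] -> M x%:C by move=> xab; apply: segM; exists x.
have seg x : x \in `[am, ap] -> contour_interior gamma x%:C by move=> xab; apply: segI; exists x.
have vab (x : R) : x \in `[am, ap] -> v != x%:C.
  by move=> xab; apply/eqP => vx; apply: nsv; rewrite vx; exists x.
have [aab bab] : am \in `[am, ap] /\ ap \in `[am, ap] by rewrite !bound_itvE !ltW.
have va := vab _ aab; have vb := vab _ bab.
have K_M z : contour_image gamma z \/ contour_interior gamma z -> M z by case=> [/imM|/intM].
have dVt z : contour_image gamma z \/ contour_interior gamma z -> holo (derive1 Vt) z.
  by move=> /K_M/holoVt/holo_deriv[].
have dVb z : contour_image gamma z \/ contour_interior gamma z -> holo (derive1 Vb) z.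
  by move=> /K_M/holoVb/holo_deriv[].
have hVt x : x \in `[am, ap] -> holo Vt x%:C by move=> /Mseg/holoVt.
have hVb x : x \in `[am, ap] -> holo Vb x%:C by move=> /Mseg/holoVb.
pose dUt := restricted_real am ap (derive1 Vt); pose dUb := restricted_real am ap (derive1 Vb).
have ct : C11_on am ap _ dUt := C11_restricted hVt.
have cb : C11_on am ap _ dUb := C11_restricted hVb.
have dUtE x : x \in `[am, ap] -> derive1 Vt x%:C = (dUt x)%:C.
  by move=> xab; rewrite (real_derive1 hVt openM segM reVt)// /dUt restricted_realE.
have dUbE x : x \in `[am, ap] -> derive1 Vb x%:C = (dUb x)%:C.
  by move=> xab; rewrite (real_derive1 hVb openM segM reVb)// /dUb restricted_realE.
have mX : measurable_fun setT (fun w => X w) by exact: measurable_funPT.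
have mY : measurable_fun setT (fun w => Y w) by exact: measurable_funPT.
pose XY w := (X w, Y w); have mXY : measurable_fun setT XY by exact: measurable_fun_pair.
pose g p := Zc^-1 * potential_weight theta (restricted_real am ap Vt) (restricted_real am ap Vb) p *
  \1_(interlacing N am ap) p.
have fg p : f p = g p by exact: weight_restricted.
have g1 : (\int[mu]_p (g p)%:E = 1)%E.
  rewrite -f1 [RHS]integral_mkcond; apply: eq_integral => p _.
  by rewrite patchE fg /g indicE; case: (p \in _); rewrite ?mulr0.
have lawg A : measurable A -> (P (XY @^-1` A) = \int[mu]_(p in A) (g p)%:E)%E.
  by move=> mA; rewrite law//; apply: eq_integral => p _; rewrite fg.
pose D := XY @^-1` interlacing N am ap.
have mD : measurable D.
  by rewrite -[D]setTI; apply: mXY => //; exact: measurable_interlacing.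
have PD : P D = 1%E by exact: (law_support g1 lawg).
have fD := support_lty PD.
have XD w : D w -> in_box am ap (X w) by move=> /(interlacing_box N0)[].
have YD w : D w -> in_box am ap (Y w) by move=> /(interlacing_box N0)[].
have LC : CI P D (fun w => complex_loop_rate theta am ap v dUt dUb (XY w)) = 0.
  exact: (complex_loop_equation N0 theta0 ab vab ct cb g1 mXY lawg).
have [_ mdUt [Kt _ [_ _ [hKt _]]]] := ct; have [_ mdUb [Kb _ [_ _ [hKb _]]]] := cb.
have [r r0 farv] := point_distance vab.
have -> := contour_stieltjes mD PD mX mY XD YD cg po dVt dVb seg nv niv va vb mdUt mdUb hKt hKb dUtE dUbE.
rewrite (derive_stieltjes mD PD mX XD r0 farv) (derive_stieltjes mD PD mY YD r0 farv).
have cX := cmeas_stieltjes (W := X) mX setT v; have cY := cmeas_stieltjes (W := Y) mY setT v.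
rewrite /E !(Cexpectation_support mD PD); [|exact: cmeasM|exact: cmeasX|exact: cmeasX].
have bX := cbm_stieltjes mX XD r0 farv; have bY := cbm_stieltjes mY YD r0 farv.
have bX2 : cbm D (fun w => \sum_(i < N) (v - (tnth (X w) i)%:C)^-1 ^+ 2).
  by apply: cbm_sum => i; apply: cbmX; exact: (cbm_resolvent mX XD r0 farv).
have bY2 : cbm D (fun w => \sum_(i < N.-1) (v - (tnth (Y w) i)%:C)^-1 ^+ 2).
  by apply: cbm_sum => i; apply: cbmX; exact: (cbm_resolvent mY YD r0 farv).
have bF : cbm D (fun w => field_sum am ap v dUt (X w) + field_sum am ap v dUb (Y w)).
  apply: cbmD; first exact: (cbm_field_sum seg niv mdUt hKt mX XD).
  exact: (cbm_field_sum seg niv mdUb hKb mY YD).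
pose A w := stieltjes_sum (X w) v; pose B w := stieltjes_sum (Y w) v.
pose A2 w : R[i] := \sum_(i < N) (v - (tnth (X w) i)%:C)^-1 ^+ 2.
pose B2 w : R[i] := \sum_(i < N.-1) (v - (tnth (Y w) i)%:C)^-1 ^+ 2.
pose Fl w := field_sum am ap v dUt (X w) + field_sum am ap v dUb (Y w).
pose pv := (v - am%:C) * (v - ap%:C).
pose k := - ((N%:R ^+ 2 - (1 - theta%:C) * N%:R * (N%:R - 1)) / pv).
have bZ (c : R[i]) h : cbm D h -> cbm D (fun w => c * h w) by move=> bh; apply: cbmM => //; exact: cbm_cst.
have bA : cbm D (fun w => A w ^+ 2) by exact: cbmX.
have bB : cbm D (fun w => B w ^+ 2) by exact: cbmX.
have bAB : cbm D (fun w => A w * B w) by exact: cbmM.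
(* the loop equation as a linear combination of expectations *)
move: LC; rewrite (CI_eq _ (g := fun w => 2^-1 * A w ^+ 2 + 2^-1 * B w ^+ 2 + 2^-1 * A2 w + 2^-1 * B2 w +
  - (1 - theta%:C) * (A w * B w) + - (N%:R * theta%:C) * Fl w + k)); last first.
  move=> w Dw; rewrite complex_loop_rateE//; [|exact: XD|exact: YD].
  by rewrite /k /pv /Fl /A /B /A2 /B2 /=; ring.
have b1 := bZ 2^-1 _ bA; have b2 := bZ 2^-1 _ bB; have b3 := bZ 2^-1 _ bX2; have b4 := bZ 2^-1 _ bY2.
have b5 := bZ (- (1 - theta%:C)) _ bAB; have b6 := bZ (- (N%:R * theta%:C)) _ bF.
have b12 := cbmD b1 b2; have b13 := cbmD b12 b3; have b14 := cbmD b13 b4; have b15 := cbmD b14 b5.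
have b16 := cbmD b15 b6.
have e2 := CID (mu := P) mD fD b1 b2; have e3 := CID (mu := P) mD fD b12 b3.
have e4 := CID (mu := P) mD fD b13 b4; have e5 := CID (mu := P) mD fD b14 b5.
have e6 := CID (mu := P) mD fD b15 b6; have e7 := CID (mu := P) mD fD b16 (cbm_cst _ k).
move=> LC; have := etrans (esym e7) LC; rewrite e6 e5 e4 e3 e2 !(CIZ (mu := P) mD fD)//.
rewrite (CI_cst P mD) (_ : fine _ = 1); last exact: (congr1 fine PD).
rewrite mulr1 => sum0.
have {sum0} : 2^-1 * CI P D (fun w => Gt v w ^+ 2) + 2^-1 * CI P D (fun w => Gb v w ^+ 2) +
  2^-1 * CI P D A2 + 2^-1 * CI P D B2 + - (1 - theta%:C) * CI P D (fun w => Gt v w * Gb v w) +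
  - (N%:R * theta%:C) * CI P D Fl + k = 0 := sum0.
have tpi := @two_pi_i_neq0 R.
have pv0 : pv != 0 by rewrite mulf_neq0// subr_eq0.
set x1 := CI P D (fun w => Gt v w ^+ 2); set x2 := CI P D (fun w => Gb v w ^+ 2).
set x3 := CI P D A2; set x4 := CI P D B2; set x5 := CI P D (fun w => Gt v w * Gb v w).
set x6 := CI P D Fl; move: (x1) (x2) (x3) (x4) (x5) (x6) => {}x1 {}x2 {}x3 {}x4 {}x5 {}x6.
rewrite /k -/pv; move: (2 * 'i%C * pi%:C) tpi => tpi tpi0 <-.
by field; rewrite pv0 tpi0.
Qed.
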